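(* Let $\Omega$ be a bounded domain of $\mathbb{R}^N$ with smooth (at least $C^2$) boundary, let $p>2$, assume that $q>p$, and define $r:=q/(q-p)$. There is a positive real number $\kappa$ depending on $\Omega$, $p$, and $q$ such that, for every $u_0\in C_0(\bar\Omega)$ with $u_0\ge 0$, $u_0\not\equiv 0$: if $\|u_0\|_{r+1}>\kappa$, then the problem $$\partial_t u-\Delta_p u=|\nabla u|^q \ \text{ in } (0,\infty)\times\Omega,\qquad u=0 \ \text{ on } (0,\infty)\times\partial\Omega,\qquad u(0)=u_0 \ \text{ in } \Omega,$$ has no global weak solution.
   Context: Notation: $C_0(\bar\Omega):=\{z\in C(\bar\Omega): z=0 \text{ on } \partial\Omega\}$; $\|\cdot\|_{r+1}$ is the $L^{r+1}(\Omega)$ norm; $\Delta_p u:=\operatorname{div}(|\nabla u|^{p-2}\nabla u)$. A (global) weak solution to the initial-boundary value problem $$\partial_t u-\Delta_p u=|\nabla u|^q \ \text{ in } (0,\infty)\times\Omega,\qquad u=0 \ \text{ on } (0,\infty)\times\partial\Omega,\qquad u(0)=u_0 \ \text{ in } \Omega,$$ is a nonnegative function $u\in C([0,\infty)\times\bar\Omega)$, with $u=0$ on $(0,\infty)\times\partial\Omega$ and $u(0,\cdot)=u_0$, which belongs to $L^\infty(0,T;W^{1,\infty}(\Omega))$ for every $T>0$ and satisfies $$\frac{d}{dt}\int_\Omega u(t,x)\,\psi(x)\,dx=\int_\Omega\left(-|\nabla u(t,x)|^{p-2}\,\nabla u(t,x)\cdot\nabla\psi(x)+|\nabla u(t,x)|^q\,\psi(x)\right)dx$$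 on $(0,T)$ (in the sense of distributions in time) for any $\psi\in H^1_0(\Omega)$ and $T>0$. *)

(* Defs.v *)
From HB Require Import structures.
From mathcomp Require Import all_boot all_order all_algebra.
From mathcomp Require Import all_classical all_reals all_analysis.
Set Implicit Arguments.
Unset Strict Implicit.
Unset Printing Implicit Defensive.
Import Order.TTheory GRing.Theory Num.Theory.
Import numFieldNormedType.Exports.
Local Open Scope classical_set_scope.
Local Open Scope ring_scope.

(* The sigma-algebra on R^n is the one generated by the coordinates, i.e. the
   n-fold product of the Borel sigma-algebra of R. *)
Definition rV_display : measure_display.
Proof. exact: default_measure_display. Qed.

Section measurable_rV.
Context (R : realType) (n : nat).

Definition rV_coord (i : 'I_n) (v : 'rV[R]_n) : measurableTypeR R := v ord0 i.

Let rV_set0 : g_sigma_preimage rV_coord set0.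
Proof. exact: sigma_algebra0. Qed.

Let rV_setC A : g_sigma_preimage rV_coord A -> g_sigma_preimage rV_coord (~` A).
Proof. exact: sigma_algebraC. Qed.

Let rV_bigcup (F : (set 'rV[R]_n)^nat) :
  (forall i, g_sigma_preimage rV_coord (F i)) ->
  g_sigma_preimage rV_coord (\bigcup_i (F i)).
Proof. exact: sigma_algebra_bigcup. Qed.

HB.instance Definition _ := @isMeasurable.Build rV_display
  'rV[R]_n (g_sigma_preimage rV_coord) rV_set0 rV_setC rV_bigcup.

Lemma measurable_rV_coord (i : 'I_n) : measurable_fun setT (rV_coord i).
Proof.
move=> _ Y mY; rewrite setTI; apply: sub_sigma_algebra => /=.
rewrite -bigcup_seq/=; exists i => /=; first by rewrite mem_index_enum.
by exists Y => //; rewrite setTI.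
Qed.

Lemma measurable_fun_rVP d (T : measurableType d) (f : T -> 'rV[R]_n) :
  measurable_fun setT f <->
  forall i, measurable_fun setT (rV_coord i \o f).
Proof.
split=> [mf i|mf]; first exact: (measurableT_comp (measurable_rV_coord i) mf).
apply: (@measurability _ _ _ _ setT f
  (\big[setU/set0]_(i < n) preimage_set_system setT (rV_coord i) measurable)).
  by [].
move=> _ [B + <-]; rewrite -bigcup_seq => -[i /= _ [A mA <-]].
by rewrite !setTI -comp_preimage -[X in measurable X]setTI; exact: mf.
Qed.

End measurable_rV.

(* Lebesgue measure on R^n, by recursion: the Dirac mass on R^0, and the image
   of the product of the measures of R and R^n under (a, v) |-> (a | v) on
   R^(1+n). *)
Section lebesgue_rV_rec.
Context (R : realType) (n : nat).

Definition rV_cons (z : measurableTypeR R * 'rV[R]_n) : 'rV[R]_n.+1 :=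
  \row_j oapp (z.2 ord0) z.1 (unlift ord0 j).

Definition rV_uncons (v : 'rV[R]_n.+1) : measurableTypeR R * 'rV[R]_n :=
  (v ord0 ord0, \row_j v ord0 (lift ord0 j)).

Lemma rV_cons0 z : rV_cons z ord0 ord0 = z.1.
Proof. by rewrite mxE unlift_none. Qed.

Lemma rV_consS z j : rV_cons z ord0 (lift ord0 j) = z.2 ord0 j.
Proof. by rewrite mxE liftK. Qed.

Lemma rV_consK : cancel rV_cons rV_uncons.
Proof.
move=> [a v]; rewrite /rV_uncons rV_cons0; congr pair.
by apply/rowP => j; rewrite mxE rV_consS.
Qed.

Lemma rV_unconsK : cancel rV_uncons rV_cons.
Proof.
move=> v; apply/rowP => j; case: (unliftP ord0 j) => [k ->|->].
  by rewrite rV_consS mxE.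
by rewrite rV_cons0.
Qed.

Lemma measurable_rV_cons : measurable_fun setT rV_cons.
Proof.
apply/measurable_fun_rVP => i; case: (unliftP ord0 i) => [k ->|->].
  rewrite (_ : _ \o _ = rV_coord k \o snd).
    exact: (measurableT_comp (measurable_rV_coord k) measurable_snd).
  by apply/funext => z; rewrite /= /rV_coord rV_consS.
rewrite (_ : _ \o _ = fst); first exact: measurable_fst.
by apply/funext => z; rewrite /= /rV_coord rV_cons0.
Qed.

Lemma measurable_rV_uncons : measurable_fun setT rV_uncons.
Proof.
apply: measurable_fun_pair; first exact: (@measurable_rV_coord R n.+1 ord0).
apply/measurable_fun_rVP => i.
rewrite (_ : _ \o _ = @rV_coord R n.+1 (lift ord0 i)).
  exact: measurable_rV_coord.
by apply/funext => z; rewrite /= /rV_coord mxE.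
Qed.

Variable m : {sigma_finite_measure set 'rV[R]_n -> \bar R}.

Definition lebesgue_cons : set 'rV[R]_n.+1 -> \bar R :=
  pushforward (lebesgue_measure \x m)%E rV_cons.

HB.instance Definition _ := Measure.copy lebesgue_cons
  (measure_function_pushforward__canonical__measure_function_Measure
     (lebesgue_measure \x m)%E measurable_rV_cons).

Let lebesgue_cons_sigma_finite : sigma_finite setT lebesgue_cons.
Proof.
have /sigma_finiteP[F [TF ndF Foo]] := sigma_finiteT (@lebesgue_measure R).
have /sigma_finiteP[G [TG ndG Goo]] := sigma_finiteT m.
exists (fun k => rV_uncons @^-1` (F k `*` G k)).
  rewrite -preimage_bigcup (_ : \bigcup_k _ = setT) ?preimage_setT//.
  rewrite -subTset => -[x y] _.
  have [k _ Fx] : (\bigcup_k F k) x by rewrite -TF.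
  have [l _ Gy] : (\bigcup_l G l) y by rewrite -TG.
  exists (maxn k l) => //; split => /=.
  - by move: x Fx; exact/subsetPset/ndF/leq_maxl.
  - by move: y Gy; exact/subsetPset/ndG/leq_maxr.
move=> k; have [mF Fk] := Foo k; have [mG Gk] := Goo k; split.
  rewrite -[X in measurable X]setTI; apply: measurable_rV_uncons => //.
  exact: measurableX.
rewrite /lebesgue_cons /pushforward -comp_preimage (_ : _ \o _ = id).
  by rewrite preimage_id product_measure1E// lte_mul_pinfty// ge0_fin_numE.
by apply/funext => z; exact: rV_consK.
Qed.

HB.instance Definition _ := Measure_isSigmaFinite.Build _ _ _ lebesgue_cons
  lebesgue_cons_sigma_finite.

End lebesgue_rV_rec.

Fixpoint lebesgue_rV (R : realType) (n : nat) :
    {sigma_finite_measure set 'rV[R]_n -> \bar R} :=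
  match n with
  | 0 => \d_(0 : 'rV[R]_0)
  | n'.+1 => lebesgue_cons (lebesgue_rV R n')
  end.
Arguments lebesgue_rV {R n}.

Definition enorm (R : realType) n (v : 'rV[R]_n) : R :=
  Num.sqrt (\sum_i v ord0 i ^+ 2).

Definition edot (R : realType) n (v w : 'rV[R]_n) : R :=
  \sum_i v ord0 i * w ord0 i.

Definition partial (R : realType) n (i : 'I_n) (f : 'rV[R]_n -> R)
    (x : 'rV[R]_n) : R :=
  'D_(delta_mx ord0 i) f x.

Section smooth.
Context (R : realType) (V : normedModType R).

(* In finite dimension this is the class C^k: all directional derivatives of
   order at most k exist and are continuous. *)
Fixpoint Ck (k : nat) (f : V -> R) : Prop :=
  continuous f /\
  match k with
  | 0 => True
  | k'.+1 => forall v : V,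
      (forall x, derivable f x v) /\ Ck k' (fun x => 'D_v f x)
  end.

Definition test_function (U : set V) (phi : V -> R) : Prop :=
  (forall k, Ck k phi) /\
  exists2 K : set V, compact K /\ K `<=` U & forall x, ~ K x -> phi x = 0.

End smooth.

Section domains.
Context (R : realType) (N : nat).
Implicit Type Omega : set 'rV[R]_N.

Definition is_domain Omega : Prop :=
  [/\ Omega !=set0, open Omega & connected Omega].

Definition boundary Omega : set 'rV[R]_N := closure Omega `\` interior Omega.

(* Near each boundary point, Omega is, up to a permutation and a reflection of
   the coordinate axes, the region above the graph of a C^2 function of the
   N - 1 coordinates other than the i-th one ([col' i x]). *)
Definition C2_boundary Omega : Prop :=
  forall x0, boundary Omega x0 ->
  exists (i : 'I_N) (b : bool) (gamma : 'rV[R]_N.-1 -> R),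
    Ck 2 gamma /\
    \forall x \near x0,
      Omega x <-> 0 < (-1) ^+ b * (x ord0 i - gamma (col' i x)).

(* C_0(closure Omega); the values outside the closure are irrelevant. *)
Definition C0bar Omega (z : 'rV[R]_N -> R) : Prop :=
  {within closure Omega, continuous z} /\ forall x, boundary Omega x -> z x = 0.

End domains.

Section sobolev.
Context (R : realType) (N : nat) (Omega : set 'rV[R]_N).
Implicit Types (f phi psi : 'rV[R]_N -> R) (g : 'rV[R]_N -> 'rV[R]_N).

Definition Lp_norm (s : \bar R) f : \bar R :=
  'N[lebesgue_rV]_s[EFin \o (f \_ Omega)].

Definition in_Lp (s : \bar R) f : Prop := (f \_ Omega) \in Lfun lebesgue_rV s.

Definition L1loc f : Prop :=
  forall K : set 'rV[R]_N, compact K -> K `<=` Omega ->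
    lebesgue_rV.-integrable K (EFin \o f).

Definition is_weak_gradient f g : Prop :=
  [/\ L1loc f, forall i, L1loc (fun x => g x ord0 i) &
    forall (i : 'I_N) phi, test_function Omega phi ->
      \int[lebesgue_rV]_(x in Omega) (f x * partial i phi x) =
      - (\int[lebesgue_rV]_(x in Omega) (g x ord0 i * phi x))].

(* Some weak gradient of f on Omega when there is one (it is unique up to
   null sets), an unspecified function otherwise. *)
Definition weak_gradient f : 'rV[R]_N -> 'rV[R]_N :=
  get (is_weak_gradient f).

Definition W1_norm (s : \bar R) f : \bar R :=
  (Lp_norm s f + Lp_norm s (fun x => enorm (weak_gradient f x)))%E.

Definition in_W1 (s : \bar R) f : Prop :=
  [/\ in_Lp s f,
      is_weak_gradient f (weak_gradient f) &
      forall i, in_Lp s (fun x => weak_gradient f x ord0 i)].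

(* H^1_0(Omega), the closure of the test functions in H^1(Omega). *)
Definition in_H10 psi : Prop :=
  in_W1 2%:E psi /\
  forall eps : R, 0 < eps ->
    exists2 phi, test_function Omega phi &
      (W1_norm 2%:E (fun x => psi x - phi x)%R < eps%:E)%E.

(* The Bochner space L^oo(0, T; W^{1,oo}(Omega)): strong measurability (limit
   almost everywhere of simple functions) and essential boundedness. *)
Definition in_Linfty_W1infty (T : R) (u : R -> 'rV[R]_N -> R) : Prop :=
  (exists s : nat -> R -> ('rV[R]_N -> R),
    [/\ forall n, finite_set (range (s n)),
        forall n f, measurable (s n @^-1` [set f] : set (measurableTypeR R)),
        forall n t, in_W1 +oo%E (s n t) &
        {ae lebesgue_measure, forall t : R, `]0, T[%classic t ->
          W1_norm +oo%E (fun x => u t x - s n t x)%R @[n --> \oo] --> 0%E}]) /\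
  (exists M : R,
    {ae lebesgue_measure, forall t : R, `]0, T[%classic t ->
      in_W1 +oo%E (u t) /\ (W1_norm +oo%E (u t) <= M%:E)%E}).

End sobolev.

Section weak_solutions.
Context (R : realType) (N : nat) (Omega : set 'rV[R]_N) (p q : R).

Definition weak_rhs (f psi : 'rV[R]_N -> R) (x : 'rV[R]_N) : R :=
  let df := weak_gradient Omega f x in
  - (enorm df `^ (p - 2) * edot df (weak_gradient Omega psi x))
  + enorm df `^ q * psi x.

Definition global_weak_solution (u0 : 'rV[R]_N -> R) (u : R -> 'rV[R]_N -> R)
    : Prop :=
  [/\ {within [set z : R * 'rV[R]_N | 0 <= z.1 /\ closure Omega z.2],
        continuous (fun z : R * 'rV[R]_N => u z.1 z.2)},
      forall t x, 0 <= t -> closure Omega x -> 0 <= u t x,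
      forall t x, 0 < t -> boundary Omega x -> u t x = 0,
      forall x, closure Omega x -> u 0 x = u0 x &
      forall T : R, 0 < T ->
        in_Linfty_W1infty Omega T u /\
        forall psi, in_H10 Omega psi ->
        forall theta : R -> R, test_function `]0, T[%classic theta ->
          - (\int[lebesgue_measure]_(t in `]0, T[%classic)
               (derive1 theta t *
                (\int[lebesgue_rV]_(x in Omega) (u t x * psi x)))) =
          \int[lebesgue_measure]_(t in `]0, T[%classic)
              (theta t *
               (\int[lebesgue_rV]_(x in Omega) weak_rhs (u t) psi x))].

End weak_solutions.

(* Main.v *)
(** For a solution [u] put [y(t) = ∫ u(t)^(r+1)].  Testing the equation with [u^r] gives
    [y' >= (r+1) ∫ (|Du|^q u^r - r u^(r-1) |Du|^p)].  Since [r = q/(q-p)], Young's inequality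
    absorbs the negative term into half of the positive one up to a constant, and a Poincaré
    inequality (integrate [∂_i (x_i u^(r+q))] over [R^n]) bounds [∫ u^(r+q)] by a multiple of
    [∫ |Du|^q u^r].  Hence [y' >= c y^(1+alpha) - C] with [alpha = (q-1)/(r+1) > 0] and constants
    depending on Omega, p, q only, so that [y] blows up in finite time when [y(0)] is large.

    As [u^r] is not an admissible test function, the differential inequality is obtained in
    integrated form on a partition [t_j]: by convexity
    [y(t_(j+1)) - y(t_j) >= (r+1) ∫ u(t_j)^r (u(t_(j+1)) - u(t_j))], where [u(t_j)^r] is replaced
    by test functions with uniformly bounded gradients; these gradients converge weakly as the
    partition gets finer, because [u] is bounded in [W^(1,oo)] and uniformly continuous. *)
Require Import Defs.
From mathcomp Require Import all_boot all_order all_algebra.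
From mathcomp Require Import all_classical all_reals all_analysis.
From mathcomp Require Import measurable_realfun ess_sup_inf.
From mathcomp Require Import ring lra.
Set Implicit Arguments.
Unset Strict Implicit.
Unset Printing Implicit Defensive.
Import Order.TTheory GRing.Theory Num.Theory.
Import numFieldNormedType.Exports.
Local Open Scope classical_set_scope.
Local Open Scope ring_scope.

(** * Lebesgue measure on R^n *)

Section rV_norm.
Context (R : realType) (n : nat).
Implicit Types x y : 'rV[R]_n.

(** Freezing the test function at the left end of each time step fits both constraints: admissible
    test functions do not depend on time, and the tangent inequality for the convex function
    [u^(r+1)] asks for exactly the factor [u(t_j)^r]. The test function enters the right-hand side
    linearly, so weak convergence of its gradient, against the bounded field [|Du|^(p-2) Du], is
    enough; the weak limit is [D(u^r)] by the chain rule.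

    Uniform gradient bounds for the approximations require [u(t)], extended by zero, to be Lipschitz
    on all of [R^n] and at every time, whereas the data bound the gradient only inside Omega and
    almost everywhere. Coordinate lines settle this: where a segment leaves Omega, [u] has come down
    to 0 at the slope allowed by the gradient bound.

    The gradient in the formulation is an arbitrary choice, so integrands are compared up to null
    sets without assuming measurability. Measurability in time of the right-hand side comes from the
    strong measurability of [u] with values in [W^(1,oo)]. The differential inequality holds at
    positive times only; continuity of the energy carries it to the initial datum. *)

Lemma rV_norm_lt x (e : R) : 0 < e -> (`|x| < e <-> forall i, `|x ord0 i| < e).
Proof.
move=> e0; have := @mx_norm_ball R 1 n; move=> /(congr1 (fun f => f x e 0)).
rewrite /ball /= /ball_ /= subr0 => <-; split.
  by move=> [_ h] i; have := h ord0 i; rewrite /ball/= mxE subr0.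
move=> h; split => // i j; rewrite (ord1 i) /ball/= mxE subr0; exact: h.
Qed.

Lemma rV_norm_le x (e : R) : 0 <= e -> (`|x| <= e <-> forall i, `|x ord0 i| <= e).
Proof.
move=> e0; split => [h i|h].
  rewrite leNgt; apply/negP => hi.
  have := @rV_norm_lt x `|x ord0 i| (le_lt_trans e0 hi).
  by move=> [/(_ (le_lt_trans h hi))/(_ i)]; rewrite ltxx.
apply/ler_addgt0Pr => d d0; apply/ltW/rV_norm_lt; first by rewrite ltr_wpDl.
by move=> i; apply: (le_lt_trans (h i)); rewrite ltrDl.
Qed.

Lemma coord_le_norm x i : `|x ord0 i| <= `|x|.
Proof. exact: (rV_norm_le x (normr_ge0 x)).1. Qed.

End rV_norm.

Section open_measurable.
Context (R : realType) (n : nat).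

Let rV := 'rV[R]_n.

Lemma measurable_rV_ball (x : rV) (e : R) : measurable (ball x e).
Proof.
have [e0|e0] := ltP 0 e; last by rewrite (le0_ball0 x e0).
rewrite (_ : ball x e = \big[setI/setT]_(i < n)
   (rV_coord i @^-1` (ball (x ord0 i) e))).
  apply: bigsetI_measurable => i _; rewrite -[X in measurable X]setTI.
  by apply: measurable_rV_coord => //; apply: open_measurable; exact: (@ball_open R R).
rewrite -bigcap_seq; apply/seteqP; split => y.
  rewrite -ball_normE /= => /(rV_norm_lt _ e0) h i _.
  by have := h i; rewrite /ball /= /rV_coord !mxE.
move=> h; rewrite -ball_normE /=; apply/(rV_norm_lt _ e0) => i.
by have := h i; rewrite /ball /= /rV_coord !mxE mem_index_enum; apply.
Qed.

Lemma rat_approx (x : rV) (e : R) : 0 < e ->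
  exists c : 'rV[rat]_n, `|x - map_mx ratr c| < e.
Proof.
move=> e0.
have h i : exists c : rat, `|x ord0 i - ratr c| < e.
  have [|c] := @rat_in_itvoo R (x ord0 i - e) (x ord0 i + e).
    by rewrite ltrD2l gt0_cp.
  by rewrite in_itv /= => hc; exists c; rewrite ltr_distlC.
have [f fP] := choice h.
exists (\row_i f i); apply/rV_norm_lt => // i; rewrite !mxE; exact: fP.
Qed.

(** An open set is the countable union of the balls it contains with rational centre and radius
    [1/(m+1)]. [F] lists these balls through [unpickle], with the empty set for every code that is
    not such a ball. *)
Lemma open_measurable_rV (U : set rV) : open U -> measurable U.
Proof.
move=> oU.
pose F (k : nat) : set rV := 
  if (unpickle k : option ('rV[rat]_n * nat)) is Some z then
    (if pselect (ball (map_mx ratr z.1 : rV) (z.2.+1%:R^-1) `<=` U) then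
       ball (map_mx ratr z.1 : rV) (z.2.+1%:R^-1) else set0)
  else set0.
suff -> : U = \bigcup_k F k.
  apply: bigcupT_measurable => k; rewrite /F.
  case: unpickle => [z|//]; case: (pselect _) => //= _.
  exact: measurable_rV_ball.
apply/seteqP; split => x.
  move=> Ux; have /nbhs_ballP[e /= e0 he] := open_nbhs_nbhs (conj oU Ux).
  have [m hm] : exists m : nat, m.+1%:R^-1 < e / 2.
    have /ltr_add_invr[k] : 0 < e / 2 by rewrite divr_gt0.
    by rewrite add0r => hk; exists k.
  have [|c hc] := @rat_approx x (m.+1%:R^-1); first by rewrite invr_gt0.
  exists (pickle (c, m)) => //; rewrite /F pickleK /=.
  case: (pselect _) => [_|[]] /=.
    by rewrite -ball_normE /= distrC.
  move=> y; rewrite -ball_normE /= => hy; apply: he; rewrite -ball_normE /=.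
  rewrite -(subrKA (map_mx ratr c)) (le_lt_trans (ler_normD _ _))//.
  by rewrite (splitr e) ltrD// (lt_trans _ hm)// .
by move=> [k _]; rewrite /F; case: unpickle => [z|//]; case: (pselect _) => //= h /h.
Qed.

Lemma continuous_measurable_rV (f : rV -> R) : continuous f ->
  measurable_fun setT f.
Proof.
move=> cf; apply: (measurability (@RGenOpens.G R)).
  exact: RGenOpens.measurableE.
move=> _ [_ [a [b ->]] <-]; rewrite setTI; apply: open_measurable_rV.
by apply: open_comp => //; exact: interval_open.
Qed.

Lemma measurable_shift_rV (a : rV) : measurable_fun setT (fun x : rV => x + a).
Proof.
apply/measurable_fun_rVP => i.
rewrite (_ : _ \o _ = (fun x => rV_coord i x + (a ord0 i : measurableTypeR R))).
  by apply: measurable_funD => //; exact: measurable_rV_coord.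
by apply/funext => x; rewrite /rV_coord /= !mxE.
Qed.

End open_measurable.

(** The image measure under the translation gives half-open intervals their length, so uniqueness of
    Lebesgue measure applies. *)
Lemma lebesgue_measure_shift (R : realType) (a : R) (A : set R) :
  measurable A ->
  lebesgue_measure ((fun x => x + a) @^-1` A) = lebesgue_measure A.
Proof.
move=> mA.
have ms : measurable_fun setT (fun x : measurableTypeR R => x + a : measurableTypeR R).
  exact: measurable_funD.
apply/esym.
pose nu : {measure set (measurableTypeR R) -> \bar R} :=
  (measure_function_pushforward__canonical__measure_function_Measure
     (@lebesgue_measure R) ms).
apply: (@lebesgue_measure_unique R nu _ A mA) => X [[b c] _ <-].
rewrite /nu /= /pushforward.
rewrite (_ : _ @^-1` _ = [set` `]b - a, c - a]]).
  rewrite !lebesgue_measure_itv /= !lte_fin ltrD2r.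
  by case: ifP => // _; rewrite -!EFinD opprB addrA subrK.
by apply/seteqP; split=> x /=; rewrite !in_itv/= ltrBlDr lerBrDr.
Qed.

Lemma ge0_integral_lebesgue_shift (R : realType) (a : R) (f : R -> \bar R) :
  measurable_fun setT f -> (forall x, 0 <= f x)%E ->
  (\int[lebesgue_measure]_x f (x + a)%R = \int[lebesgue_measure]_x f x)%E.
Proof.
move=> mf f0.
have ms : measurable_fun setT (fun x : measurableTypeR R => x + a : measurableTypeR R).
  exact: measurable_funD.
pose nu : {measure set (measurableTypeR R) -> \bar R} :=
  (measure_function_pushforward__canonical__measure_function_Measure
     (@lebesgue_measure R) ms).
transitivity (\int[nu]_x f x)%E; first by rewrite ge0_integral_pushforward.
apply: eq_measure_integral => A mA _.
by rewrite /nu /= /pushforward lebesgue_measure_shift.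
Qed.

(** By induction on the dimension: the section at [x] of the translated set is a translate of the
    section at [x + a_0] of the original one, which leaves a translation in one real variable. *)
Lemma lebesgue_rV_shift (R : realType) n (a : 'rV[R]_n) (A : set 'rV[R]_n) :
  measurable A ->
  lebesgue_rV ((fun x => x + a) @^-1` A) = lebesgue_rV A.
Proof.
elim: n a A => [|n ih] a A mA.
  congr (lebesgue_rV _); apply/seteqP; split => x /=;
  by rewrite (_ : x + a = x)//; apply/rowP => -[].
have E (B : set 'rV[R]_n.+1) : (lebesgue_rV B = \int[lebesgue_measure]_x
    lebesgue_rV (xsection (@rV_cons R n @^-1` B) x))%E by [].
have mcA : measurable (@rV_cons R n @^-1` A).
  by rewrite -[X in measurable X]setTI; apply: measurable_rV_cons.
pose a' : 'rV[R]_n := \row_j a ord0 (lift ord0 j).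
have rc (x : measurableTypeR R) (y : 'rV[R]_n) :
    rV_cons (x, y) + a = rV_cons (x + a ord0 ord0, y + a').
  by apply/rowP => j; rewrite mxE; case: (unliftP ord0 j) => [k ->|->];
     rewrite ?rV_consS ?rV_cons0 /= ?mxE.
have sec x : xsection (@rV_cons R n @^-1` ((fun z => z + a) @^-1` A)) x =
    (fun y => y + a') @^-1` (xsection (@rV_cons R n @^-1` A) (x + a ord0 ord0)).
  by rewrite !xsectionE; apply/funext => y; rewrite /preimage /= rc.
rewrite 2!E; under eq_integral => x _.
  rewrite sec ih; last exact: measurable_xsection.
  over.
apply: (ge0_integral_lebesgue_shift _ (f := fun x => lebesgue_rV (xsection (@rV_cons R n @^-1` A) x))) => //.
exact: measurable_fun_xsection.
Qed.

(** Measurability suffices: the positive and negative parts are treated separately, and both sides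
    are the same difference of the two integrals. *)
Lemma integral_rV_shift (R : realType) n (a : 'rV[R]_n) (f : 'rV[R]_n -> \bar R) :
  measurable_fun setT f ->
  (\int[lebesgue_rV]_x f (x + a)%R = \int[lebesgue_rV]_x f x)%E.
Proof.
move=> mf; pose s x : 'rV[R]_n := x + a.
have ms : measurable_fun setT s by exact: measurable_shift_rV.
pose nu : {measure set 'rV[R]_n -> \bar R} :=
  (measure_function_pushforward__canonical__measure_function_Measure
     (@lebesgue_rV R n) ms).
have H (g : 'rV[R]_n -> \bar R) : measurable_fun setT g -> (forall x, 0 <= g x)%E ->
    (\int[lebesgue_rV]_x (g \o s) x = \int[lebesgue_rV]_x g x)%E.
  move=> mg g0; transitivity (\int[nu]_x g x)%E.
    by rewrite ge0_integral_pushforward.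
  apply: eq_measure_integral => A mA _.
  by rewrite /nu /= /pushforward lebesgue_rV_shift.
rewrite [LHS]integralE [RHS]integralE -(H f^\+)%E//; last exact: measurable_funepos.
rewrite -(H f^\-)%E//; last exact: measurable_funeneg.
by congr (_ - _)%E; apply: eq_integral => x _ /=; rewrite ?funeposE ?funenegE.
Qed.

Lemma Rintegral_rV_shift (R : realType) n (a : 'rV[R]_n) (f : 'rV[R]_n -> R) :
  measurable_fun setT f ->
  \int[lebesgue_rV]_x f (x + a) = \int[lebesgue_rV]_x f x.
Proof.
move=> mf; rewrite /Rintegral -[in RHS](integral_rV_shift a)//.
exact/measurable_EFinP.
Qed.

(** Balls of the sup norm are cubes, hence products of a one-dimensional ball with a cube of lower
    dimension. *)
Lemma lebesgue_rV_ball0 (R : realType) n (r : R) : 0 < r ->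
  lebesgue_rV (ball (0 : 'rV[R]_n) r) = ((r *+ 2) ^+ n)%:E.
Proof.
move=> r0; elim: n => [|n ih].
  by rewrite /= diracE expr0 mem_set//; exact: ballxx.
rewrite /= /lebesgue_cons /pushforward.
rewrite (_ : _ @^-1` _ = ball (0 : R) r `*` ball (0 : 'rV[R]_n) r); last first.
  apply/seteqP; split => -[x v] /=; rewrite -!ball_normE /= !sub0r !normrN.
    move=> /(rV_norm_lt _ r0) h; split; first by have := h ord0; rewrite rV_cons0.
    by apply/rV_norm_lt => // i; have := h (lift ord0 i); rewrite rV_consS.
  move=> [h1 /(rV_norm_lt _ r0) h2]; apply/rV_norm_lt => // j.
  by case: (unliftP ord0 j) => [k ->|->]; rewrite ?rV_consS ?rV_cons0//; exact: h2.
rewrite product_measure1E; [|apply: open_measurable; exact: (@ball_open R R)|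
  exact: measurable_rV_ball].
rewrite ih [X in (X * _)%E](_ : _ = (r *+ 2)%:E) -?EFinM ?exprS//.
exact: (lebesgue_measure_ball _ (ltW r0)).
Qed.

Lemma bounded_lebesgue_rV (R : realType) n (A : set 'rV[R]_n) (M : R) :
  measurable A -> (forall x, A x -> `|x| <= M) -> (lebesgue_rV A < +oo)%E.
Proof.
move=> mA AM; have M0 : 0 < `|M| + 1 by rewrite ltr_wpDl.
apply: (@le_lt_trans _ _ (lebesgue_rV (ball (0 : 'rV[R]_n) (`|M| + 1)))).
  apply: le_measure; rewrite ?inE//; first exact: measurable_rV_ball.
  move=> x /AM xM; rewrite -ball_normE /= sub0r normrN.
  by rewrite (le_lt_trans xM)// (le_lt_trans (ler_norm M))// ltrDl.
by rewrite lebesgue_rV_ball0 ?ltry.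
Qed.

(** * Smooth functions *)

Section smooth_line.
Context (R : realType).
Implicit Types (a b : R -> R) (k m : nat).

Lemma scaleRE (x y : R) : x *: (y : R^o) = x * y.
Proof. by []. Qed.

(** Class [C^k] on the line with the derivative given as a witness, which makes sums, products and
    affine changes of variable short inductions. [Ck_comp_affine] turns it into [Ck] in several
    variables. *)
Fixpoint Sm k a : Prop :=
  match k with
  | 0 => continuous a
  | k'.+1 => exists2 a', (forall x : R, is_derive x 1 a (a' x)) & Sm k' a'
  end.

Lemma Sm_continuous k a : Sm k a -> continuous a.
Proof.
case: k => [//|k] [a' da _] x; apply: differentiable_continuous.
exact/derivable1_diffP.
Qed.

Lemma SmW k a : Sm k.+1 a -> Sm k a.
Proof.
elim: k a => [|k ih] a; first by move=> h; exact: (Sm_continuous h).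
by move=> [a' da ha]; exists a' => //; exact: ih.
Qed.

Lemma Sm_cst k (c : R) : Sm k (fun=> c).
Proof.
elim: k c => [|k ih] c /=; first exact: cst_continuous.
by exists (fun=> 0); [move=> x; exact: is_derive_cst|exact: ih].
Qed.

Lemma SmD k a b : Sm k a -> Sm k b -> Sm k (fun x => a x + b x).
Proof.
elim: k a b => [|k ih] a b /=.
  by move=> ca cb x; apply: continuousD; [exact: ca|exact: cb].
move=> [a' da ha] [b' db hb]; exists (fun x => a' x + b' x); last exact: ih.
by move=> x; exact: is_deriveD.
Qed.

Lemma SmM k a b : Sm k a -> Sm k b -> Sm k (fun x => a x * b x).
Proof.
elim: k a b => [|k ih] a b.
  by move=> ca cb x; apply: continuousM; [exact: ca|exact: cb].
move=> Ha Hb; have [a' da ha] := Ha; have [b' db hb] := Hb.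
exists (fun x => a x * b' x + b x * a' x).
  by move=> x; exact: is_deriveM.
by apply: SmD; apply: ih => //; exact: SmW.
Qed.

Lemma Sm_affine k a (c d : R) : Sm k a -> Sm k (fun x => a (c * x + d)).
Proof.
elim: k a => [|k ih] a /=.
  move=> ca x; apply: (@continuous_comp _ _ _ (fun x => c * x + d) a); last exact: ca.
  apply: cvgD; last exact: cvg_cst.
  by apply: cvgM; [exact: cvg_cst|exact: cvg_id].
move=> [a' da ha]; exists (fun x => c * a' (c * x + d)); last first.
  by apply: SmM; [exact: Sm_cst|exact: ih].
move=> x.
have h : is_derive x 1 (fun x : R => c * x + d) c.
  have : is_derive x 1 ((cst c : R -> R) \* id + cst d) (c *: 1 + id x *: 0 + 0).
    exact: is_deriveD.
  by rewrite scaler0 !addr0 [_ *: _]mulr1.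
by have := @is_derive1_comp _ a (fun x : R => c * x + d) x _ _ (da (c * x + d)) h; rewrite mulrC.
Qed.

(** The function [s^(-m) exp(-1/s)] extended by 0 to [s <= 0]. The exponent [m] is carried along
    because the derivative of a member of the family is a combination of two others. *)
Definition flat m (s : R) : R := if 0 < s then s^-1 ^+ m * expR (- s^-1) else 0.

Lemma flat_ge0 m s : 0 <= flat m s.
Proof.
rewrite /flat; case: ifP => // s0.
by rewrite mulr_ge0 ?expR_ge0// exprn_ge0// invr_ge0 ltW.
Qed.

(** One term of the exponential series, [exp(1/s) >= s^(-(m+1)) / (m+1)!], beats the pole of order
    [m]. *)
Lemma flat_le m s : 0 <= s -> flat m s <= m.+1`!%:R * s.
Proof.
rewrite le_eqVlt => /predU1P[<-|s0]; first by rewrite /flat ltxx mulr0.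
rewrite /flat s0 expRN ler_pdivrMr ?expR_gt0//.
have /(_ (ltW _))h := @expR_ge1Dxn R s^-1 m.
have {}h : s^-1 ^+ m.+1 / m.+1`!%:R <= expR s^-1.
  by apply: le_trans (h _); rewrite ?lerDr// invr_gt0.
apply: (@le_trans _ _ (m.+1`!%:R * s * (s^-1 ^+ m.+1 / m.+1`!%:R))).
  have fn : m.+1`!%:R != 0 :> R by rewrite pnatr_eq0 -lt0n fact_gt0.
  have sn : s != 0 by rewrite gt_eqF.
  by rewrite le_eqVlt; apply/orP; left; apply/eqP; rewrite exprS; field; rewrite fn.
by rewrite ler_wpM2l// mulr_ge0// ltW.
Qed.

(** Only [s = 0] is not a computation: there the difference quotient is [flat m.+1 h] for [h > 0]
    and 0 for [h < 0], and [flat_le] sends it to 0. *)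
Lemma is_derive_flat m (s : R) :
  is_derive s 1 (flat m) (- m%:R * flat m.+1 s + flat m.+2 s).
Proof.
have [s0|s0|s0] := ltgtP 0 s.
- pose f := (fun x : R => x^-1) ^+ m * (expR \o (- (fun x : R => x^-1))).
  apply: (@near_eq_is_derive _ _ _ f).
    near=> x; rewrite /flat.
    have -> : 0 < x by near: x; exact: lt_nbhsr.
    by rewrite /f /= mulrfctE exprfctE.
  have sn0 : s != 0 by rewrite gt_eqF.
  have hi : is_derive s 1 (fun x : R => x^-1) (- s ^- 2).
    apply: DeriveDef; first by apply: (@derivableV _ _ id); [|exact: derivable_id].
    by rewrite (@deriveV _ _ id)// derive_id [_ *: _]mulr1.
  have he := @is_derive1_comp _ expR (- (fun x : R => x^-1)) s _ _
    (is_derive_expR (- s^-1)) (is_deriveN hi).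
  have := is_deriveM (is_deriveX m hi) he.
  rewrite /flat s0 /=; congr (is_derive _ _ _ _).
  rewrite !scaleRE /= exprfctE opprK.
  rewrite addrC; congr (_ + _).
    case: (m) => [|m']; first by rewrite !mul0r mulr0 oppr0 mul0r.
    by rewrite -[(- _) s]/(- s^-1) /= -exprVn !exprS; ring.
  by rewrite -exprVn !exprS; ring.
- apply: (@near_eq_is_derive _ _ _ (cst 0)).
    near=> x; rewrite /flat ifF//; apply/negbTE; rewrite -leNgt ltW//.
    by near: x; exact: lt_nbhsl.
  rewrite /flat (lt_gtF s0) mulr0 addr0; exact: is_derive_cst.
rewrite -s0 [flat m.+1 0]/flat [flat m.+2 0]/flat ltxx mulr0 addr0.
have h : h^-1 *: ((flat m \o shift 0) (h *: 1) - flat m 0) @[h --> 0^'] --> (0:R).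
  apply/cvgr0Pnorm_le => e e0; near=> h.
  have hn0 : h != 0 by near: h; exact: nbhs_dnbhs_neq.
  rewrite /= addr0 {2}/flat ltxx subr0 !scaleRE mulr1.
  have [h0|h0] := ltP 0 h; last by rewrite /flat ltNge h0/= mulr0 normr0 ltW.
  have -> : h^-1 * flat m h = flat m.+1 h by rewrite /flat h0 exprS mulrA.
  rewrite ger0_norm ?flat_ge0// (le_trans (flat_le _ (ltW h0)))//.
  rewrite mulrC -ler_pdivlMr ?ltr0n ?fact_gt0// -(gtr0_norm h0).
  rewrite -[h]subr0 distrC.
  near: h; apply: nbhs_dnbhs; apply/nbhs_normP; exists (e / m.+2`!%:R).
    by rewrite /= divr_gt0// ltr0n fact_gt0.
  by move=> x /= /ltW.
by apply: DeriveDef; [apply/cvg_ex; exists 0|exact: cvg_lim].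
Unshelve. all: by end_near. Qed.

Lemma Sm_flat k m : Sm k (flat m).
Proof.
elim: k m => [|k ih] m /=.
  move=> x; apply: differentiable_continuous; apply/derivable1_diffP.
  by have [] := is_derive_flat m x.
exists (fun s => - m%:R * flat m.+1 s + flat m.+2 s); first exact: is_derive_flat.
by apply: SmD => //; apply: SmM => //; exact: Sm_cst.
Qed.

(** On []-1, 1[] this is [exp(-2 / (1 - s^2))]; it is even, smooth, and zero elsewhere. *)
Definition bumpR (s : R) : R := flat 0 (1 + s) * flat 0 (1 - s).

Lemma Sm_bumpR k : Sm k bumpR.
Proof.
apply: SmM.
  rewrite (_ : (fun x => _) = (fun x => flat 0 (1 * x + 1))).
    by apply: Sm_affine; exact: Sm_flat.
  by apply/funext => x; rewrite mul1r addrC.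
rewrite (_ : (fun x => _) = (fun x => flat 0 (-1 * x + 1))).
  by apply: Sm_affine; exact: Sm_flat.
by apply/funext => x; rewrite mulN1r addrC.
Qed.

Lemma bumpR_ge0 s : 0 <= bumpR s.
Proof. by rewrite mulr_ge0// flat_ge0. Qed.

Lemma bumpR_eq0 s : 1 <= `|s| -> bumpR s = 0.
Proof.
rewrite ler_normr /bumpR /flat => /orP[s1|s1].
  by rewrite subr_gt0 [X in _ * X]ifF ?mulr0//; apply/negbTE; rewrite -leNgt.
rewrite ifF ?mul0r//; apply/negbTE; rewrite -leNgt.
by rewrite -lerBrDl sub0r lerNr.
Qed.

Lemma bumpRN s : bumpR (- s) = bumpR s.
Proof. by rewrite /bumpR opprK mulrC. Qed.

End smooth_line.

Section Ck_algebra.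
Context (R : realType) (V : normedModType R).
Implicit Types (f g : V -> R) (k : nat).

Lemma Ck_continuous k f : Ck k f -> continuous f.
Proof. by case: k => [|k] []. Qed.

Lemma CkW k f : Ck k.+1 f -> Ck k f.
Proof.
elim: k f => [|k ih] f; first by move=> [cf _]; split.
move=> [cf h]; split => // v; split; first by have [] := h v.
by apply: ih; have [] := h v.
Qed.

Lemma Ck_cst k (c : R) : Ck k (fun _ : V => c).
Proof.
elim: k c => [|k ih] c; split => //; try exact: cst_continuous.
move=> v; split; first by move=> x; exact: derivable_cst.
by rewrite (_ : 'D_v _ = (fun=> 0))//; apply/funext => x; exact: derive_cst.
Qed.

Lemma CkD k f g : Ck k f -> Ck k g -> Ck k (fun x => f x + g x).
Proof.
elim: k f g => [|k ih] f g [cf hf] [cg hg]; split => //;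
  try by move=> x; apply: continuousD; [exact: cf|exact: cg].
move=> v; have [df h1] := hf v; have [dg h2] := hg v.
split; first by move=> x; exact: derivableD.
rewrite (_ : 'D_v _ = (fun x => 'D_v f x + 'D_v g x)); first exact: ih.
by apply/funext => x; exact: deriveD.
Qed.

Lemma CkM k f g : Ck k f -> Ck k g -> Ck k (fun x => f x * g x).
Proof.
elim: k f g => [|k ih] f g Hf Hg.
  case: Hf => cf _; case: Hg => cg _; split => //.
  by move=> x; apply: continuousM; [exact: cf|exact: cg].
case: (Hf) => cf hf; case: (Hg) => cg hg; split.
  by move=> x; apply: continuousM; [exact: cf|exact: cg].
move=> v; have [df h1] := hf v; have [dg h2] := hg v.
split; first by move=> x; exact: derivableM.
rewrite (_ : 'D_v _ = (fun x => f x * 'D_v g x + g x * 'D_v f x)).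
  by apply: CkD; apply: ih => //; exact: CkW.
by apply/funext => x; exact: deriveM.
Qed.

Lemma CkB k f g : Ck k f -> Ck k g -> Ck k (fun x => f x - g x).
Proof.
move=> hf hg; rewrite (_ : (fun x => _) = (fun x => f x + (-1) * g x)).
  by apply: CkD => //; apply: CkM => //; exact: Ck_cst.
by apply/funext => x; rewrite mulN1r.
Qed.

Lemma Ck_prod k n (f : 'I_n -> V -> R) : (forall i, Ck k (f i)) ->
  Ck k (fun x => \prod_(i < n) f i x).
Proof.
elim: n f => [|n ih] f hf.
  rewrite (_ : (fun x => _) = (fun=> 1)); first exact: Ck_cst.
  by apply/funext => x; rewrite big_ord0.
rewrite (_ : (fun x => _) = (fun x => f ord0 x * \prod_(i < n) f (lift ord0 i) x)).
  by apply: CkM => //; exact: ih.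
by apply/funext => x; rewrite big_ord_recl.
Qed.

(** The hypothesis on [L] says that it is affine with linear part [l]. The derivative of [a \o L]
    along [v] is then [a' \o L] times the constant [l v], which is again of the form covered by the
    induction. *)
Lemma Ck_comp_affine k (a : R -> R) (L : V -> R) (l : V -> R) :
  continuous L -> (forall x v h, L (h *: v + x) = L x + h * l v) ->
  Sm k a -> Ck k (a \o L).
Proof.
move=> cL hL; elim: k a => [|k ih] a.
  by move=> ca; split => // x; apply: continuous_comp; [exact: cL|exact: ca].
move=> Ha; have ca := Sm_continuous Ha; have [a' da ha] := Ha; split.
  by move=> x; apply: continuous_comp; [exact: cL|exact: ca].
move=> v.
have H x : is_derive x v (a \o L) (l v * a' (L x)).
  have dfa : differentiable a (L x) by apply/derivable1_diffP.
  have /derivableP d1 : derivable a (L x) (l v) by exact: diff_derivable.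
  have E : (fun h : R => h^-1 *: (((a \o L) \o shift x) (h *: v) - (a \o L) x)) =
         (fun h : R => h^-1 *: ((a \o shift (L x)) (h *: l v) - a (L x))).
    by apply/funext => h /=; rewrite hL scaleRE [_ + L x]addrC.
  apply: DeriveDef.
    by have [] := d1; rewrite /derivable E.
  transitivity ('D_(l v) a (L x)); first by rewrite /derive E.
  rewrite deriveE// -[l v in LHS]mulr1 -scaleRE linearZ -deriveE//.
  by have [_ ->] := da (L x).
split; first by move=> x; have [] := H x.
rewrite (_ : 'D_v _ = (fun x => (fun=> l v) x * (a' \o L) x)).
  by apply: CkM; [exact: Ck_cst|exact: ih].
by apply/funext => x; have [_ ->] := H x.
Qed.

End Ck_algebra.

(** * Convolution with smooth kernels *)

(** Compactness is used in its near-covering form, with the radius as the parameter tending to 0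
    from the right. *)
Lemma compact_uniform_continuous (R : realType) (T : pseudoMetricType R) (K : set T)
    (f : T -> R) : compact K -> {within K, continuous f} ->
  forall e : R, 0 < e -> exists2 d : R, 0 < d &
    forall x y, K x -> K y -> ball x d y -> `|f x - f y| < e.
Proof.
move=> /compact_near_coveringP cK /subspace_continuousP cf e e0.
have e20 : 0 < e / 2 by rewrite divr_gt0.
have := cK R (0^'+) (fun d x => K x -> forall y, K y -> ball x d y -> `|f x - f y| < e) _ _.
case.
  move=> x Kx; have /cvgrPdist_lt/(_ _ e20) := cf x Kx.
  rewrite near_withinE => /nbhs_ballP[r /= r0 hr].
  exists (ball x (r / 2), [set d | d < r / 2]).
    split; first by apply: nbhsx_ballx; rewrite divr_gt0.
    by apply: nbhs_right_lt; rewrite divr_gt0.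
  move=> [x' d] /= [xx' dr] Kx' y Ky x'y.
  have h1 : `|f x - f x'| < e / 2.
    by apply: hr => //; apply: le_ball xx'; move: r0; clear; lra.
  have h2 : `|f x - f y| < e / 2.
    by apply: hr => //; rewrite (splitr r); apply: (ball_triangle xx'); apply: le_ball x'y; exact: ltW.
  by rewrite (splitr e) -(subrKA (f x)) (le_lt_trans (ler_normD _ _))// ltrD// distrC.
move=> d /= d0 hd; exists (d / 2); first by rewrite divr_gt0.
move=> x y Kx Ky; apply: hd => //=; last by rewrite divr_gt0.
by rewrite sub0r normrN gtr0_norm ?divr_gt0//; move: d0; clear; lra.
Qed.

Lemma Rintegral_support (R : realType) d (S : measurableType d) (nu : {measure set S -> \bar R}) (D B : set S)
    (f : S -> R) : B `<=` D -> (forall x, D x -> ~ B x -> f x = 0) ->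
  \int[nu]_(x in D) f x = \int[nu]_(x in B) f x.
Proof.
move=> BD fB; rewrite Rintegral_mkcond [RHS]Rintegral_mkcond.
apply: eq_Rintegral => x _; rewrite /patch.
have [Bx|nBx] := pselect (B x); first by rewrite !mem_set//; exact: BD.
rewrite [x \in B]memNset//; case: ifPn => // /set_mem Dx; exact: fB.
Qed.

Section integral_tools.
Context d (T : measurableType d) (R : realType) (mu : {measure set T -> \bar R}).

Lemma Rintegral_dominated_cvg_ae (D : set T) (f_ : nat -> T -> R) (f g : T -> R) :
  measurable D -> (forall n, measurable_fun D (f_ n)) -> measurable_fun D f ->
  {ae mu, forall x, D x -> f_ n x @[n --> \oo] --> f x} ->
  mu.-integrable D (EFin \o g) ->
  {ae mu, forall x n, D x -> `|f_ n x| <= g x} ->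
  mu.-integrable D (EFin \o f) /\
  \int[mu]_(x in D) f_ n x @[n --> \oo] --> \int[mu]_(x in D) f x.
Proof.
move=> mD mf mfl cf ig fg.
have [fi _ ci] : [/\ mu.-integrable D (EFin \o f),
    [sequence \int[mu]_(x in D) `|(f_ n x)%:E - (f x)%:E|]_n @ \oo --> 0 &
    [sequence \int[mu]_(x in D) (f_ n x)%:E]_n @ \oo --> \int[mu]_(x in D) (f x)%:E]%E.
  apply: (@dominated_convergence _ _ _ mu D mD (fun n => EFin \o f_ n)
    (EFin \o f) (EFin \o g)) => //.
  - by move=> n; exact/measurable_EFinP.
  - exact/measurable_EFinP.
  - move: cf; apply: filterS => x h Dx; apply: cvg_EFin; [exact: nearW|exact: h].
split => //.
by apply: fine_cvg; rewrite fineK; [exact: ci|exact: integrable_fin_num].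
Qed.

Lemma Rintegral_dominated_cvg (D : set T) (f_ : nat -> T -> R) (f g : T -> R) :
  measurable D -> (forall n, measurable_fun D (f_ n)) ->
  (forall x, D x -> f_ n x @[n --> \oo] --> f x) ->
  mu.-integrable D (EFin \o g) ->
  (forall n x, D x -> `|f_ n x| <= g x) ->
  mu.-integrable D (EFin \o f) /\
  \int[mu]_(x in D) f_ n x @[n --> \oo] --> \int[mu]_(x in D) f x.
Proof.
move=> mD mf cf ig fg.
apply: (@Rintegral_dominated_cvg_ae _ _ _ g) => //.
- exact: (@measurable_fun_cvg _ _ _ D f_).
- by apply: aeW => x Dx; exact: cf.
- by apply: aeW => x n Dx; exact: fg.
Qed.

Lemma bounded_integrable (D : set T) (f : T -> R) (C : R) :
  measurable D -> (mu D < +oo)%E -> measurable_fun D f ->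
  (forall x, D x -> `|f x| <= C) -> mu.-integrable D (EFin \o f).
Proof.
move=> mD fD mf fC; apply: measurable_bounded_integrable => //.
exists C; split; first exact: num_real.
by move=> M CM x Dx /=; rewrite (le_trans (fC _ Dx))// ltW.
Qed.

Lemma le_integrable_EFin (D : set T) (f g : T -> R) :
  measurable D -> measurable_fun D f -> mu.-integrable D (EFin \o g) ->
  (forall x, D x -> `|f x| <= g x) -> mu.-integrable D (EFin \o f).
Proof.
move=> mD mf ig fg; apply: (le_integrable mD _ _ ig); first exact/measurable_EFinP.
by move=> x Dx /=; rewrite lee_fin (le_trans (fg _ Dx))// ler_norm.
Qed.

Lemma integrableD_EFin (D : set T) (f g : T -> R) : measurable D ->
  mu.-integrable D (EFin \o f) -> mu.-integrable D (EFin \o g) ->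
  mu.-integrable D (EFin \o (fun x => f x + g x)).
Proof. by move=> mD hf hg; exact: (integrableD mD hf hg). Qed.

Lemma integrableB_EFin (D : set T) (f g : T -> R) : measurable D ->
  mu.-integrable D (EFin \o f) -> mu.-integrable D (EFin \o g) ->
  mu.-integrable D (EFin \o (fun x => f x - g x)).
Proof. by move=> mD hf hg; exact: (integrableB mD hf hg). Qed.

Lemma integrableZl_EFin (D : set T) (c : R) (f : T -> R) : measurable D ->
  mu.-integrable D (EFin \o f) -> mu.-integrable D (EFin \o (fun x => c * f x)).
Proof. by move=> mD hf; exact: (integrableZl mD c hf). Qed.

Lemma integrable_sum_EFin (D : set T) (I : Type) (s : seq I) (f : I -> T -> R) :
  measurable D -> (forall i, mu.-integrable D (EFin \o f i)) ->
  mu.-integrable D (EFin \o (fun x => \sum_(i <- s) f i x)).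
Proof.
move=> mD hf; elim: s => [|a s ih].
  under [fun x => _]eq_fun do rewrite big_nil.
  exact: integrable0.
under [fun x => _]eq_fun do rewrite big_cons.
exact: integrableD_EFin.
Qed.

Lemma Rintegral_sum (D : set T) (I : Type) (s : seq I) (f : I -> T -> R) :
  measurable D -> (forall i, mu.-integrable D (EFin \o f i)) ->
  \int[mu]_(x in D) (\sum_(i <- s) f i x) = \sum_(i <- s) \int[mu]_(x in D) f i x.
Proof.
move=> mD hf; elim: s => [|a s ih].
  under eq_Rintegral do rewrite big_nil.
  by rewrite big_nil Rintegral_cst// mul0r.
under eq_Rintegral do rewrite big_cons.
by rewrite big_cons RintegralD// ?ih//; exact: integrable_sum_EFin.
Qed.

Lemma Rintegral_le_bound (D : set T) (f g : T -> R) :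
  measurable D -> mu.-integrable D (EFin \o f) -> mu.-integrable D (EFin \o g) ->
  (forall x, D x -> `|f x| <= g x) ->
  `|\int[mu]_(x in D) f x| <= \int[mu]_(x in D) g x.
Proof.
move=> mD iff ig fg; apply: (le_trans (le_normr_Rintegral _ _)) => //.
by apply: le_Rintegral => //; exact: integrable_norm.
Qed.

End integral_tools.

Lemma MVT_between (R : realType) (g g' : R -> R) :
  (forall s : R, is_derive s 1 g (g' s)) ->
  forall a b, exists2 c, `|c - a| <= `|b - a| & g b - g a = g' c * (b - a).
Proof.
move=> dg a b.
have cg A : {within A, continuous g}.
  apply: continuous_subspaceT => x; apply: differentiable_continuous.
  exact/derivable1_diffP.
have [ab|ba] := leP a b.
  have [c] := @MVT_segment _ g g' a b ab (fun x _ => dg x) (cg _).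
  rewrite in_itv /= => /andP[ac cb] ->; exists c => //.
  by rewrite !ger0_norm ?subr_ge0// lerD2r.
have [c] := @MVT_segment _ g g' b a (ltW ba) (fun x _ => dg x) (cg _).
rewrite in_itv /= => /andP[bc ca] E; exists c; last by rewrite -opprB E -mulrN opprB.
by rewrite ler0_norm ?subr_le0// ltr0_norm ?subr_lt0// lerN2 lerD2r.
Qed.

Section mollifier.
Context (R : realType) (n : nat).
Let V := 'rV[R]_n.
Let mu := @lebesgue_rV R n.
Implicit Types (f k : V -> R) (x y v : V).

Definition bounded_support f := exists L : R, forall x, L < `|x| -> f x = 0.

(** Bounded, measurable, with bounded support. Such functions are integrable over [R^n] and remain
    so after translation or multiplication by a bounded measurable function, which settles the
    integrability side conditions over [R^n]. *)
Definition bmb f := [/\ measurable_fun setT f, exists C : R, forall x, `|f x| <= C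
  & bounded_support f].

Lemma closed_ball0_compact (L : R) : compact [set x : V | `|x| <= L].
Proof.
apply: bounded_closed_compact.
  exists L; split; first exact: num_real.
  by move=> M LM x /= xL; rewrite (le_trans xL)// ltW.
have -> : [set x : V | `|x| <= L] = (fun x : V => `|x|) @^-1` [set r | r <= L] by [].
apply: closed_comp; last exact: closed_le.
by move=> x _; exact: norm_continuous.
Qed.

Lemma continuous_bounded_support f : continuous f -> bounded_support f ->
  exists C : R, forall x, `|f x| <= C.
Proof.
move=> cf [L fL]; have [L0|L0] := ltP L 0.
  exists 0 => x; rewrite fL ?normr0//; exact: lt_le_trans L0 _.
have [|||c _ hc] := @EVT_max_rV R n (fun x => `|f x|) [set x | `|x| <= L].
- by exists 0; rewrite /= normr0.
- exact: closed_ball0_compact.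
- apply: continuous_subspaceT => x.
  by apply: (@continuous_comp _ _ _ f Num.norm); [exact: cf|exact: norm_continuous].
exists `|f c| => x; have [xL|xL] := leP `|x| L; first by apply: hc; rewrite inE.
by rewrite fL// normr0.
Qed.

Lemma bmb_integrable f : bmb f -> mu.-integrable setT (EFin \o f).
Proof.
move=> [mf [C fC] [L fL]].
have -> : EFin \o f = (EFin \o f) \_ [set x | `|x| <= L].
  apply/funext => x; rewrite /patch; case: ifPn => //.
  by rewrite notin_setE /= => /negP; rewrite -ltNge => /fL ->.
have mD : measurable [set x : V | `|x| <= L].
  rewrite -[X in measurable X]setCK; apply: measurableC; apply: open_measurable_rV.
  rewrite openC; apply: compact_closed; last exact: closed_ball0_compact.
  exact: norm_hausdorff.
apply/integrable_restrict => //; rewrite setTI.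
apply: (@bounded_integrable _ _ _ _ _ _ C) => //.
  exact: (@bounded_lebesgue_rV _ _ _ L).
exact: measurable_funTS.
Qed.

Lemma bmbM f (g : V -> R) : bmb f -> measurable_fun setT g -> (exists C : R, forall x, `|g x| <= C) ->
  bmb (fun x => f x * g x).
Proof.
move=> [mf [C fC] [L fL]] mg [D gD]; split; first exact: measurable_funM.
  by exists (C * D) => x; rewrite normrM ler_pM.
by exists L => x /fL ->; rewrite mul0r.
Qed.

Definition convol k f x : R := \int[mu]_y (f y * k (x - y)).

Definition smooth_kernel k := (forall j, Ck j k) /\ bounded_support k.

Lemma kernel_bounded k : smooth_kernel k -> exists2 C : R, 0 <= C & forall x, `|k x| <= C.
Proof.
move=> [ck sk]; have [C hC] := continuous_bounded_support (Ck_continuous (ck 0)) sk.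
by exists C => //; exact: le_trans (hC 0).
Qed.

Lemma kernel_derive k v : smooth_kernel k -> smooth_kernel ('D_v k).
Proof.
move=> [ck [L kL]]; split; first by move=> j; have [_ /(_ v)[]] := ck j.+1.
exists L => x Lx.
have : \near x, cst 0 x = k x.
  have : \forall y \near x, L < `|y|.
    by have /cvgr_gt := @norm_continuous R V x; apply.
  by apply: filterS => y /kL ->.
by move=> /near_eq_is_derive /(_ (is_derive_cst 0 x v))[].
Qed.

Lemma kernel_measurable k x : smooth_kernel k -> measurable_fun setT (fun y => k (x - y)).
Proof.
move=> [ck _]; apply: continuous_measurable_rV => y.
apply: (@continuous_comp _ _ _ (fun y => x - y) k); last exact: Ck_continuous (ck 0) _.
by apply: (@continuousB _ _ _ (fun=> x) id); [exact: cst_continuous|move=> ?].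
Qed.

Lemma convol_integrable k f x : smooth_kernel k -> bmb f ->
  mu.-integrable setT (EFin \o (fun y => f y * k (x - y))).
Proof.
move=> hk hf; apply: bmb_integrable; apply: bmbM => //; first exact: kernel_measurable.
by have [C _ hC] := kernel_bounded hk; exists C.
Qed.

Lemma is_derive_line k z v (s : R) : (forall y, derivable k y v) ->
  is_derive s 1 (fun s : R => k (z + s *: v)) ('D_v k (z + s *: v)).
Proof.
move=> dk.
have E : (fun h : R => h^-1 *: (((fun s : R => k (z + s *: v)) \o shift s) (h *: 1)
     - k (z + s *: v))) =
  (fun h : R => h^-1 *: ((k \o shift (z + s *: v)) (h *: v) - k (z + s *: v))).
  apply/funext => h /=; congr (_ *: (k _ - _)).
  by rewrite [h *: 1]mulr1 scalerDl addrCA.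
apply: DeriveDef; first by have := dk (z + s *: v); rewrite /derivable E.
by rewrite /derive E.
Qed.

(** Two applications of the mean value theorem show that the difference quotient of [k] differs from
    ['D_v k] by at most [C * |h|], uniformly in the base point, where [C] bounds the second
    derivative along [v]. Integrating this against [|f|] gives the derivative under the integral
    sign. *)
Lemma convol_is_derive k f x v : smooth_kernel k -> bmb f ->
  is_derive x v (convol k f) (convol ('D_v k) f x).
Proof.
move=> hk hf.
have hk1 := kernel_derive v hk; have hk2 := kernel_derive v hk1.
have [C C0 hC] := kernel_bounded hk2.
have dk y : derivable k y v by have [/(_ 1%N)[_ /(_ v)[]]] := hk.
have dk1 y : derivable ('D_v k) y v by have [/(_ 1%N)[_ /(_ v)[]]] := hk1.
have key z (h : R) : h != 0 -> `|h^-1 * (k (z + h *: v) - k z) - 'D_v k z| <= C * `|h|.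
  move=> h0.
  have [c cl E] := MVT_between (fun s => is_derive_line z s dk) 0 h.
  have [d dl E2] := MVT_between (fun s => is_derive_line z s dk1) 0 c.
  move: E E2 cl dl; rewrite /= scale0r addr0 !subr0 => E E2 cl dl.
  rewrite E mulrCA mulVf// mulr1 E2 normrM ler_pM//.
have fi : mu.-integrable setT (EFin \o (fun y => `|f y|)).
  by apply: integrable_norm; exact: bmb_integrable.
set I := \int[mu]_y `|f y|.
have I0 : 0 <= I by exact: Rintegral_ge0.
have cv : h^-1 *: ((convol k f \o shift x) (h *: v) - convol k f x) @[h --> 0^']
    --> convol ('D_v k) f x.
  apply/cvgrPdist_le => e e0; near=> h.
  have h0 : h != 0 by near: h; exact: nbhs_dnbhs_neq.
  rewrite /= scaleRE /convol -RintegralB//; try exact: convol_integrable.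
  rewrite -RintegralZl//; last first.
    by apply: integrableB_EFin => //; exact: convol_integrable.
  rewrite -RintegralB//; first last.
  - by apply: integrableZl_EFin => //; apply: integrableB_EFin => //; exact: convol_integrable.
  - exact: (convol_integrable x hk1 hf).
  apply: (@le_trans _ _ (C * `|h| * I)); last first.
    have : `|h| < e / (C * I + 1).
      near: h; apply: nbhs_dnbhs; apply/nbhs_normP; exists (e / (C * I + 1)).
        by rewrite /= divr_gt0// ltr_wpDl// mulr_ge0.
      by move=> z /=; rewrite sub0r normrN.
    rewrite ltr_pdivlMr ?ltr_wpDl ?mulr_ge0// => /ltW; apply: le_trans.
    by rewrite mulrAC [leRHS]mulrC ler_wpM2r// lerDl.
  rewrite -RintegralZl//.
  apply: Rintegral_le_bound => //.
  + apply: integrableB_EFin => //; first exact: (convol_integrable x hk1 hf).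
    by apply: integrableZl_EFin => //; apply: integrableB_EFin => //; exact: convol_integrable.
  + exact: integrableZl_EFin.
  move=> y _; rewrite -mulrBr mulrCA -mulrBr normrM mulrC ler_wpM2r//.
  rewrite distrC; have := key (x - y) h h0.
  by rewrite (_ : x - y + h *: v = h *: v + x - y)// addrC addrA.
by apply: DeriveDef; [apply/cvg_ex; eexists; exact: cv|exact: cvg_lim].
Unshelve. all: by end_near. Qed.

Lemma convol_measurable_term k f x : smooth_kernel k -> bmb f ->
  measurable_fun setT (fun y => f y * k (x - y)).
Proof.
by move=> hk [mf _ _]; apply: measurable_funM => //; exact: kernel_measurable.
Qed.

Lemma kernel_uniform_continuous k : smooth_kernel k -> forall e : R, 0 < e ->
  exists2 d : R, 0 < d & forall x y, `|x - y| < d -> `|k x - k y| < e.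
Proof.
move=> [ck [L kL]] e e0.
have [d d0 hd] := compact_uniform_continuous (@closed_ball0_compact (L + 1))
  (continuous_subspaceT (Ck_continuous (ck 0))) e0.
exists (Num.min d 1); first by rewrite lt_min d0 ltr01.
move=> x y; rewrite lt_min => /andP[xyd xy1].
have [xL|xL] := leP `|x| L.
  apply: hd => /=; first by rewrite (le_trans xL)// lerDl.
    rewrite -[y](subrK x) addrC (le_trans (ler_normD _ _))// lerD//.
    by rewrite distrC ltW.
  by rewrite -ball_normE.
have [yL|yL] := leP `|y| L.
  apply: hd => /=; last by rewrite -ball_normE.
    rewrite -[x](subrK y) addrC (le_trans (ler_normD _ _))// lerD//.
    by rewrite ltW.
  by rewrite (le_trans yL)// lerDl.
by rewrite (kL x)// (kL y)// subrr normr0.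
Qed.

Lemma convol_continuous k f : smooth_kernel k -> bmb f -> continuous (convol k f).
Proof.
move=> hk hf x.
have fi : mu.-integrable setT (EFin \o (fun y => `|f y|)).
  by apply: integrable_norm; exact: bmb_integrable.
set I := \int[mu]_y `|f y|.
have I0 : 0 <= I by exact: Rintegral_ge0.
apply/(@cvgrPdist_le R R _ _ (nbhs_filter (x : V)) (convol k f)) => e e0.
have [d d0 hd] := @kernel_uniform_continuous k hk (e / (I + 1))
  (divr_gt0 e0 (ltr_wpDl I0 ltr01)).
near=> z.
rewrite /convol -RintegralB//; try exact: convol_integrable.
apply: (@le_trans _ _ (e / (I + 1) * I)); last first.
  rewrite mulrAC ler_pdivrMr ?ltr_wpDl//.
  by rewrite ler_wpM2l ?ltW// ltrDl.
rewrite -RintegralZl//.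
apply: Rintegral_le_bound => //.
- by apply: integrableB_EFin => //; exact: convol_integrable.
- exact: integrableZl_EFin.
move=> y _; rewrite -mulrBr normrM mulrC ler_wpM2r//; apply/ltW/hd.
rewrite opprB addrA subrK.
near: z; apply/(@nbhs_normP R V); by exists d.
Unshelve. all: by end_near. Qed.

Lemma convol_Ck j k f : smooth_kernel k -> bmb f -> Ck j (convol k f).
Proof.
elim: j k => [|j ih] k hk hf; split => //; try exact: convol_continuous.
move=> v; split; first by move=> x; have [] := convol_is_derive x v hk hf.
have -> : 'D_v (convol k f) = convol ('D_v k) f.
  by apply/funext => x; have [_ ->] := convol_is_derive x v hk hf.
by apply: ih => //; exact: kernel_derive.
Qed.

Definition moll0 (e : R) x : R := \prod_(i < n) bumpR (x ord0 i / e).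

Lemma moll0_ge0 e x : 0 <= moll0 e x.
Proof. by apply: prodr_ge0 => i _; exact: bumpR_ge0. Qed.

Lemma moll0_eq0 e x : 0 < e -> e <= `|x| -> moll0 e x = 0.
Proof.
move=> e0 ex; have [i ei] : exists i, e <= `|x ord0 i|.
  apply/not_existsP => h; move: ex; rewrite leNgt => /negP; apply.
  by apply/(rV_norm_lt _ e0) => i; rewrite ltNge; apply/negP; exact: h.
rewrite /moll0 (bigD1 i)//= bumpR_eq0 ?mul0r//.
by rewrite normrM normfV (gtr0_norm e0) ler_pdivlMr// mul1r.
Qed.

Lemma moll0N e x : moll0 e (- x) = moll0 e x.
Proof. by apply: eq_bigr => i _; rewrite mxE mulNr bumpRN. Qed.

Lemma moll0_kernel e : 0 < e -> smooth_kernel (moll0 e).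
Proof.
move=> e0; split; last by exists e => x /ltW; exact: moll0_eq0.
move=> j; apply: Ck_prod => i.
apply: (@Ck_comp_affine _ _ j (@bumpR R) (fun x => x ord0 i / e) (fun x => x ord0 i / e)).
- move=> x; apply: (@continuousM _ _ (fun x : V => x ord0 i) (fun=> e^-1)).
    exact: coord_continuous.
  exact: cst_continuous.
- by move=> x v h; rewrite !mxE mulrDl addrC mulrA.
- exact: Sm_bumpR.
Qed.

End mollifier.

(** * Mollification *)

Section normalized_mollifier.
Context (R : realType) (n : nat).
Let V := 'rV[R]_n.
Let mu := @lebesgue_rV R n.
Implicit Types (f : V -> R) (x y v : V).

Lemma bounded_support_uniform_continuous f : continuous f -> bounded_support f ->
  forall e : R, 0 < e ->
  exists2 d : R, 0 < d & forall x y, `|x - y| < d -> `|f x - f y| < e.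
Proof.
move=> cf [L kL] e e0.
have [d d0 hd] := compact_uniform_continuous (@closed_ball0_compact R n (L + 1))
  (continuous_subspaceT cf) e0.
exists (Num.min d 1); first by rewrite lt_min d0 ltr01.
move=> x y; rewrite lt_min => /andP[xyd xy1].
have [xL|xL] := leP `|x| L.
  apply: hd => /=; first by rewrite (le_trans xL)// lerDl.
    rewrite -[y](subrK x) addrC (le_trans (ler_normD _ _))// lerD//.
    by rewrite distrC ltW.
  by rewrite -ball_normE.
have [yL|yL] := leP `|y| L.
  apply: hd => /=; last by rewrite -ball_normE.
    rewrite -[x](subrK y) addrC (le_trans (ler_normD _ _))// lerD//.
    by rewrite ltW.
  by rewrite (le_trans yL)// lerDl.
by rewrite (kL x)// (kL y)// subrr normr0.
Qed.

(** Both [1 + s] and [1 - s] are at least [1/2], so each of the two exponential factors is at least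
    [exp(-2)]. *)
Lemma bumpR_ge_half (s : R) : `|s| <= 2^-1 -> expR (- 4) <= bumpR s.
Proof.
rewrite ler_norml => /andP[s1 s2].
have h1 : 2^-1 <= 1 + s by lra.
have h2 : 2^-1 <= 1 - s by lra.
have p1 : 0 < 1 + s by lra.
have p2 : 0 < 1 - s by lra.
rewrite /bumpR /flat p1 p2 !expr0 !mul1r -expRD ler_expR -opprD lerN2.
have i1 : (1 + s)^-1 <= 2 by rewrite -[2]invrK lef_pV2 ?posrE.
have i2 : (1 - s)^-1 <= 2 by rewrite -[2]invrK lef_pV2 ?posrE.
lra.
Qed.

Lemma moll0_bmb (e : R) : 0 < e -> bmb (@moll0 R n e).
Proof.
move=> e0; have hk := @moll0_kernel R n e e0; split.
- by apply: continuous_measurable_rV; case: hk => /(_ 0) /Ck_continuous.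
- by have [C _ hC] := kernel_bounded hk; exists C.
- by case: hk.
Qed.

Lemma Rintegral_moll0_gt0 (e : R) : 0 < e -> 0 < \int[mu]_x moll0 e x.
Proof.
move=> e0; have e20 : 0 < e / 2 by rewrite divr_gt0.
set B := ball (0 : V) (e / 2).
have mB : measurable B by exact: measurable_rV_ball.
have muB : mu B = ((e / 2 *+ 2) ^+ n)%:E by exact: lebesgue_rV_ball0.
apply: (@lt_le_trans _ _ (\int[mu]_(x in B) expR (- 4) ^+ n)).
  rewrite Rintegral_cst//; apply: mulr_gt0; first exact/exprn_gt0/expR_gt0.
  by change (0 < fine (mu B)); rewrite muB; apply: exprn_gt0; rewrite pmulrn_lgt0.
rewrite Rintegral_mkcond; apply: le_Rintegral => //.
- rewrite -restrict_EFin; apply/integrable_restrict => //; rewrite setTI.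
  apply: (@bounded_integrable _ _ _ _ _ _ `|expR (- 4) ^+ n|) => //.
  by rewrite [X in (X < _)%E]muB ltry.
- exact/bmb_integrable/moll0_bmb.
move=> x _; rewrite /patch; case: ifPn; last by move=> _; exact: moll0_ge0.
rewrite inE /B -ball_normE /= sub0r normrN => /(rV_norm_lt _ e20) xe.
rewrite -[in leLHS](card_ord n) -prodr_const; apply: ler_prod => i _.
rewrite expR_ge0/=; apply: bumpR_ge_half.
rewrite normrM normfV (gtr0_norm e0) ler_pdivrMr// mulrC.
exact/ltW.
Qed.

Definition moll (e : R) x : R := (\int[mu]_y moll0 e y)^-1 * moll0 e x.

Lemma moll_ge0 e x : 0 < e -> 0 <= moll e x.
Proof.
by move=> e0; rewrite mulr_ge0 ?moll0_ge0// invr_ge0 ltW// Rintegral_moll0_gt0.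
Qed.

Lemma moll_eq0 e x : 0 < e -> e <= `|x| -> moll e x = 0.
Proof. by move=> e0 ex; rewrite /moll moll0_eq0// mulr0. Qed.

Lemma mollN e x : moll e (- x) = moll e x.
Proof. by rewrite /moll moll0N. Qed.

Lemma moll_kernel e : 0 < e -> smooth_kernel (moll e).
Proof.
move=> e0; have [ck [L sk]] := @moll0_kernel R n e e0; split.
  by move=> j; apply: CkM => //; exact: Ck_cst.
by exists L => x /sk h; rewrite /moll h mulr0.
Qed.

Lemma moll_bmb e : 0 < e -> bmb (moll e).
Proof.
move=> e0; have hk := moll_kernel e0; split.
- by apply: continuous_measurable_rV; case: hk => /(_ 0) /Ck_continuous.
- by have [C _ hC] := kernel_bounded hk; exists C.
- by case: hk.
Qed.

Lemma moll_integrable e x : 0 < e ->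
  mu.-integrable setT (EFin \o (fun y => moll e (x - y))).
Proof.
move=> e0; apply: bmb_integrable; split.
- exact: (kernel_measurable x (moll_kernel e0)).
- by have [C _ hC] := kernel_bounded (moll_kernel e0); exists C.
- exists (e + `|x|) => y ey; apply: moll_eq0 => //.
  have : `|y| <= `|x - y| + `|x|.
    by rewrite -{1}[y](subrK x) (le_trans (ler_normD _ _))// distrC.
  by move: ey; lra.
Qed.

Lemma Rintegral_moll e x : 0 < e -> \int[mu]_y moll e (x - y) = 1.
Proof.
move=> e0; transitivity (\int[mu]_y moll e (y + (- x))).
  by apply: eq_Rintegral => y _; rewrite -mollN opprB.
rewrite (@Rintegral_rV_shift _ _ _ (moll e)); last by case: (moll_bmb e0).
rewrite /moll RintegralZl//; last exact/bmb_integrable/moll0_bmb.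
by rewrite mulVf// gt_eqF// Rintegral_moll0_gt0.
Qed.

Definition mollify e f := convol (moll e) f.

(** The mollified value is an average of [f] over the ball of radius [e]. Taking [eta = 0] locates
    the support and the plateaus of a mollification; taking [a] as the midpoint of an interval gives
    two-sided bounds. *)
Lemma mollify_near e f x (a eta : R) : 0 < e -> bmb f ->
  (forall y, `|x - y| < e -> `|f y - a| <= eta) -> `|mollify e f x - a| <= eta.
Proof.
move=> e0 hf h.
have -> : mollify e f x - a = \int[mu]_y ((f y - a) * moll e (x - y)).
  rewrite -{1}[a]mulr1 -(Rintegral_moll x e0) -RintegralZl//; last exact: moll_integrable.
  rewrite /mollify /convol -RintegralB//.
  - by apply: eq_Rintegral => y _; rewrite mulrBl.
  - exact: (convol_integrable x (moll_kernel e0) hf).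
  - by apply: integrableZl_EFin => //; exact: moll_integrable.
rewrite -[eta]mulr1 -(Rintegral_moll x e0) -RintegralZl//; last exact: moll_integrable.
apply: Rintegral_le_bound => //.
- rewrite (_ : (fun y => _) = (fun y => f y * moll e (x - y) - a * moll e (x - y))).
    apply: integrableB_EFin => //; first exact: (convol_integrable x (moll_kernel e0) hf).
    by apply: integrableZl_EFin => //; exact: moll_integrable.
  by apply/funext => y; rewrite mulrBl.
- by apply: integrableZl_EFin => //; exact: moll_integrable.
move=> y _; rewrite normrM (ger0_norm (moll_ge0 _ e0)).
have [xy|xy] := ltP `|x - y| e; first by rewrite ler_wpM2r ?moll_ge0// h.
by rewrite moll_eq0// !mulr0.
Qed.

Lemma derive_le_lipschitz f x v (M : R) : derivable f x v ->
  (forall h : R, `|f (x + h *: v) - f x| <= M * `|h|) -> `|'D_v f x| <= M.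
Proof.
move=> df hM.
have cv : `|h^-1 *: ((f \o shift x) (h *: v) - f x)| @[h --> 0^'] --> `|'D_v f x|.
  exact: cvg_norm.
rewrite -(cvg_lim _ cv)//; apply: limr_le; first by apply/cvg_ex; eexists; exact: cv.
near=> h; have h0 : h != 0 by near: h; exact: nbhs_dnbhs_neq.
rewrite /= scaleRE normrM normfV mulrC ler_pdivrMr ?normr_gt0// [_ + x]addrC.
exact: hM.
Unshelve. all: by end_near. Qed.

(** Translation invariance moves the increment from the kernel to [f], and the kernel has mass 1, so
    mollification does not increase the Lipschitz constant along [v]. *)
Lemma mollify_lipschitz e f x v (M : R) : 0 < e -> bmb f ->
  (forall y (h : R), `|f (y + h *: v) - f y| <= M * `|h|) ->
  `|'D_v (mollify e f) x| <= M.
Proof.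
move=> e0 hf hM; have hk := moll_kernel e0.
apply: derive_le_lipschitz; first by have [] := convol_is_derive x v hk hf.
move=> h.
have E : mollify e f (x + h *: v) = \int[mu]_y (f (y + h *: v) * moll e (x - y)).
  rewrite /mollify /convol -(Rintegral_rV_shift (h *: v)); last first.
    exact: convol_measurable_term.
  by apply: eq_Rintegral => y _; rewrite opprD addrACA subrr addr0.
rewrite E /mollify /convol.
have hf' : bmb (fun y => f (y + h *: v)).
  case: hf => mf [C hC] [L hL]; split.
  - exact: (measurableT_comp mf (measurable_shift_rV _)).
  - by exists C => y.
  - exists (L + `|h *: v|) => y; rewrite -ltrBrDr => hy; apply: hL.
    by have := ler_normB (y + h *: v) (h *: v); rewrite addrK; move: hy; lra.
have i1 := convol_integrable x hk hf'; have i2 := convol_integrable x hk hf.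
rewrite -(RintegralB measurableT i1 i2).
have -> : M * `|h| = \int[mu]_y (M * `|h| * moll e (x - y)).
  rewrite (RintegralZl (M * `|h|) measurableT (moll_integrable x e0)).
  by rewrite (Rintegral_moll x e0) mulr1.
apply: (Rintegral_le_bound measurableT (integrableB_EFin measurableT i1 i2)
  (integrableZl_EFin (M * `|h|) measurableT (moll_integrable x e0))).
move=> y _; rewrite -mulrBl normrM (ger0_norm (moll_ge0 _ e0)).
by rewrite ler_wpM2r ?moll_ge0.
Qed.

Lemma mollify_Ck e f j : 0 < e -> bmb f -> Ck j (mollify e f).
Proof. by move=> e0 hf; apply: convol_Ck => //; exact: moll_kernel. Qed.

Lemma bounded_setP (U : set V) : bounded_set U -> exists2 L : R, 0 <= L & forall x, U x -> `|x| <= L.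
Proof.
move=> [M [_ hM]]; exists (`|M| + 1) => // x Ux.
by apply: (hM (`|M| + 1)) => //; rewrite (le_lt_trans (ler_norm M))// ltrDl.
Qed.

Definition shrink (U : set V) (d : R) : set V := [set x | forall y, `|x - y| < d -> U y].

Lemma closed_shrink U d : closed (shrink U d).
Proof.
rewrite -[shrink U d]setCK closedC (_ : ~` _ = \bigcup_(y in ~` U) ball y d).
  by apply: bigcup_open => y _; exact: ball_open.
apply/seteqP; split => x.
  move=> /existsNP[y /not_implyP[xy nUy]]; exists y => //.
  by rewrite -ball_normE /= distrC.
by move=> [y nUy]; rewrite -ball_normE /= distrC => xy /(_ y xy).
Qed.

Lemma sub_shrink U d : 0 < d -> shrink U d `<=` U.
Proof. by move=> d0 x; apply; rewrite subrr normr0. Qed.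

Lemma compact_shrink U d : 0 < d -> bounded_set U -> compact (shrink U d).
Proof.
move=> d0 /bounded_setP[L _ UL]; apply: bounded_closed_compact; last exact: closed_shrink.
exists L; split; first exact: num_real.
by move=> M LM x /(sub_shrink d0)/UL; move/le_trans; apply; exact: ltW.
Qed.

Lemma measurable_closed_rV (A : set V) : closed A -> measurable A.
Proof.
by move=> cA; rewrite -[A]setCK; apply: measurableC; apply: open_measurable_rV; exact: closed_openC.
Qed.

(** With [d = 1/(k+1)], the indicator of the points at distance at least [2d] from the complement is
    mollified at scale [d]. The result is supported at distance at least [d] from the complement and
    equals 1 at distance [3d]. *)
Lemma cutoff (U : set V) : open U -> bounded_set U ->
  exists phi : nat -> V -> R, [/\ forall k, test_function U (phi k),
    forall k x, 0 <= phi k x <= 1 &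
    forall x, U x -> \forall k \near \oo, phi k x = 1].
Proof.
move=> oU bU; have [L L0 UL] := bounded_setP bU.
pose d k : R := k.+1%:R^-1; have d0 k : 0 < d k by rewrite invr_gt0.
pose f k : V -> R := \1_(shrink U (d k *+ 2)).
have d20 k : 0 < d k *+ 2 by rewrite pmulrn_lgt0.
have hf k : bmb (f k).
  split.
  - by apply: measurable_indic; apply: measurable_closed_rV; exact: closed_shrink.
  - by exists 1 => x; rewrite /f indicE; case: (_ \in _); rewrite ?normr1 ?normr0.
  - exists L => x Lx; rewrite /f indicE memNset// => /(sub_shrink (d20 k))/UL.
    by rewrite leNgt Lx.
exists (fun k => mollify (d k) (f k)); split.
- move=> k; split; first by move=> j; exact: mollify_Ck.
  exists (shrink U (d k)); first by split; [exact: compact_shrink|exact: sub_shrink].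
  move=> x nx; have := @mollify_near (d k) (f k) x 0 0 (d0 k) (hf k).
  rewrite subr0 normr_le0 => h; apply/eqP/h => y xy.
  rewrite subr0 normr_le0 /f indicE memNset// => hy; apply: nx => z xz.
  apply: hy; rewrite mulr2n -(subrKA x) (le_lt_trans (ler_normD _ _))// ltrD//.
  by rewrite distrC.
- move=> k x; have := @mollify_near (d k) (f k) x 2^-1 2^-1 (d0 k) (hf k).
  rewrite ler_distl subrr => h; have : 0 <= mollify (d k) (f k) x <= 2^-1 + 2^-1.
    apply: h => y _; rewrite /f indicE ler_distl subrr.
    by case: (_ \in _) => /=; apply/andP; split; lra.
  by rewrite -[2^-1 in X in X -> _]div1r -splitr.
- move=> x Ux.
  have /nbhs_ballP[e /= e0 he] := open_nbhs_nbhs (conj oU Ux).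
  have : \forall k \near \oo, d k < e / 3.
    by apply: near_infty_natSinv_lt (PosNum _) => //; rewrite divr_gt0.
  apply: filterS => k dke.
  have := @mollify_near (d k) (f k) x 1 0 (d0 k) (hf k).
  rewrite normr_le0 subr_eq0 => h; apply/eqP/h => y xy.
  rewrite normr_le0 subr_eq0 /f indicE mem_set// => z yz.
  apply: he; rewrite -ball_normE /= -(subrKA y) (le_lt_trans (ler_normD _ _))//.
  by move: xy yz dke; rewrite mulr2n; lra.
Qed.

(** Lipschitz along the coordinate axes only: this matches a bound on each partial derivative with
    the same constant. *)
Definition coord_lipschitz (M : R) f :=
  forall (i : 'I_n) x (h : R), `|f (x + h *: delta_mx ord0 i) - f x| <= M * `|h|.

(** Subtracting [eta / 2] and truncating at 0 keeps the Lipschitz constant. If the mollification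
    scale is so small that [f] varies by less than [eta / 4], the result is supported in
    [{f >= eta / 4}], a compact subset of [U]. What matters is that the gradient bound [M] does not
    depend on [eta]. *)
Lemma lipschitz_approx (U : set V) f (M : R) : open U -> bounded_set U ->
  continuous f -> (forall x, 0 <= f x) -> (forall x, ~ U x -> f x = 0) ->
  coord_lipschitz M f -> forall eta : R, 0 < eta ->
  exists phi, [/\ test_function U phi, forall x, `|phi x - f x| <= eta &
    forall i x, `|partial i phi x| <= M].
Proof.
move=> oU bU cf f0 fU fM eta eta0; have [L L0 UL] := bounded_setP bU.
have bf : bounded_support f.
  by exists L => x Lx; apply: fU => /UL; rewrite leNgt Lx.
pose T (s : R) := Num.max (s - eta / 2) 0.
have Tlip s t : `|T s - T t| <= `|s - t|.
  have := ler_norm (s - t); have := ler_norm (t - s); rewrite distrC.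
  rewrite /T /Num.max ler_norml.
  by case: ltP => h1; case: ltP => h2 h3 h4; apply/andP; split; lra.
pose g x := T (f x).
have cg : continuous g.
  move=> x; apply: (@continuous_comp _ _ _ f T); first exact: cf.
  apply: continuous_max; last exact: cst_continuous.
  by apply: (@continuousB _ _ _ id (fun=> eta / 2)); [move=> ?|exact: cst_continuous].
have bg : bounded_support g.
  case: bf => l hl; exists l => x /hl h; rewrite /g h /T sub0r.
  by apply: max_r; rewrite oppr_le0 divr_ge0// ltW.
have hg : bmb g.
  split => //; [exact: continuous_measurable_rV|exact: continuous_bounded_support].
have eta40 : 0 < eta / 4 by rewrite divr_gt0.
have [d d0 hd] := bounded_support_uniform_continuous cf bf eta40.
exists (mollify d g); split.
- split; first by move=> j; exact: mollify_Ck.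
  exists [set x | eta / 4 <= f x].
    split; last first.
      move=> x /= hx; apply: contrapT => /fU fx; move: hx; rewrite fx leNgt.
      by rewrite eta40.
    apply: bounded_closed_compact.
      exists L; split; first exact: num_real.
      move=> m Lm x /= hx; apply: le_trans (ltW Lm); apply: UL; apply: contrapT => /fU fx.
      by move: hx; rewrite fx leNgt eta40.
    rewrite (_ : [set x | _] = f @^-1` [set r | eta / 4 <= r])//.
    by apply: closed_comp => [x _|]; [exact: cf|exact: closed_ge].
  move=> x /negP; rewrite -ltNge => fx.
  have := @mollify_near d g x 0 0 d0 hg; rewrite subr0 normr_le0 => h; apply/eqP/h => y xy.
  rewrite subr0 normr_le0 /g /T; apply/eqP/max_r.
  by have := hd _ _ xy; rewrite ltr_norml => /andP[]; lra.
- move=> x; have : `|mollify d g x - g x| <= eta / 4.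
    apply: mollify_near => // y xy; rewrite distrC (le_trans (Tlip _ _))// ltW//.
    exact: hd.
  have : `|g x - f x| <= eta / 2.
    rewrite /g /T ler_norml /Num.max; have := f0 x.
    by case: ltP => h1 h2; apply/andP; split; lra.
  move=> h1 h2; rewrite -(subrKA (g x)) (le_trans (ler_normD _ _))//.
  by apply: (le_trans (lerD h2 h1)); lra.
- move=> i x; apply: mollify_lipschitz => // y h.
  exact: le_trans (Tlip _ _) (fM _ _ _).
Qed.

End normalized_mollifier.

(** * Weak convergence against test functions *)

Lemma cvg0_double_limit (R : realType) (a : nat -> R) (b : nat -> nat -> R) (t : nat -> R) :
  t m @[m --> \oo] --> (0 : R) -> (forall m n, `|a n - b m n| <= t m) ->
  (forall m, b m n @[n --> \oo] --> (0 : R)) -> a n @[n --> \oo] --> (0 : R).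
Proof.
move=> t0 ab b0; apply/cvgr0Pnorm_lt => e e0.
have e20 : 0 < e / 2 by rewrite divr_gt0.
have /cvgr0Pnorm_lt/(_ _ e20)[m _ hm] := t0.
have /cvgr0Pnorm_lt/(_ _ e20) := b0 m; apply: filterS => n hn.
rewrite -[a n](subrK (b m n)) (le_lt_trans (ler_normD _ _))// (splitr e) ltr_leD ?ltW//.
by apply: (le_lt_trans (ab m n)); apply: (le_lt_trans (ler_norm _)); apply: hm => /=.
Qed.

Section weak_limits.
Context (R : realType) (n : nat).
Let V := 'rV[R]_n.
Let mu := @lebesgue_rV R n.

(** The coordinate sigma-algebra is the Borel one, so that the monotone class argument below can
    start from open sets. *)
Lemma measurable_rV_openE : @measurable _ V = <<s @open V >>.
Proof.
apply/seteqP; split; last first.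
  apply: smallest_sub; first exact: sigma_algebra_measurable.
  by move=> U; exact: open_measurable_rV.
have mid : measurable_fun setT (id : g_sigma_algebraType (@open V) -> V).
  apply/measurable_fun_rVP => i; apply: (measurability (@RGenOpens.G R)).
    exact: RGenOpens.measurableE.
  move=> _ [_ [a [b ->]] <-]; rewrite setTI.
  apply: sub_sigma_algebra; apply: open_comp; last exact: interval_open.
  by move=> x _; exact: coord_continuous.
by move=> A mA; have := mid measurableT A mA; rewrite setTI.
Qed.

Section fixed_domain.
Variables (B : set V) (g_ : nat -> V -> R) (G : V -> R).
Hypotheses (oB : open B) (bB : bounded_set B).
Hypothesis mg : forall m, measurable_fun B (g_ m).
Hypothesis iG : mu.-integrable B (EFin \o G).
Hypothesis gG : forall m x, B x -> `|g_ m x| <= G x.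

Let mB : measurable B. Proof. exact: open_measurable_rV. Qed.

(** The functions against which [g_] tends weakly to 0. This class is enlarged step by step: test
    functions, indicators of open sets, indicators of measurable sets, integrable functions. *)
Definition weak0 (F : V -> R) := \int[mu]_(x in B) (g_ m x * F x) @[m --> \oo] --> (0 : R).

Definition bmf (F : V -> R) := measurable_fun B F /\ exists C : R, forall x, `|F x| <= C.

Lemma G_ge0 x : B x -> 0 <= G x.
Proof. by move=> Bx; apply: le_trans (gG 0 Bx). Qed.

Lemma bmf_integrable m F : bmf F -> mu.-integrable B (EFin \o (fun x => g_ m x * F x)).
Proof.
move=> [mF [C FC]].
apply: (le_integrable_EFin mB _ (integrableZl_EFin C mB iG)).
  exact: measurable_funM.
by move=> x Bx; rewrite normrM mulrC; apply: ler_pM => //; exact: gG.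
Qed.

Lemma weak0D F1 F2 (c : R) : bmf F1 -> bmf F2 -> weak0 F1 -> weak0 F2 ->
  weak0 (fun x => F1 x + c * F2 x).
Proof.
move=> b1 b2 w1 w2; rewrite /weak0.
have E m : \int[mu]_(x in B) (g_ m x * (F1 x + c * F2 x)) =
    \int[mu]_(x in B) (g_ m x * F1 x) + c * \int[mu]_(x in B) (g_ m x * F2 x).
  rewrite -(RintegralZl c mB (bmf_integrable m b2)).
  rewrite -(RintegralD mB (bmf_integrable m b1) (integrableZl_EFin c mB (bmf_integrable m b2))).
  by apply: eq_Rintegral => x _; rewrite mulrDr [in LHS]mulrCA.
under eq_fun do rewrite E.
rewrite -[0]addr0 -[X in _ + X](mulr0 c).
by apply: cvgD; [exact: w1|apply: cvgMr; exact: w2].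
Qed.

(** The error of replacing [F] by [F_ k] is at most the integral of [G * |F - F_ k|] for every index
    of [g_], and this tends to 0 by dominated convergence. *)
Lemma weak0_bounded_cvg (F_ : nat -> V -> R) F (C : R) :
  (forall k, measurable_fun B (F_ k)) -> (forall k x, `|F_ k x| <= C) ->
  (forall x, `|F x| <= C) -> (forall x, B x -> F_ k x @[k --> \oo] --> F x) ->
  (forall k, weak0 (F_ k)) -> weak0 F.
Proof.
move=> mF FC fC cF wF.
have mFl : measurable_fun B F by exact: (measurable_fun_cvg mF cF).
have bF k : bmf (F_ k) by split => //; exists C.
have bFl : bmf F by split => //; exists C.
have C0 : 0 <= C by apply: le_trans (fC 0).
have mG : measurable_fun B G by apply/measurable_EFinP; exact: measurable_int iG.
pose t k := \int[mu]_(x in B) (G x * `|F x - F_ k x|).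
have mt k : measurable_fun B (fun x => G x * `|F x - F_ k x|).
  apply: measurable_funM => //; apply: measurableT_comp => //.
  exact: measurable_funB.
have ht k x : B x -> `|G x * `|F x - F_ k x| | <= (C + C) * G x.
  move=> Bx; have G0 := G_ge0 Bx.
  rewrite normrM normr_id (ger0_norm G0) mulrC ler_wpM2r//.
  by rewrite (le_trans (ler_normB _ _))// lerD.
have it k : mu.-integrable B (EFin \o (fun x => G x * `|F x - F_ k x|)).
  exact: (le_integrable_EFin mB (mt k) (integrableZl_EFin (C + C) mB iG) (ht k)).
apply: (@cvg0_double_limit _ _ (fun k m => \int[mu]_(x in B) (g_ m x * F_ k x)) t) => //.
  have [] := @Rintegral_dominated_cvg _ _ _ mu B (fun k x => G x * `|F x - F_ k x|)
    (fun=> 0) (fun x => (C + C) * G x) mB mt _ (integrableZl_EFin (C + C) mB iG) ht.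
    move=> x Bx; rewrite -[0](mulr0 (G x)); apply: cvgMr.
    rewrite -[0](normr0 R) -[0 in X in _ --> X](subrr (F x)).
    by apply: cvg_norm; apply: cvgB; [exact: cvg_cst|exact: cF].
  by move=> _; rewrite Rintegral_cst// mul0r.
move=> k m.
rewrite -(RintegralB mB (bmf_integrable m bFl) (bmf_integrable m (bF k))).
apply: (Rintegral_le_bound mB (integrableB_EFin mB (bmf_integrable m bFl)
  (bmf_integrable m (bF k))) (it k)).
by move=> x Bx; rewrite -mulrBr normrM ler_wpM2r// gG.
Qed.

Hypothesis test0 : forall phi, test_function B phi -> weak0 phi.

Lemma bmf_indic (A : set V) : measurable A -> bmf \1_A.
Proof.
move=> mA; split; first exact: measurable_indic.
by exists 1 => x; rewrite indicE; case: (_ \in _); rewrite ?normr1 ?normr0.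
Qed.

Lemma eq_weak0 F1 F2 : (forall x, B x -> F1 x = F2 x) -> weak0 F1 -> weak0 F2.
Proof.
move=> h; rewrite /weak0; apply: cvg_trans; apply: near_eq_cvg; apply: nearW => m.
by apply: eq_Rintegral => x /set_mem Bx; rewrite h.
Qed.

(** Only the part of [U] inside [B] matters, and there the indicator is the bounded limit of the
    test functions given by [cutoff]. *)
Lemma weak0_open (U : set V) : open U -> weak0 \1_U.
Proof.
move=> oU; have oUB : open (U `&` B) by exact: openI.
have bUB : bounded_set (U `&` B).
  by apply: (@sub_boundedr _ _ _ (globally (U `&` B)) (globally B)) => // P hP x [_ /hP].
have [phi [tphi phi01 phi1]] := cutoff oUB bUB.
have cphi k : continuous (phi k) by have [/(_ 0%N)/Ck_continuous] := tphi k.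
apply: (@weak0_bounded_cvg phi _ 1).
- move=> k; apply: measurable_funTS; exact: continuous_measurable_rV.
- by move=> k x; have /andP[h1 h2] := phi01 k x; rewrite ger0_norm.
- by move=> x; rewrite indicE; case: (_ \in _); rewrite ?normr1 ?normr0.
- move=> x Bx; apply: cvg_near_cst; rewrite indicE.
  have [Ux|nUx] := pselect (U x).
    rewrite mem_set//; exact: phi1.
  rewrite memNset//; apply: nearW => k.
  have [_ [K [_ KU] h]] := tphi k; apply: h => /KU[]//.
- move=> k; apply: test0; have [h1 [K [cK KU] h]] := tphi k; split => //.
  by exists K => //; split => // x /KU[].
Qed.

(** Dynkin's lemma, with the open sets as the pi-system: complements follow by linearity, countable
    disjoint unions from their finite partial unions and [weak0_bounded_cvg]. *)
Lemma weak0_indic (A : set V) : measurable A -> weak0 \1_A.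
Proof.
move=> mA; have : <<s @open V >> A by rewrite -measurable_rV_openE.
move: A {mA}; apply: dynkin_induction => //.
- exact: measurable_rV_openE.
- by move=> X Y; exact: openI.
- by apply: weak0_open; exact: openT.
- exact: weak0_open.
- move=> S mS wS.
  apply: (@eq_weak0 (fun x => \1_setT x + (-1) * \1_S x)).
    by move=> x _; rewrite !indicE in_setT in_setC mulN1r; case: (_ \in _); rewrite ?subrr ?subr0.
  apply: weak0D => //; try exact: bmf_indic.
  by apply: weak0_open; exact: openT.
- move=> F mF tF wF.
  have mU k : measurable (\big[setU/set0]_(i < k) F i) by exact: bigsetU_measurable.
  apply: (@weak0_bounded_cvg (fun k => \1_(\big[setU/set0]_(i < k) F i)) _ 1).
  + by move=> k; exact: measurable_indic.
  + by move=> k x; rewrite indicE; case: (_ \in _); rewrite ?normr1 ?normr0.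
  + by move=> x; rewrite indicE; case: (_ \in _); rewrite ?normr1 ?normr0.
  + move=> x _; apply: cvg_near_cst; rewrite !indicE.
    have [[i _ Fi]|nF] := pselect ((\bigcup_k F k) x).
      rewrite mem_set; last by exists i.
      exists i.+1 => // k /= ik; rewrite indicE mem_set//.
      by rewrite -bigcup_mkord; exists i.
    rewrite memNset//; apply: nearW => k; rewrite indicE memNset//.
    by rewrite -bigcup_mkord => -[i _ Fi]; apply: nF; exists i.
  + elim=> [|k ih].
      apply: (@eq_weak0 \1_set0); first by rewrite big_ord0.
      by apply: weak0_open; exact: open0.
    apply: (@eq_weak0 (fun x => \1_(\big[setU/set0]_(i < k) F i) x + 1 * \1_(F k) x)).
      move=> x _; rewrite big_ord_recr/= mul1r !indicE in_setU.
      have [h|] := boolP (x \in F k); last by rewrite orbF addr0.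
      rewrite orbT [x \in _](_ : _ = false) ?add0r//; apply/negP => /set_mem.
      rewrite -bigcup_mkord => -[i /= ik Fi].
      by have := tF i k I I (ex_intro _ x (conj Fi (set_mem h))); move: ik => /[swap] ->; rewrite ltnn.
    by apply: weak0D => //; exact: bmf_indic.
Qed.

Import HBSimple.

(** Simple functions approximate [F] in [L^1]. Since [F] need not be bounded, the functions [g_]
    must now be bounded by a constant, not merely dominated by [G]. *)
Lemma weak0_integrable (M : R) F : (forall m x, B x -> `|g_ m x| <= M) ->
  mu.-integrable B (EFin \o F) -> weak0 F.
Proof.
move=> gM iF; have [s [si sF sl]] := approximation_sfun_integrable mB iF.
have mF : measurable_fun B F by apply/measurable_EFinP; exact: measurable_int iF.
have ms k : measurable_fun B (s k) by apply: measurable_funTS; exact: measurable_funP.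
have iFs k : mu.-integrable B (EFin \o (fun x => `|F x - s k x|)).
  by apply: integrable_norm; exact: integrableB_EFin.
have ig (H : V -> R) m : mu.-integrable B (EFin \o H) ->
    mu.-integrable B (EFin \o (fun x => g_ m x * H x)).
  move=> iH; apply: (le_integrable_EFin mB _ (integrableZl_EFin M mB (integrable_norm iH))).
    by apply: measurable_funM => //; apply/measurable_EFinP; exact: measurable_int iH.
  by move=> x Bx /=; rewrite normrM ler_wpM2r// gM.
apply: (@cvg0_double_limit _ _ (fun k m => \int[mu]_(x in B) (g_ m x * s k x))
   (fun k => M * \int[mu]_(x in B) `|F x - s k x|)).
- rewrite -[0](mulr0 M); apply: cvgMr; move: sl => /fine_cvg; apply: cvg_trans.
  by apply: near_eq_cvg; apply: nearW.
- move=> k m; rewrite -(RintegralB mB (ig F m iF) (ig (s k) m (si k))).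
  rewrite -(RintegralZl M mB (iFs k)).
  apply: (Rintegral_le_bound mB (integrableB_EFin mB (ig F m iF) (ig (s k) m (si k)))
    (integrableZl_EFin M mB (iFs k))).
  by move=> x Bx; rewrite -mulrBr normrM ler_wpM2r// gM.
move=> k; change (weak0 (s k)).
pose S (x : V) : R := \sum_(y <- finmap.enum_fset (fset_set (range (s k)))) (y * \1_(s k @^-1` [set y]) x).
apply: (eq_weak0 (F1 := S) (F2 := s k)); rewrite /S.
  by move=> x _; rewrite [RHS]fimfunE fsbig_finite.
have mI y : measurable (s k @^-1` [set y]) by exact: measurable_sfunP.
elim: (finmap.enum_fset _) => [|y l ih].
  apply: (@eq_weak0 \1_set0); last by apply: weak0_open; exact: open0.
  by move=> x _; rewrite big_nil indicE in_set0.
apply: (@eq_weak0 (fun x => \sum_(j <- l) (j * \1_(s k @^-1` [set j]) x) +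
    y * \1_(s k @^-1` [set y]) x)).
  by move=> x _; rewrite big_cons addrC.
apply: weak0D => //; [|exact: bmf_indic|exact: weak0_indic].
split.
  apply: measurable_sum => j; apply: measurable_funM => //.
exists (\sum_(j <- l) `|j|) => x; rewrite (le_trans (ler_norm_sum _ _ _))//.
apply: ler_sum => j _; rewrite normrM ler_piMr// indicE.
by case: (_ \in _); rewrite ?normr1 ?normr0.
Qed.

End fixed_domain.

End weak_limits.

(** * Weak gradients *)

Section uniqueness.
Context (R : realType) (n : nat).
Let V := 'rV[R]_n.
Let mu := @lebesgue_rV R n.
Variable Omega : set V.
Hypotheses (oO : open Omega) (bO : bounded_set Omega).

Let mO : measurable Omega. Proof. exact: open_measurable_rV. Qed.

Lemma finite_lebesgue_bounded : (mu Omega < +oo)%E.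
Proof. by have [L _ OL] := bounded_setP bO; exact: (bounded_lebesgue_rV mO OL). Qed.

Lemma weak_test_cvg (g_ : nat -> V -> R) (M : R) (F : V -> R) :
  (forall m, measurable_fun Omega (g_ m)) -> (forall m x, Omega x -> `|g_ m x| <= M) ->
  (forall phi, test_function Omega phi ->
    \int[mu]_(x in Omega) (g_ m x * phi x) @[m --> \oo] --> (0 : R)) ->
  mu.-integrable Omega (EFin \o F) ->
  \int[mu]_(x in Omega) (g_ m x * F x) @[m --> \oo] --> (0 : R).
Proof.
move=> mg gM h iF.
have iM : mu.-integrable Omega (EFin \o (fun=> M)).
  apply: (bounded_integrable (C := `|M|) mO finite_lebesgue_bounded) => //.
exact: (weak0_integrable oO bO mg iM gM h gM iF).
Qed.

(** Open sets that exhaust Omega, each inside a compact subset of Omega, on which local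
    integrability becomes integrability. *)
Definition exhaust (k : nat) : set V := interior (shrink Omega k.+1%:R^-1).

Lemma exhaust_open k : open (exhaust k).
Proof. exact: open_interior. Qed.

Lemma exhaust_sub k : exhaust k `<=` shrink Omega k.+1%:R^-1.
Proof. exact: interior_subset. Qed.

Lemma exhaust_bigcup : \bigcup_k exhaust k = Omega.
Proof.
apply/seteqP; split => x.
  by move=> [k _ /exhaust_sub]; apply: sub_shrink; rewrite invr_gt0.
move=> Ox; have /nbhs_ballP[e /= e0 he] := open_nbhs_nbhs (conj oO Ox).
have [k _ hk] : \forall k \near \oo, k.+1%:R^-1 < e / 2.
  by apply: near_infty_natSinv_lt (PosNum _) => //; rewrite divr_gt0.
exists k => //; apply/nbhs_ballP; exists (e / 2); first by rewrite /= divr_gt0.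
move=> y; rewrite -ball_normE /= => xy z yz; apply: he; rewrite -ball_normE /=.
rewrite -(subrKA y) (le_lt_trans (ler_normD _ _))// (splitr e) ltrD//.
by apply: lt_trans yz _; apply: hk => /=.
Qed.

Lemma shrink_compact_sub k :
  compact (shrink Omega k.+1%:R^-1) /\ shrink Omega k.+1%:R^-1 `<=` Omega.
Proof.
by split; [apply: compact_shrink => //; rewrite invr_gt0|
  apply: sub_shrink; rewrite invr_gt0].
Qed.

Lemma L1loc_measurable (g : V -> R) : L1loc Omega g -> measurable_fun Omega g.
Proof.
move=> hg; rewrite -exhaust_bigcup; apply/measurable_fun_bigcup => k.
  by apply: open_measurable_rV; exact: exhaust_open.
have [cK KO] := shrink_compact_sub k.
have /measurable_int/measurable_EFinP mK := hg _ cK KO.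
apply: measurable_funS mK; last exact: exhaust_sub.
by apply: measurable_closed_rV; exact: closed_shrink.
Qed.

Lemma Rintegral_subset_support (D B : set V) (f : V -> R) : B `<=` D ->
  (forall x, ~ B x -> f x = 0) ->
  \int[mu]_(x in D) f x = \int[mu]_(x in B) f x.
Proof. by move=> BD fB; exact: (@Rintegral_support R _ _ mu D B f BD (fun x _ => fB x)). Qed.

(** Fundamental lemma of the calculus of variations. On each set of the exhaustion the constant
    sequence [g] is weakly null, so the integral of [g] over every measurable subset vanishes. *)
Lemma ae0_of_test (g : V -> R) : L1loc Omega g ->
  (forall phi, test_function Omega phi -> \int[mu]_(x in Omega) (g x * phi x) = 0) ->
  {ae mu, forall x, Omega x -> g x = 0}.
Proof.
move=> hg test0.
suff h k : {ae mu, forall x, exhaust k x -> g x = 0}.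
  have /ae_foralln := h; apply: filterS => x hx.
  by rewrite -exhaust_bigcup => -[k _]; exact: hx.
have [cK KO] := shrink_compact_sub k.
set B := exhaust k; have oB : open B by exact: exhaust_open.
have mB : measurable B by exact: open_measurable_rV.
have BO : B `<=` Omega by apply: subset_trans KO; exact: exhaust_sub.
have bB : bounded_set B.
  by apply: (@sub_boundedr _ _ _ (globally B) (globally Omega)) => // P hP x /BO /hP.
have mK : measurable (shrink Omega k.+1%:R^-1).
  by apply: measurable_closed_rV; exact: closed_shrink.
have iB : mu.-integrable B (EFin \o g).
  exact: (integrableS mK mB (@exhaust_sub k) (hg _ cK KO)).
have mg : measurable_fun B g by apply/measurable_EFinP; exact: measurable_int iB.
have ing := integrable_norm iB.
have t0 phi : test_function B phi -> weak0 B (fun=> g) phi.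
  move=> [cphi [K [cKp KB] hphi]]; rewrite /weak0.
  rewrite (_ : (fun=> _) = (fun=> 0)); first exact: cvg_cst.
  apply/funext => m; rewrite -(test0 phi).
    rewrite (@Rintegral_subset_support Omega B)// => x nBx.
    by rewrite hphi ?mulr0// => /KB.
  by split => //; exists K => //; split => //; exact: subset_trans KB BO.
have w0 A : measurable A -> \int[mu]_(x in B) (g x * \1_A x) = 0.
  move=> mA; have := weak0_indic oB bB (fun=> mg) ing (fun _ _ _ => lexx _) t0 mA.
  by rewrite /weak0 => /cvg_lim <-//; rewrite lim_cst.
have : ae_eq mu B (EFin \o g) (EFin \o cst 0).
  apply: (integral_ae_eq mB iB); first exact/measurable_EFinP/measurable_cst.
  move=> E EB mE; rewrite /= integral0.
  have iE : mu.-integrable E (EFin \o g) by exact: (integrableS mB mE EB iB).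
  rewrite -(fineK (integrable_fin_num mE iE)); congr EFin.
  rewrite -(w0 E mE) -[LHS]/(\int[mu]_(x in E) g x).
  rewrite Rintegral_mkcond [RHS]Rintegral_mkcond.
  apply: eq_Rintegral => x _; rewrite /patch indicE.
  have [Ex|nEx] := pselect (E x).
    by rewrite !mem_set ?mulr1//; exact: EB.
  by rewrite [x \in E]memNset// mulr0; case: ifP.
by apply: filterS => x h Bx; have [] := h Bx.
Qed.

Lemma test_smooth_kernel (phi : V -> R) : test_function Omega phi -> smooth_kernel phi.
Proof.
move=> [cphi [K [_ KO] h]]; split => //; have [L _ OL] := bounded_setP bO.
by exists L => x Lx; apply: h => /KO/OL; rewrite leNgt Lx.
Qed.

Lemma smooth_kernel_measurable (k : V -> R) : smooth_kernel k -> measurable_fun setT k.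
Proof. by move=> [/(_ 0%N)/Ck_continuous ck _]; exact: continuous_measurable_rV. Qed.

Lemma smooth_kernel_bmb (k : V -> R) : smooth_kernel k -> bmb k.
Proof.
move=> hk; split; [exact: smooth_kernel_measurable| |by case: hk].
by have [C _ hC] := kernel_bounded hk; exists C.
Qed.

(** By translation invariance each difference quotient has integral 0. The quotients are bounded by
    a bound of the derivative and vanish outside a fixed ball, so dominated convergence applies. *)
Lemma Rintegral_derive0 (k : V -> R) v : smooth_kernel k -> \int[mu]_x 'D_v k x = 0.
Proof.
move=> hk; have hk1 := kernel_derive v hk.
have [C C0 hC] := kernel_bounded hk1.
have [_ [L hL]] := hk.
have dk y : derivable k y v by have [/(_ 1%N)[_ /(_ v)[]]] := hk.
have [mk _ _] := smooth_kernel_bmb hk.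
pose h (m : nat) : R := m.+1%:R^-1.
have h0 m : 0 < h m by rewrite invr_gt0.
have h1 m : h m <= 1 by rewrite invf_le1// ler1n.
pose q m (x : V) : R := (h m)^-1 * (k (x + h m *: v) - k x).
have msh m : measurable_fun setT (fun x : V => k (x + h m *: v)).
  exact: (measurableT_comp mk (measurable_shift_rV _)).
have mq m : measurable_fun setT (q m : V -> R).
  by apply: measurable_funM => //; exact: measurable_funB.
(* The steps [h m] are at most 1, so all the quotients vanish outside the ball of radius [L + |v|],
   up to a margin. *)
pose L' := L + `|v|.
have q0 m : \int[mu]_x q m x = 0.
  have ik : mu.-integrable setT (EFin \o k) by exact/bmb_integrable/smooth_kernel_bmb.
  have iks : mu.-integrable setT (EFin \o (fun x => k (x + h m *: v))).
    apply: bmb_integrable; split => //.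
      by have [D _ hD] := kernel_bounded hk; exists D.
    exists (L + `|h m *: v|) => y hy; apply: hL.
    by have := ler_normB (y + h m *: v) (h m *: v); rewrite addrK; move: hy; lra.
  rewrite /q (RintegralZl _ measurableT (integrableB_EFin measurableT iks ik)).
  by rewrite (RintegralB measurableT iks ik) Rintegral_rV_shift// subrr mulr0.
have qC m x : `|q m x| <= C * \1_(ball (0 : V) (L' + 1)) x.
  rewrite indicE; have [xL|xL] := ltP `|x| (L' + 1).
    rewrite mem_set ?mulr1; last by rewrite -ball_normE /= sub0r normrN.
    have [c _ E] := MVT_between (fun s => is_derive_line x s dk) 0 (h m).
    move: E; rewrite scale0r addr0 subr0 /q => ->.
    by rewrite mulrCA mulVf ?mulr1 ?gt_eqF.
  have Lx : L < `|x| by move: xL (normr_ge0 v); rewrite /L'; lra.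
  have hv : `|h m *: v| <= `|v|.
    by rewrite normrZ (gtr0_norm (h0 m)) ler_piMl.
  have Lx2 : L < `|x + h m *: v|.
    have := ler_normB (x + h m *: v) (h m *: v); rewrite addrK.
    by move: xL hv; rewrite /L'; lra.
  by rewrite /q (hL _ Lx) (hL _ Lx2) subrr mulr0 normr0 mulr_ge0.
have mBa : measurable (ball (0 : V) (L' + 1)) by exact: measurable_rV_ball.
have iB : mu.-integrable setT (EFin \o (fun x => C * \1_(ball (0 : V) (L' + 1)) x)).
  apply: bmb_integrable; split.
  - by apply: measurable_funM => //; exact: measurable_indic.
  - exists C => x; rewrite indicE normrM (ger0_norm C0).
    by case: (_ \in _) => /=; rewrite ?normr1 ?normr0 ?mulr1 ?mulr0.
  - exists (L' + 1) => x hx; rewrite indicE memNset ?mulr0//.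
    by rewrite -ball_normE /= sub0r normrN => /lt_trans/(_ hx); rewrite ltxx.
have [] := @Rintegral_dominated_cvg _ _ _ mu setT q ('D_v k) _ measurableT mq _ iB.
- move=> x _.
  have cd : h^-1 *: ((k \o shift x) (h *: v) - k x) @[h --> (0:R)^'] --> 'D_v k x.
    by have := dk x.
  have /cvg_at_rightP/(_ h) : h^-1 *: ((k \o shift x) (h *: v) - k x) @[h --> (0:R)^'+] --> 'D_v k x.
    apply: cvg_trans cd; apply: cvg_app => A hA.
    have hA' : \forall y \near (0 : R), y != 0 -> A y by exact: hA.
    change (\forall y \near (0 : R), 0 < y -> A y).
    by apply: filterS hA' => y hy y0; apply: hy; rewrite gt_eqF.
  have -> : (fun m => q m x) = (fun m => (h m)^-1 *: ((k \o shift x) (h m *: v) - k x)).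
    by apply/funext => m; rewrite /q /= [_ + x]addrC.
  by apply; split => //; exact: cvg_harmonic.
- by move=> m x _; exact: qC.
move=> _; under eq_fun do rewrite q0.
by move/cvg_lim => <-//; rewrite lim_cst.
Qed.

Lemma test_derive (U : set V) (phi : V -> R) v : test_function U phi ->
  test_function U ('D_v phi).
Proof.
move=> [cphi [K [cK KU] h]]; split; first by move=> j; have [_ /(_ v)[]] := cphi j.+1.
exists K => // x nKx.
have clK : closed K by apply: compact_closed => //; exact: norm_hausdorff.
have : \near x, cst 0 x = phi x.
  have : \forall y \near x, (~` K) y by apply: open_nbhs_nbhs; split => //; exact: closed_openC.
  by apply: filterS => y /h ->.
by move=> /near_eq_is_derive /(_ (is_derive_cst 0 x v))[].
Qed.

Lemma kernelM (f k : V -> R) : (forall j, Ck j f) -> smooth_kernel k ->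
  smooth_kernel (fun x => f x * k x).
Proof.
move=> cf [ck [L hL]]; split; first by move=> j; exact: CkM.
by exists L => x /hL ->; rewrite mulr0.
Qed.

Lemma test_outside (phi : V -> R) x : test_function Omega phi -> ~ Omega x -> phi x = 0.
Proof. by move=> [_ [K [_ KO] h]] nO; apply: h => /KO. Qed.

Lemma integration_by_parts (f phi : V -> R) v : (forall j, Ck j f) ->
  test_function Omega phi ->
  \int[mu]_(x in Omega) (f x * 'D_v phi x) = - \int[mu]_(x in Omega) ('D_v f x * phi x).
Proof.
move=> cf tphi; have hk := test_smooth_kernel tphi.
have tphi' := test_derive v tphi; have hk' := test_smooth_kernel tphi'.
have cdf j : Ck j ('D_v f) by have [_ /(_ v)[]] := cf j.+1.
have i1 := bmb_integrable (smooth_kernel_bmb (kernelM cf hk')).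
have i2 := bmb_integrable (smooth_kernel_bmb (kernelM cdf hk)).
apply/eqP; rewrite -addr_eq0; apply/eqP.
rewrite -(Rintegral_subset_support (@subsetT _ Omega) (f := fun x => f x * 'D_v phi x)); last first.
  by move=> x nO; rewrite (test_outside tphi') ?mulr0.
rewrite -(Rintegral_subset_support (@subsetT _ Omega) (f := fun x => 'D_v f x * phi x)); last first.
  by move=> x nO; rewrite (test_outside tphi) ?mulr0.
rewrite -(RintegralD measurableT i1 i2).
rewrite -[RHS](Rintegral_derive0 v (kernelM cf hk)); apply: eq_Rintegral => x _.
have [_ /(_ v)[df _]] := cf 1%N.
have [/(_ 1%N)[_ /(_ v)[dphi _]] _] := hk.
by rewrite [RHS](deriveM (df x) (dphi x)) [_ * phi x]mulrC.
Qed.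

Lemma L1loc_continuous (f : V -> R) : continuous f -> L1loc Omega f.
Proof.
move=> cf K cK _; have [->|/set0P K0] := eqVneq K set0; first exact: integrable_set0.
have clK : closed K by apply: compact_closed => //; exact: norm_hausdorff.
have mK : measurable K by exact: measurable_closed_rV.
have bK : bounded_set K by exact: compact_bounded.
have [L _ hL] := bounded_setP bK.
have [|c _ hc] := @EVT_max_rV R n (fun x => `|f x|) K K0 cK.
  apply: continuous_subspaceT => x.
  by apply: (@continuous_comp _ _ _ f Num.norm); [exact: cf|exact: norm_continuous].
apply: (bounded_integrable (C := `|f c|) mK (bounded_lebesgue_rV mK hL)).
  by apply: measurable_funTS; exact: continuous_measurable_rV.
by move=> x Kx; apply: hc; rewrite inE.
Qed.

Lemma is_weak_gradient_smooth (f : V -> R) : (forall j, Ck j f) ->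
  is_weak_gradient Omega f (fun x => \row_i partial i f x).
Proof.
move=> cf; split.
- exact: L1loc_continuous (Ck_continuous (cf 0%N)).
- move=> i; rewrite (_ : (fun x => _) = partial i f).
    by apply: L1loc_continuous; have [_ /(_ (delta_mx ord0 i))[_ []]] := cf 1%N.
  by apply/funext => x; rewrite mxE.
- move=> i phi tphi; rewrite (integration_by_parts _ cf tphi); congr (- _).
  by apply: eq_Rintegral => x _; rewrite mxE.
Qed.

Lemma L1loc_test_integrable (g phi : V -> R) : L1loc Omega g -> test_function Omega phi ->
  mu.-integrable Omega (EFin \o (fun x => g x * phi x)).
Proof.
move=> hg tphi; have hk := test_smooth_kernel tphi.
have mphi := smooth_kernel_measurable hk; have [C _ hC] := kernel_bounded hk.
have [_ [K [cK KO] h]] := tphi.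
have clK : closed K by apply: compact_closed => //; exact: norm_hausdorff.
have mK : measurable K by exact: measurable_closed_rV.
have iK := hg K cK KO.
have iKp : mu.-integrable K (EFin \o (fun x => g x * phi x)).
  apply: (le_integrable_EFin mK _ (integrableZl_EFin C mK (integrable_norm iK))).
    apply: measurable_funM; last exact: measurable_funTS.
    by apply/measurable_EFinP; exact: measurable_int iK.
  by move=> x Kx /=; rewrite normrM mulrC ler_wpM2r.
rewrite (_ : EFin \o _ = (EFin \o (fun x => g x * phi x)) \_ K).
  by apply/integrable_restrict => //; rewrite setIidr.
apply/funext => x; rewrite /patch; case: ifPn => //.
by rewrite notin_setE /= => /h ->; rewrite mulr0.
Qed.

Lemma L1locB (f g : V -> R) : L1loc Omega f -> L1loc Omega g -> L1loc Omega (fun x => f x - g x).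
Proof.
move=> hf hg K cK KO; apply: integrableB_EFin; [|exact: hf|exact: hg].
by apply: measurable_closed_rV; apply: compact_closed => //; exact: norm_hausdorff.
Qed.

Lemma is_weak_gradientB (f1 f2 : V -> R) g1 g2 :
  is_weak_gradient Omega f1 g1 -> is_weak_gradient Omega f2 g2 ->
  is_weak_gradient Omega (fun x => f1 x - f2 x) (fun x => g1 x - g2 x).
Proof.
move=> [lf1 lg1 h1] [lf2 lg2 h2]; split; first exact: L1locB.
  move=> i; rewrite (_ : (fun x => _) = (fun x => g1 x ord0 i - g2 x ord0 i)).
    exact: L1locB.
  by apply/funext => x; rewrite !mxE.
move=> i phi tphi; have tphi' := test_derive (delta_mx ord0 i) tphi.
transitivity (\int[mu]_(x in Omega) (f1 x * partial i phi x) -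
   \int[mu]_(x in Omega) (f2 x * partial i phi x)).
  rewrite -(RintegralB mO (L1loc_test_integrable lf1 tphi') (L1loc_test_integrable lf2 tphi')).
  by apply: eq_Rintegral => x _; rewrite mulrBl.
rewrite h1// h2// -opprD; congr (- _).
rewrite -(RintegralB mO (L1loc_test_integrable (lg1 i) tphi) (L1loc_test_integrable (lg2 i) tphi)).
by apply: eq_Rintegral => x _; rewrite !mxE mulrBl.
Qed.

Lemma is_weak_gradient_unique f g1 g2 :
  is_weak_gradient Omega f g1 -> is_weak_gradient Omega f g2 ->
  {ae mu, forall x, Omega x -> g1 x = g2 x}.
Proof.
move=> [_ lg1 h1] [_ lg2 h2].
have H (i : 'I_n) : {ae mu, forall x, Omega x -> g1 x ord0 i - g2 x ord0 i = 0}.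
  apply: ae0_of_test; first exact: L1locB.
  move=> phi tphi.
  transitivity (\int[mu]_(x in Omega) (g1 x ord0 i * phi x) -
     \int[mu]_(x in Omega) (g2 x ord0 i * phi x)).
    rewrite -(RintegralB mO (L1loc_test_integrable (lg1 i) tphi) (L1loc_test_integrable (lg2 i) tphi)).
    by apply: eq_Rintegral => x _; rewrite mulrBl.
  have := h1 i phi tphi; rewrite (h2 i phi tphi) => /oppr_inj E.
  by apply/eqP; rewrite subr_eq0; apply/eqP/esym; exact: E.
have FF : Filter (almost_everywhere mu) by typeclasses eauto.
have := filter_forall FF H.
apply: filterS => x hx Ox; apply/rowP => i; apply/eqP; rewrite -subr_eq0; apply/eqP.
exact: hx.
Qed.

(** [weak_gradient] is a choice; this is how any explicit gradient is substituted for it under an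
    integral. *)
Lemma weak_gradientP f g : is_weak_gradient Omega f g ->
  is_weak_gradient Omega f (weak_gradient Omega f) /\
  {ae mu, forall x, Omega x -> weak_gradient Omega f x = g x}.
Proof.
move=> hg; have hw : is_weak_gradient Omega f (weak_gradient Omega f).
  by rewrite /weak_gradient; apply: getPex; exists g.
by split => //; exact: is_weak_gradient_unique hw hg.
Qed.

End uniqueness.

(** * Integrals of possibly non-measurable functions that agree almost everywhere *)

Section ae_integral.
Context d (T : measurableType d) (R : realType) (mu : {measure set T -> \bar R}).
Local Open Scope ereal_scope.

Import HBNNSimple.

(** The integral of a nonnegative function is a supremum over simple functions below it. Setting
    such a simple function to 0 on the exceptional null set keeps its integral and puts it below [g]
    everywhere. *)
Let sintegral_ae_le (f g : T -> \bar R) : (forall x, 0 <= f x) -> (forall x, 0 <= g x) ->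
  {ae mu, forall x, f x = g x} -> \int[mu]_x f x <= \int[mu]_x g x.
Proof.
move=> f0 g0 [N [mN N0 subN]]; rewrite !ge0_integralTE//.
apply: ge_ereal_sup => _ [h /= hf <-].
pose h' := proj_nnsfun h (measurableC mN).
have -> : sintegral mu h = sintegral mu h'.
  rewrite -!integralT_nnsfun; apply: ge0_ae_eq_integral => //.
  - exact/measurable_EFinP.
  - exact/measurable_EFinP.
  - by move=> x _; rewrite lee_fin.
  - by move=> x _; rewrite lee_fin.
  exists N; split => // x /= hx; apply: contrapT => nN; apply: hx => _.
  by rewrite /h' /= mindicE mem_set// mulr1.
apply: ereal_sup_ubound; exists h' => // x.
rewrite /h' /= mindicE.
have [Nx|nN] := pselect (N x); first by rewrite memNset ?mulr0// => /(_ Nx).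
rewrite mem_set// mulr1.
have fgx : f x = g x by apply: contrapT => hx; apply: nN; exact: subN.
by rewrite -fgx.
Qed.

(* No measurability is assumed: the integral is a lower integral. *)
Lemma ae_eq_integral_lower (D : set T) (f g : T -> \bar R) :
  {ae mu, forall x, D x -> f x = g x} -> \int[mu]_(x in D) f x = \int[mu]_(x in D) g x.
Proof.
move=> fg; rewrite integral_mkcond [RHS]integral_mkcond.
have {}fg : {ae mu, forall x, (f \_ D) x = (g \_ D) x}.
  move: fg; apply: filterS => x h; rewrite /patch; case: ifPn => //.
  by rewrite inE => /h.
have gf : {ae mu, forall x, (g \_ D) x = (f \_ D) x}.
  by move: fg; apply: filterS => x ->.
rewrite integralE [RHS]integralE; congr (_ - _); apply/eqP; rewrite eq_le;
  apply/andP; split; apply: sintegral_ae_le => //.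
- by move: fg; apply: filterS => x h; rewrite !funeposE h.
- by move: gf; apply: filterS => x h; rewrite !funeposE h.
- by move: fg; apply: filterS => x h; rewrite !funenegE h.
- by move: gf; apply: filterS => x h; rewrite !funenegE h.
Qed.

Lemma ae_eq_Rintegral_lower (D : set T) (f g : T -> R) :
  {ae mu, forall x, D x -> f x = g x} ->
  (\int[mu]_(x in D) f x = \int[mu]_(x in D) g x)%R.
Proof.
move=> fg; congr fine; apply: ae_eq_integral_lower.
by move: fg; apply: filterS => x h Dx; rewrite h.
Qed.

Lemma ae0_Lnorm (p : R) (f : T -> R) : (p != 0)%R -> {ae mu, forall x, f x = 0%R} ->
  'N[mu]_(p%:E)[EFin \o f] = 0.
Proof.
move=> p0 f0; rewrite -(@Lnorm0 _ _ _ mu p%:E) ?eqe// unlock; congr (_ `^ _).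
by apply: ae_eq_integral_lower; move: f0; apply: filterS => x h _ /=; rewrite h.
Qed.

End ae_integral.

(** * Test functions belong to [H^1_0] *)

Section test_in_H10.
Context (R : realType) (n : nat).
Let V := 'rV[R]_n.
Let mu := @lebesgue_rV R n.
Variable Omega : set V.
Hypotheses (oO : open Omega) (bO : bounded_set Omega).

Let mO : measurable Omega. Proof. exact: open_measurable_rV. Qed.

Lemma measurable_enorm d (T : measurableType d) (D : set T) (g : T -> V) :
  measurable D -> (forall i, measurable_fun D (fun x => g x ord0 i)) ->
  measurable_fun D (fun x => enorm (g x)).
Proof.
move=> mD mg.
apply: (@measurableT_comp _ _ _ _ _ _ (@Num.sqrt R)).
  by apply: continuous_measurable_fun; exact: sqrt_continuous.
apply: measurable_sum => i.
exact: measurable_funX.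
Qed.

Lemma bounded_in_Lp (s : R) (f : V -> R) (C : R) : measurable_fun Omega f ->
  {ae mu, forall x, Omega x -> `|f x| <= C} -> 0 < s -> in_Lp Omega s%:E f.
Proof.
move=> mf fC s0; rewrite /in_Lp.
have mfO : measurable_fun setT (f \_ Omega) by exact: (measurable_restrictT _ mO).1 mf.
rewrite /Lfun inE; apply/andP; split; rewrite inE//=.
rewrite /finite_norm unlock; apply: poweR_lty.
have C0 : 0 <= `|C| by [].
apply: (@le_lt_trans _ _ (\int[mu]_x ((`|C| `^ s) * \1_Omega x)%:E)%E).
  apply: ae_ge0_le_integral => //.
  - by move=> x _; exact: poweR_ge0.
  - apply: (@measurableT_comp _ _ _ _ _ _ (fun x => poweR x s)); first exact: measurable_poweR.
    by apply: measurableT_comp => //; exact/measurable_EFinP.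
  - by apply/measurable_EFinP; apply: measurable_funM => //; exact: measurable_indic.
  move: fC; apply: filterS => x hx _ /=.
  rewrite lee_fin indicE /patch.
  have [Ox|nO] := boolP (x \in Omega); last by rewrite normr0 powR0 ?mulr0// gt_eqF.
  rewrite mulr1; apply: ge0_ler_powR; rewrite ?nnegrE//; first exact: ltW.
  by rewrite (le_trans (hx (set_mem Ox)))// ler_norm.
under eq_integral do rewrite EFinM.
rewrite ge0_integralZl//.
  rewrite integral_indic// setIT lte_mul_pinfty ?lee_fin ?powR_ge0//.
  exact: finite_lebesgue_bounded.
by apply/measurable_EFinP; exact: measurable_indic.
Qed.

(** [phi] approximates itself. The chosen gradient of [phi - phi] is known to vanish only almost
    everywhere, which is enough for its norm to be 0. *)
Lemma test_in_H10 (phi : V -> R) : test_function Omega phi -> in_H10 Omega phi.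
Proof.
move=> tphi; have hk := test_smooth_kernel bO tphi; have [cphi _] := tphi.
have [C _ hC] := kernel_bounded hk.
have [hw aew] := weak_gradientP oO bO (is_weak_gradient_smooth bO cphi).
have [_ lw _] := hw.
split; first split => //.
- apply: (@bounded_in_Lp 2 _ C) => //; last by apply: aeW => x _.
  by apply: measurable_funTS; exact: smooth_kernel_measurable.
- move=> i; have [D _ hD] := kernel_bounded (kernel_derive (delta_mx ord0 i) hk).
  apply: (@bounded_in_Lp 2 _ D) => //; first exact: L1loc_measurable.
  by move: aew; apply: filterS => x h Ox; rewrite h// mxE; exact: hD.
move=> eps eps0; exists phi => //.
have [hw0 aew0] := weak_gradientP oO bO (is_weak_gradientB oO bO hw hw).
rewrite /W1_norm /Lp_norm.
rewrite ae0_Lnorm//; last first.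
  by apply: aeW => x; rewrite /patch subrr; case: ifP.
rewrite ae0_Lnorm//; first by rewrite adde0 lte_fin.
move: aew0; apply: filterS => x h; rewrite /patch; case: ifPn => //.
rewrite inE => /h ->; rewrite subrr /enorm big1 ?sqrtr0// => i _.
by rewrite mxE expr0n.
Qed.

End test_in_H10.

(** * Lipschitz bounds from weak gradients *)

Lemma ler_dist_approx (R : realType) (a1 a2 b1 b2 m t : R) :
  `|a1 - b1| <= t / 2 -> `|a2 - b2| <= t / 2 -> `|a1 - a2| <= m -> `|b1 - b2| <= m + t.
Proof.
rewrite !ler_norml => /andP[h1 h2] /andP[h3 h4] /andP[h5 h6].
by apply/andP; split; lra.
Qed.

Section weak_lipschitz.
Context (R : realType) (n : nat).
Let V := 'rV[R]_n.
Let mu := @lebesgue_rV R n.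
Variable Omega : set V.
Hypotheses (oO : open Omega) (bO : bounded_set Omega).

Let mO : measurable Omega. Proof. exact: open_measurable_rV. Qed.

Lemma compact_thick (K : set V) : compact K -> K `<=` Omega ->
  exists2 d : R, 0 < d & forall x y, K x -> `|x - y| < d -> Omega y.
Proof.
move=> /compact_near_coveringP cK KO.
have := cK R (0^'+) (fun d x => forall y, `|x - y| < d -> Omega y) _ _.
case.
  move=> x Kx; have /nbhs_ballP[r /= r0 hr] := open_nbhs_nbhs (conj oO (KO _ Kx)).
  exists (ball x (r / 2), [set d | d < r / 2]).
    split; first by apply: nbhsx_ballx; rewrite divr_gt0.
    by apply: nbhs_right_lt; rewrite divr_gt0.
  move=> [x' d] /= [xx' dr] y xy; apply: hr; rewrite -ball_normE /=.
  rewrite -(subrKA x') (le_lt_trans (ler_normD _ _))// (splitr r) ltrD//.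
    by move: xx'; rewrite -ball_normE.
  exact: lt_trans dr.
move=> d /= d0 hd; exists (d / 2); first by rewrite divr_gt0.
move=> x y Kx xy; apply: (hd (d / 2) _ _ x Kx y xy) => /=; last by rewrite divr_gt0.
by rewrite sub0r normrN gtr0_norm ?divr_gt0//; move: d0; lra.
Qed.

Lemma is_derive_reflect (k : V -> R) (z y v : V) : (forall x, derivable k x v) ->
  is_derive y v (fun y => k (z - y)) (- 'D_v k (z - y)).
Proof.
move=> dk.
have h1 := is_derive_line (z - y) 0 dk; rewrite scale0r addr0 in h1.
have h2 : is_derive (0 : R) 1 (fun s : R => - s) (-1).
  exact: is_deriveN.
have h1' : is_derive (- (0 : R)) 1 (fun s : R => k (z - y + s *: v)) ('D_v k (z - y)).
  by rewrite oppr0.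
have h3 := @is_derive1_comp _ (fun s : R => k (z - y + s *: v)) (fun s : R => - s) 0 _ _ h1' h2.
rewrite mulrN1 in h3.
have E : (fun h : R => h^-1 *: (((fun y => k (z - y)) \o shift y) (h *: v) - k (z - y))) =
  (fun h : R => h^-1 *: ((((fun s : R => k (z - y + s *: v)) \o (fun s : R => - s)) \o shift 0) (h *: 1)
     - ((fun s : R => k (z - y + s *: v)) \o (fun s : R => - s)) 0)).
  apply/funext => h /=; rewrite [h *: 1]mulr1 addr0 oppr0 scale0r addr0.
  by rewrite opprD addrCA addrC scaleNr.
have [d3 e3] := h3.
apply: DeriveDef; first by rewrite /derivable E.
by rewrite /derive E; exact: e3.
Qed.

Lemma continuous_sub_point (z : V) : continuous (fun y : V => z - y).
Proof.
move=> y; apply: (@continuousB _ _ _ (fun=> z) id); first exact: cst_continuous.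
by move=> ?.
Qed.

Lemma Ck_reflect (k : V -> R) (z : V) j : (forall i, Ck i k) ->
  Ck j (fun y : V => k (z - y)).
Proof.
move=> ck; have ck0 : continuous (fun y : V => k (z - y)).
  move=> y; apply: (@continuous_comp _ _ _ (fun y : V => z - y) k).
    exact: continuous_sub_point.
  exact: Ck_continuous (ck 0%N) _.
elim: j k ck ck0 => [|j ih] k ck ck0; split => //.
move=> v; have dk x : derivable k x v by have [_ /(_ v)[]] := ck 1%N.
split; first by move=> y; have [] := is_derive_reflect z y dk.
rewrite (_ : 'D_v _ = (fun y => (fun=> (-1)) y * 'D_v k (z - y))).
  apply: CkM; first exact: Ck_cst.
  have cdk i : Ck i ('D_v k) by have [_ /(_ v)[]] := ck i.+1.
  apply: (ih ('D_v k)) => // y; apply: (@continuous_comp _ _ _ (fun y : V => z - y) ('D_v k)).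
    exact: continuous_sub_point.
  exact: Ck_continuous (cdk 0%N) _.
by apply/funext => y; have [_ ->] := is_derive_reflect z y dk; rewrite mulN1r.
Qed.

Lemma moll_test (e d : R) z : 0 < e -> e < d -> (forall y, `|z - y| < d -> Omega y) ->
  test_function Omega (fun y => moll e (z - y)).
Proof.
move=> e0 ed zd; split; first by move=> j; apply: Ck_reflect; have [] := @moll_kernel R n e e0.
exists [set y | `|z - y| <= e].
  split; last by move=> y /= zy; apply: zd; exact: le_lt_trans ed.
  apply: bounded_closed_compact.
    exists (e + `|z|); split; first exact: num_real.
    move=> M hM y /= zy; apply: le_trans (ltW hM).
    by rewrite -[y](subrK z) (le_trans (ler_normD _ _))// lerD2r distrC.
  rewrite (_ : [set y | _] = (fun y : V => `|z - y|) @^-1` [set r | r <= e])//.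
  apply: closed_comp; last exact: closed_le.
  move=> y _; apply: (@continuous_comp _ _ _ (fun y : V => z - y) Num.norm); last exact: norm_continuous.
  exact: continuous_sub_point.
by move=> y /negP; rewrite -ltNge => /ltW; exact: moll_eq0.
Qed.

Variables (f : V -> R) (g : V -> V) (M : R) (i : 'I_n).
Hypotheses (cf : continuous f) (bf : bounded_support f).
Hypothesis wg : is_weak_gradient Omega f g.
Hypothesis M0 : 0 <= M.
Hypothesis gM : {ae mu, forall x, Omega x -> `|g x ord0 i| <= M}.

Let ei : V := delta_mx ord0 i.

Let hf : bmb f.
Proof.
by split; [exact: continuous_measurable_rV|exact: continuous_bounded_support|].
Qed.

(** The function [y |-> moll e (z - y)] is a test function of Omega, so the derivative of the
    mollification at [z] is an average of the weak derivative [g]. *)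
Lemma mollify_derive_le (e d : R) z : 0 < e -> e < d -> (forall y, `|z - y| < d -> Omega y) ->
  `|'D_ei (mollify e f) z| <= M.
Proof.
move=> e0 ed zd; have hk := @moll_kernel R n e e0.
have tchi := moll_test e0 ed zd.
have [_ ->] := convol_is_derive z ei hk hf.
have dk x : derivable (moll e) x ei by have [/(_ 1%N)[_ /(_ ei)[]]] := hk.
have E y : partial i (fun y => moll e (z - y)) y = - 'D_ei (moll e) (z - y).
  by rewrite /partial; have [_ ->] := is_derive_reflect z y dk.
have tchi' := test_derive ei tchi.
have [lf lg wgi] := wg.
have -> : convol ('D_ei (moll e)) f z = \int[mu]_(x in Omega) (g x ord0 i * moll e (z - x)).
  apply: oppr_inj; rewrite -(wgi i _ tchi).
  rewrite -(Rintegral_subset_support (@subsetT _ Omega) (f := fun x => f x * partial i (fun y => moll e (z - y)) x)); last first.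
    by move=> x nO; rewrite [partial _ _ _](test_outside tchi') ?mulr0.
  rewrite /convol -mulN1r -(RintegralZl (-1) measurableT (convol_integrable z (kernel_derive ei hk) hf)).
  by apply: eq_Rintegral => y _; rewrite E mulN1r mulrN.
have ig := L1loc_test_integrable oO bO (lg i) tchi.
have i1 := moll_integrable z e0.
have iO : mu.-integrable Omega (EFin \o (fun y => moll e (z - y))).
  exact: (integrableS measurableT mO (@subsetT _ _) i1).
have -> : M = \int[mu]_(y in Omega) (M * moll e (z - y)).
  rewrite (RintegralZl M mO iO) -[LHS]mulr1; congr (_ * _).
  rewrite -(Rintegral_subset_support (@subsetT _ Omega)) ?Rintegral_moll//.
  by move=> x nO; exact: (test_outside tchi).
apply: (le_trans (le_normr_Rintegral mO ig)).
have mchi : measurable_fun Omega (fun y => moll e (z - y)).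
  by apply/measurable_EFinP; exact: measurable_int iO.
(* The bound on [g] holds only almost everywhere. [b] agrees almost everywhere with the integrand
   and satisfies the desired bound everywhere. *)
pose b (x : V) : R := Num.min `|g x ord0 i * moll e (z - x)| (M * moll e (z - x)).
have mb1 : measurable_fun Omega (fun x => `|g x ord0 i * moll e (z - x)|).
  by apply/measurable_EFinP; exact: measurable_int (integrable_norm ig).
rewrite (@ae_eq_Rintegral_lower _ _ _ mu Omega
  (fun x => `|g x ord0 i * moll e (z - x)|) b); last first.
  move: gM; apply: filterS => x h Ox; rewrite /b; apply: esym; apply: min_l.
  by rewrite normrM (ger0_norm (moll_ge0 _ e0)) ler_wpM2r ?moll_ge0// h.
apply: le_Rintegral => //.
- apply: (le_integrable_EFin mO _ (integrable_norm ig)).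
    by apply: measurable_minr => //; exact: measurable_funM.
  move=> x Ox; rewrite /b /= ger0_norm ?ge_min ?lexx// le_min normr_ge0/=.
  by rewrite mulr_ge0// moll_ge0.
- exact: integrableZl_EFin.
- by move=> x Ox; rewrite /b ge_min lexx orbT.
Qed.

Lemma mollify_cvg (eta : R) : 0 < eta ->
  exists2 d : R, 0 < d & forall e, 0 < e -> e <= d -> forall x, `|mollify e f x - f x| <= eta.
Proof.
move=> eta0; have [d d0 hd] := bounded_support_uniform_continuous cf bf eta0.
exists d => // e e0 ed y; apply: mollify_near => // z yz.
by rewrite distrC ltW// hd// (lt_le_trans yz).
Qed.

Let line (x : V) (s : R) : V := x + s *: ei.

Let line_continuous x : continuous (line x).
Proof.
move=> s; rewrite /line.
apply: (@continuousD _ _ _ (fun=> x) (fun s : R => s *: ei)); first exact: cst_continuous.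
exact: scalel_continuous.
Qed.

(** A compact segment in Omega has a tube around it in Omega, so at small scales the mollifications
    have slope at most [M] along it; they converge uniformly to [f]. *)
Lemma weak_lipschitz_segment x (h : R) : 0 <= h ->
  (forall s, 0 <= s <= h -> Omega (x + s *: ei)) -> `|f (x + h *: ei) - f x| <= M * h.
Proof.
move=> h0 seg.
have cK : compact (line x @` `[0, h]).
  apply: continuous_compact; last exact: segment_compact.
  exact/continuous_subspaceT/line_continuous.
have KO : line x @` `[0, h] `<=` Omega.
  by move=> _ [s /= hs <-]; apply: seg; move: hs; rewrite in_itv.
have [d d0 hd] := compact_thick cK KO.
have hseg s z : 0 <= s <= h -> `|x + s *: ei - z| < d -> Omega z.
  by move=> hs; apply: hd; exists s => //=; rewrite in_itv.
apply/ler_addgt0Pr => eta eta0.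
have [d' d'0 hd'] := mollify_cvg (divr_gt0 eta0 (ltr0Sn R 1)).
pose e := Num.min (d / 2) d'.
have e0 : 0 < e by rewrite lt_min d'0 divr_gt0.
have ed : e < d.
  by apply: (@le_lt_trans _ _ (d / 2)); [rewrite ge_min lexx|move: d0; lra].
have ed' : e <= d' by rewrite ge_min lexx orbT.
have hk := @moll_kernel R n e e0.
have dk y : derivable (mollify e f) y ei by have [] := convol_is_derive y ei hk hf.
have [c c0h E] := MVT_segment h0 (fun s _ => is_derive_line x s dk)
  (continuous_subspaceT (fun s => differentiable_continuous
    ((derivable1_diffP _ _).1 (@ex_derive _ _ _ _ _ _ _ (is_derive_line x s dk))))).
apply: (ler_dist_approx (hd' e e0 ed' (x + h *: ei)) (hd' e e0 ed' x)).
have := E; rewrite scale0r addr0 subr0 => ->; rewrite normrM (ger0_norm h0) ler_wpM2r//.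
apply: (mollify_derive_le e0 ed) => y; apply: hseg.
by move: c0h; rewrite in_itv.
Qed.

Hypothesis f0 : forall x, 0 <= f x.
Hypothesis fO : forall x, ~ Omega x -> f x = 0.

Lemma weak_lipschitz_signed x (sg : R) (h : R) : sg = 1 \/ sg = -1 -> 0 <= h ->
  (forall s, 0 <= s <= h -> Omega (x + (sg * s) *: ei)) ->
  `|f (x + (sg * h) *: ei) - f x| <= M * h.
Proof.
move=> [->|->] h0 seg.
  by rewrite mul1r; apply: weak_lipschitz_segment => // s hs; have := seg s hs; rewrite mul1r.
rewrite distrC mulN1r scaleNr.
have := @weak_lipschitz_segment (x - h *: ei) h h0; rewrite subrK; apply.
move=> s /andP[s0 sh].
have := seg (h - s); rewrite subr_ge0 sh gerBl s0 => /(_ isT).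
by rewrite mulN1r opprB scalerBl addrCA addrC.
Qed.

(** Let [tau] be the first time at which the ray is outside Omega. Since Omega is open, the point at
    [tau] is already outside, so [f] vanishes there; just before [tau] the segment from [x] is still
    inside and the slope bound applies. *)
Lemma weak_lipschitz_exit x (sg : R) (h : R) : sg = 1 \/ sg = -1 -> 0 <= h ->
  ~ (forall s, 0 <= s <= h -> Omega (x + (sg * s) *: ei)) -> f x <= M * h.
Proof.
move=> hsg h0 /existsNP[s0 /not_implyP[/andP[s00 s0h] nO]].
have Mh0 : 0 <= M * h by rewrite mulr_ge0.
have [Ox|nOx] := pselect (Omega x); last by rewrite fO.
pose F s := f (x + (sg * s) *: ei).
have cline : continuous (fun s : R => x + (sg * s) *: ei).
  move=> s; apply: (@continuous_comp _ _ _ (fun s => sg * s) (line x)); last exact: line_continuous.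
  exact: mulrl_continuous.
have cF : continuous F.
  move=> s; apply: (@continuous_comp _ _ _ (fun s : R => x + (sg * s) *: ei) f).
    exact: cline.
  exact: cf.
pose S : set R := [set s | 0 <= s /\ ~ Omega (x + (sg * s) *: ei)].
have hS : has_inf S by split; [exists s0|exists 0 => s []].
pose tau := inf S.
have tau0 : 0 <= tau by apply: lb_le_inf; [case: hS|move=> s []].
have tau_le t : S t -> tau <= t by move=> St; apply: ge_inf => //; case: hS.
have tauh : tau <= h by apply: le_trans s0h; exact: tau_le.
have nOtau : ~ Omega (x + (sg * tau) *: ei).
  move=> Ot.
  have : \forall s \near tau, Omega (x + (sg * s) *: ei).
    by apply: cline; apply: open_nbhs_nbhs.
  move=> /nbhs_ballP[r /= r0 hr].
  have [s [s1 s2] st] := inf_adherent r0 hS.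
  have ts : tau <= s by exact: tau_le.
  apply: s2; apply: hr; rewrite -ball_normE /= distrC ger0_norm ?subr_ge0//.
  by rewrite ltrBlDl.
have tau_gt0 : 0 < tau.
  rewrite lt_neqAle tau0 andbT; apply/eqP => t0.
  by apply: nOtau; rewrite -t0 mulr0 scale0r addr0.
have Ftau : F tau = 0 by exact: fO.
apply/ler_addgt0Pr => eta eta0.
have /cvgrPdist_lt/(_ _ eta0) := cF tau; rewrite Ftau => /nbhs_ballP[r /= r0 hr].
pose s := Num.max 0 (tau - r / 2).
have s_ge0 : 0 <= s by rewrite le_max lexx.
have st : s < tau by rewrite gt_max tau_gt0/=; move: r0; lra.
have Fs : F s < eta.
  have : `|0 - F s| < eta.
    apply: hr; rewrite -ball_normE /= ger0_norm ?subr_ge0 ?ltW//.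
    have : tau - r / 2 <= s by rewrite le_max lexx orbT.
    by move: r0; lra.
  by rewrite sub0r normrN; apply: le_lt_trans; exact: ler_norm.
have seg t : 0 <= t <= s -> Omega (x + (sg * t) *: ei).
  move=> /andP[t0 ts]; apply: contrapT => nOt.
  by have := tau_le t (conj t0 nOt); rewrite leNgt (le_lt_trans ts st).
have := weak_lipschitz_signed hsg s_ge0 seg; rewrite -/(F s) ler_norml => /andP[h1 _].
have : M * s <= M * h by rewrite ler_wpM2l// (le_trans (ltW st)).
by move: h1 Fs; lra.
Qed.

(** If the segment leaves Omega, both end values are at most [M * |h|] by [weak_lipschitz_exit],
    applied from each end. As they are nonnegative, so is their difference in absolute value: the
    constant stays [M]. *)
Lemma weak_coord_lipschitz x (h : R) : `|f (x + h *: ei) - f x| <= M * `|h|.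
Proof.
wlog h0 : x h / 0 <= h.
  move=> H; have [h0|h0] := leP 0 h; first exact: H.
  have := H (x + h *: ei) (- h); rewrite scaleNr addrK normrN distrC; apply.
  by rewrite oppr_ge0 ltW.
rewrite (ger0_norm h0).
have [seg|nseg] := pselect (forall s, 0 <= s <= h -> Omega (x + s *: ei)).
  exact: weak_lipschitz_segment.
have h1 : f x <= M * h.
  apply: (@weak_lipschitz_exit x 1) => //; first by left.
  by apply: contra_not nseg => H s /H; rewrite mul1r.
have h2 : f (x + h *: ei) <= M * h.
  apply: (@weak_lipschitz_exit _ (-1)) => //; first by right.
  apply: contra_not nseg => H s /andP[s0 sh].
  have := H (h - s); rewrite subr_ge0 sh gerBl s0 => /(_ isT).
  by rewrite -addrA -scalerDl mulN1r opprB [h + _]addrC subrK.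
have := f0 x; have := f0 (x + h *: ei).
by rewrite ler_norml => h3 h4; apply/andP; split; lra.
Qed.

End weak_lipschitz.

(** * The chain rule for powers *)

Section powR_calculus.
Context (R : realType).
Implicit Types a b m t : R.

Lemma ler_powRl t a b : 0 <= t -> 0 <= a -> a <= b -> a `^ t <= b `^ t.
Proof.
by move=> t0 a0 ab; apply: ge0_ler_powR => //; rewrite nnegrE// (le_trans a0).
Qed.

Lemma continuous_powR_ge0 t a : 0 < t -> 0 <= a ->
  (fun x => x `^ t) x @[x --> within [set x | 0 <= x] (nbhs a)] --> a `^ t.
Proof.
move=> t0; rewrite le_eqVlt => /predU1P[<-|a0].
  rewrite powR0 ?gt_eqF//; apply/cvgr0Pnorm_lt => e e0.
  have ei0 : 0 < e `^ t^-1 by exact: powR_gt0.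
  rewrite near_withinE; apply/nbhs_ballP; exists (e `^ t^-1) => // x.
  rewrite -ball_normE /= sub0r normrN => xe x0.
  rewrite ger0_norm ?powR_ge0//.
  have -> : e = (e `^ t^-1) `^ t by rewrite -powRrM mulVf ?gt_eqF// powRr1// ltW.
  rewrite gt0_ltr_powR ?nnegrE// ?ltW//.
  by rewrite ger0_norm in xe.
apply: cvg_within_filter.
have := @derivable_powR R 1 t a; rewrite in_itv/= a0 => /(_ isT)/derivable1_diffP.
exact: differentiable_continuous.
Qed.

Lemma powR_cvg_ge0 t a (c : nat -> R) : 0 < t -> 0 <= a -> (forall k, 0 <= c k) ->
  c k @[k --> \oo] --> a -> c k `^ t @[k --> \oo] --> a `^ t.
Proof.
move=> t0 a0 c0 ca A /(continuous_powR_ge0 t0 a0).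
rewrite /= /fmap/= => hA; have : \forall x \near a, 0 <= x -> A (x `^ t) by exact: hA.
move=> /ca h; have h' : \forall k \near \oo, 0 <= c k -> A (c k `^ t) by exact: h.
change (\forall k \near \oo, A (c k `^ t)).
by apply: filterS h' => k; apply; exact: c0.
Qed.

Lemma powR_MVT m a b : 1 < m -> 0 <= a -> a <= b ->
  exists2 c, a <= c <= b & b `^ m - a `^ m = m * c `^ (m - 1) * (b - a).
Proof.
move=> m1 a0 ab.
have m0 : 0 < m by apply: lt_trans m1.
have [||c] := @MVT_segment R (fun x => x `^ m) (fun x => m * x `^ (m - 1)) a b ab.
- move=> x; rewrite in_itv /= => /andP[ax _].
  exact/is_derive1_powR/(le_lt_trans a0 ax).
- apply/subspace_continuousP => x; rewrite /= in_itv /= => /andP[ax xb] A hA.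
  have := continuous_powR_ge0 m0 (le_trans a0 ax) hA.
  rewrite /= /fmap /= => hB.
  have hB' : \forall x \near x, 0 <= x -> A (x `^ m) by exact: hB.
  change (\forall x \near x, x \in `[a, b] -> A (x `^ m)).
  apply: filterS hB' => y hy; rewrite in_itv /= => /andP[ay _]; apply: hy.
  exact: le_trans a0 ay.
by rewrite in_itv /= => cab E; exists c.
Qed.

Lemma powR_MVT_sym m a b : 1 < m -> 0 <= a -> 0 <= b ->
  exists c, [/\ 0 <= c, `|c - a| <= `|b - a|, c <= Num.max a b &
   b `^ m - a `^ m = m * c `^ (m - 1) * (b - a)].
Proof.
move=> m1 a0 b0; have [ab|/ltW ba] := leP a b.
  have [c /andP[ac cb] E] := powR_MVT m1 a0 ab; exists c; split => //.
  - exact: le_trans ac.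
  - by rewrite !ger0_norm ?subr_ge0// lerD2r.
have [c /andP[bc ca] E] := powR_MVT m1 b0 ba; exists c; split => //.
- exact: le_trans bc.
- by rewrite distrC [leRHS]distrC !ger0_norm ?subr_ge0// lerD2l lerN2.
- by rewrite -opprB E -mulrN opprB.
Qed.

End powR_calculus.

(** * Difference quotients *)

Section difference_quotient.
Context (R : realType) (n : nat).
Let V := 'rV[R]_n.
Let mu := @lebesgue_rV R n.

Definition hk (k : nat) : R := k.+1%:R^-1.

Lemma hk_gt0 k : 0 < hk k. Proof. by rewrite invr_gt0. Qed.

Lemma hk_le1 k : hk k <= 1. Proof. by rewrite invf_le1// ler1n. Qed.

Lemma hk_cvg0 : hk k @[k --> \oo] --> (0 : R).
Proof. exact: cvg_harmonic. Qed.

Lemma derivable_hk (chi : V -> R) x (v : V) (s : R) : s = 1 \/ s = -1 -> derivable chi x v ->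
  (s * hk k)^-1 * (chi (x + (s * hk k) *: v) - chi x) @[k --> \oo] --> 'D_v chi x.
Proof.
move=> hs dc.
have cd : h^-1 *: ((chi \o shift x) (h *: v) - chi x) @[h --> (0:R)^'] --> 'D_v chi x.
  by have := dc.
move=> A /cd hA.
have hA' : \forall h \near (0 : R), h != 0 -> A (h^-1 *: (chi (h *: v + x) - chi x)) by exact: hA.
have cs : s * hk k @[k --> \oo] --> (0 : R).
  by rewrite -[0](mulr0 s); apply: cvgMr; exact: hk_cvg0.
have hk' : \forall k \near \oo, s * hk k != 0 ->
    A ((s * hk k)^-1 *: (chi ((s * hk k) *: v + x) - chi x)) by exact: (cs _ hA').
change (\forall k \near \oo, A ((s * hk k)^-1 * (chi (x + (s * hk k) *: v) - chi x))).
apply: filterS hk' => k; rewrite [_ + x]addrC; apply.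
have hn : hk k != 0 by rewrite gt_eqF ?hk_gt0.
by case: hs => ->; rewrite ?mul1r ?mulN1r ?oppr_eq0.
Qed.

Lemma bmb_shift (f : V -> R) (a : V) : bmb f -> bmb (fun x => f (x + a)).
Proof.
move=> [mf [C hC] [L hL]]; split.
- exact: (measurableT_comp mf (measurable_shift_rV _)).
- by exists C => y.
- exists (L + `|a|) => y hy; apply: hL.
  by have := ler_normB (y + a) a; rewrite addrK; move: hy; lra.
Qed.

Lemma bmbMl (f g : V -> R) : bmb f -> measurable_fun setT g ->
  (exists C : R, forall x, `|g x| <= C) -> bmb (fun x => g x * f x).
Proof.
move=> hf mg hg; rewrite (_ : (fun x => _) = (fun x => f x * g x)); first exact: bmbM.
by apply/funext => x; rewrite mulrC.
Qed.

Definition dquot (f : V -> R) (v : V) k (x : V) : R := (hk k)^-1 * (f (x + hk k *: v) - f x).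

Lemma dquot_measurable f v k : measurable_fun setT f -> measurable_fun setT (dquot f v k).
Proof.
move=> mf; apply: measurable_funM => //; apply: measurable_funB => //.
exact: (measurableT_comp mf (measurable_shift_rV _)).
Qed.

(** Discrete integration by parts: translation invariance moves the forward quotient of [f] to a
    backward quotient of [chi], which converges boundedly. *)
Lemma Rintegral_dquot_test (f chi : V -> R) v : bmb f -> smooth_kernel chi ->
  \int[mu]_x (chi x * dquot f v k x) @[k --> \oo] --> - \int[mu]_x (f x * 'D_v chi x).
Proof.
move=> hf hc; have hchi := smooth_kernel_bmb hc.
have [mc [Cc hCc] _] := hchi; have [mf [Cf hCf] _] := hf.
have [D D0 hD] := kernel_bounded (kernel_derive v hc).
have dc x : derivable chi x v by have [/(_ 1%N)[_ /(_ v)[]]] := hc.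
pose q k x := (-1 * hk k)^-1 * (chi (x + (-1 * hk k) *: v) - chi x).
have mq k : measurable_fun setT (q k).
  apply: measurable_funM => //; apply: measurable_funB => //.
  exact: (measurableT_comp mc (measurable_shift_rV _)).
have qD k x : `|q k x| <= D.
  have [c _ E] := MVT_between (fun s => is_derive_line x s dc) 0 (-1 * hk k).
  move: E; rewrite scale0r addr0 subr0 /q => ->.
  have hn : -1 * hk k != 0 by rewrite mulN1r oppr_eq0 gt_eqF ?hk_gt0.
  by rewrite mulrCA mulVf ?mulr1.
have E k : \int[mu]_x (chi x * dquot f v k x) = - \int[mu]_x (f x * q k x).
  have i1 : mu.-integrable setT (EFin \o (fun x => chi x * f (x + hk k *: v))).
    by apply/bmb_integrable/bmbMl => //; [exact: bmb_shift|exists Cc].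
  have i2 : mu.-integrable setT (EFin \o (fun x => chi x * f x)).
    by apply/bmb_integrable/bmbMl => //; exists Cc.
  have i3 : mu.-integrable setT (EFin \o (fun x => chi (x - hk k *: v) * f x)).
    apply/bmb_integrable/bmbMl => //; last by exists Cc.
    exact: (measurableT_comp mc (measurable_shift_rV _)).
  transitivity ((hk k)^-1 * (\int[mu]_x (chi x * f (x + hk k *: v)) - \int[mu]_x (chi x * f x))).
    rewrite -(RintegralB measurableT i1 i2) -(RintegralZl _ measurableT (integrableB_EFin measurableT i1 i2)).
    by apply: eq_Rintegral => x _; rewrite /dquot; ring.
  have -> : \int[mu]_x (chi x * f (x + hk k *: v)) = \int[mu]_x (chi (x - hk k *: v) * f x).
    rewrite -(Rintegral_rV_shift (hk k *: v) (f := fun x => chi (x - hk k *: v) * f x)).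
      by apply: eq_Rintegral => x _; rewrite addrK.
    apply: measurable_funM => //.
    exact: (measurableT_comp mc (measurable_shift_rV _)).
  rewrite -(RintegralB measurableT i3 i2) -(RintegralZl _ measurableT (integrableB_EFin measurableT i3 i2)).
  rewrite -mulN1r -RintegralZl//; last by apply/bmb_integrable/bmbM => //; exists D.
  apply: eq_Rintegral => x _; rewrite /q mulN1r scaleNr invrN; ring.
under eq_fun do rewrite E.
apply: cvgN.
have iD : mu.-integrable setT (EFin \o (fun x => D * `|f x|)).
  by apply: integrableZl_EFin => //; apply: integrable_norm; exact: bmb_integrable.
have [] := @Rintegral_dominated_cvg _ _ _ mu setT (fun k x => f x * q k x)
  (fun x => f x * 'D_v chi x) (fun x => D * `|f x|) measurableT _ _ iD => //.
- by move=> k; exact: measurable_funM.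
- by move=> x _; apply: cvgMr; apply: derivable_hk => //; right.
- by move=> k x _; rewrite normrM mulrC ler_wpM2r.
Qed.

End difference_quotient.

Section nice_gradient.
Context (R : realType) (n : nat).
Let V := 'rV[R]_n.
Let mu := @lebesgue_rV R n.
Variable Omega : set V.
Hypotheses (oO : open Omega) (bO : bounded_set Omega).

Let mO : measurable Omega. Proof. exact: open_measurable_rV. Qed.

Lemma bounded_L1loc (f : V -> R) (C : R) : measurable_fun Omega f ->
  (forall x, Omega x -> `|f x| <= C) -> L1loc Omega f.
Proof.
move=> mf fC K cK KO.
have mK : measurable K.
  by apply: measurable_closed_rV; apply: compact_closed => //; exact: norm_hausdorff.
apply: (bounded_integrable (C := C) mK).
- apply: le_lt_trans (finite_lebesgue_bounded oO bO).
  by apply: le_measure; rewrite ?inE.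
- exact: measurable_funS mf.
- by move=> x Kx; apply: fC; exact: KO.
Qed.

(** Redefining the gradient as 0 where it exceeds [M] turns an almost everywhere bound into a bound
    that holds everywhere. *)
Lemma nice_gradient (f : V -> R) (g : V -> V) (M : R) : is_weak_gradient Omega f g -> 0 <= M ->
  {ae mu, forall x, Omega x -> enorm (g x) <= M} ->
  exists G : V -> V, [/\ forall i, measurable_fun Omega (fun x => G x ord0 i),
    forall x, enorm (G x) <= M, {ae mu, forall x, Omega x -> g x = G x} &
    is_weak_gradient Omega f G].
Proof.
move=> [lf lg wg] M0 gM.
have mg i : measurable_fun Omega (fun x => g x ord0 i) by exact: L1loc_measurable (lg i).
have me : measurable_fun Omega (fun x => enorm (g x)) by exact: measurable_enorm.
pose G x := if enorm (g x) <= M then g x else 0.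
have aeG : {ae mu, forall x, Omega x -> g x = G x}.
  by move: gM; apply: filterS => x h Ox; rewrite /G h.
have mG i : measurable_fun Omega (fun x => G x ord0 i).
  pose A := Omega `&` (fun x => enorm (g x)) @^-1` `]-oo, M].
  have mA : measurable A by apply: me => //; exact: measurable_itv.
  apply: (@eq_measurable_fun _ _ _ _ _ (fun x => g x ord0 i * \1_A x)).
    move=> x /set_mem Ox; rewrite /G indicE; case: ifPn => h.
      by rewrite mem_set ?mulr1//; split => //=; rewrite in_itv.
    rewrite memNset ?mulr0 ?mxE// => -[_ /=]; rewrite in_itv /=.
    exact/negP.
  by apply: measurable_funM => //; apply: measurable_funTS; exact: measurable_indic.
have GM x : enorm (G x) <= M.
  rewrite /G; case: ifP => // _; rewrite /enorm big1 ?sqrtr0// => i _.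
  by rewrite mxE expr0n.
exists G; split => //; split => //.
- move=> i; apply: (bounded_L1loc (C := M)) => // x _.
  apply: le_trans (GM x); rewrite -sqrtr_sqr ler_wsqrtr// (bigD1 i)//= lerDl.
  by apply: sumr_ge0 => j _; exact: sqr_ge0.
- move=> i phi tphi; rewrite wg//; congr (- _).
  apply: ae_eq_Rintegral_lower; move: aeG; apply: filterS => x h Ox.
  by rewrite h.
Qed.

Lemma enorm_ge_coord (v : V) i : `|v ord0 i| <= enorm v.
Proof.
rewrite -sqrtr_sqr ler_wsqrtr// (bigD1 i)//= lerDl.
by apply: sumr_ge0 => j _; exact: sqr_ge0.
Qed.

End nice_gradient.

Section profile.
Context (R : realType) (n : nat).
Let V := 'rV[R]_n.
Let mu := @lebesgue_rV R n.
Variable Omega : set V.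
Hypotheses (oO : open Omega) (bO : bounded_set Omega).

Let mO : measurable Omega. Proof. exact: open_measurable_rV. Qed.

Variables (f : V -> R) (G : V -> V) (M : R).
Hypotheses (cf : continuous f) (f0 : forall x, 0 <= f x).
Hypothesis fO : forall x, ~ Omega x -> f x = 0.
Hypothesis fM : coord_lipschitz M f.
Hypothesis mG : forall i, measurable_fun Omega (fun x => G x ord0 i).
Hypothesis GM : forall x, enorm (G x) <= M.
Hypothesis wG : is_weak_gradient Omega f G.

Lemma profile_bounded_support : bounded_support f.
Proof.
have [L _ OL] := bounded_setP bO; exists L => x Lx; apply: fO => /OL.
by rewrite leNgt Lx.
Qed.

Lemma profile_bmb : bmb f.
Proof.
split; [exact: continuous_measurable_rV| |exact: profile_bounded_support].
exact: continuous_bounded_support cf profile_bounded_support.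
Qed.

Lemma profile_M_ge0 : 0 <= M.
Proof. by apply: le_trans (GM 0); exact: sqrtr_ge0. Qed.

Lemma profile_GM i x : `|G x ord0 i| <= M.
Proof. exact: le_trans (enorm_ge_coord _ _) (GM x). Qed.

Lemma dquot_le i k x : `|dquot f (delta_mx ord0 i) k x| <= M.
Proof.
rewrite /dquot normrM normfV mulrC ler_pdivrMr ?normr_gt0 ?gt_eqF ?hk_gt0//.
Qed.

Lemma finite_bounded_integrable (h : V -> R) (C : R) : measurable_fun Omega h ->
  (forall x, Omega x -> `|h x| <= C) -> mu.-integrable Omega (EFin \o h).
Proof. by move=> mh hC; exact: (bounded_integrable mO (finite_lebesgue_bounded oO bO) mh hC). Qed.

(** The quotients are bounded by the Lipschitz constant, so it suffices to test with smooth
    functions, where discrete integration by parts meets the definition of the weak gradient. As [f]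
    and the test function vanish outside Omega, integrals over Omega and over [R^n] agree. *)
Lemma dquot_weak_cvg i (F : V -> R) : mu.-integrable Omega (EFin \o F) ->
  \int[mu]_(x in Omega) ((dquot f (delta_mx ord0 i) k x - G x ord0 i) * F x) @[k --> \oo]
  --> (0 : R).
Proof.
move=> iF; have [mf _ _] := profile_bmb.
have mq k : measurable_fun Omega (dquot f (delta_mx ord0 i) k).
  by apply: measurable_funTS; exact: dquot_measurable.
apply: (weak_test_cvg oO bO (M := M + M)) => //.
- by move=> k; exact: measurable_funB.
- move=> k x _; rewrite (le_trans (ler_normB _ _))// lerD//.
    exact: dquot_le.
  exact: profile_GM.
move=> phi tphi; have hk := test_smooth_kernel bO tphi.
have [mphi [C hC] _] := smooth_kernel_bmb hk.
have i1 k : mu.-integrable Omega (EFin \o (fun x => phi x * dquot f (delta_mx ord0 i) k x)).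
  apply: (finite_bounded_integrable (C := C * M)).
    by apply: measurable_funM => //; exact: measurable_funTS.
  by move=> x _; rewrite normrM ler_pM//; exact: dquot_le.
have [_ lG wgi] := wG.
have i2 : mu.-integrable Omega (EFin \o (fun x => G x ord0 i * phi x)).
  exact: (L1loc_test_integrable oO bO (lG i) tphi).
have E k : \int[mu]_(x in Omega) ((dquot f (delta_mx ord0 i) k x - G x ord0 i) * phi x) =
    \int[mu]_x (phi x * dquot f (delta_mx ord0 i) k x) -
    (- \int[mu]_x (f x * partial i phi x)).
  rewrite (Rintegral_subset_support (@subsetT _ Omega) (f := fun x => phi x * _)); last first.
    by move=> x nO; rewrite (test_outside tphi) ?mul0r.
  rewrite (Rintegral_subset_support (@subsetT _ Omega) (f := fun x => f x * _)); last first.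
    by move=> x nO; rewrite fO ?mul0r.
  rewrite wgi// opprK -(RintegralB mO (i1 k) i2).
  by apply: eq_Rintegral => x _; ring.
under eq_fun do rewrite E.
have h := @Rintegral_dquot_test R n f phi (delta_mx ord0 i) profile_bmb hk.
have := cvgB h (@cvg_cst _ (- \int[mu]_x (f x * partial i phi x)) _ _ _).
by rewrite subrr; exact.
Qed.

Variable U : R.
Hypothesis fU : forall x, f x <= U.

Lemma powR_bmb t : 0 < t -> bmb (fun x => f x `^ t).
Proof.
move=> t0; have [mf _ [L hL]] := profile_bmb; split.
- exact: (measurableT_comp (measurable_powR t) mf).
- exists (U `^ t) => x; rewrite ger0_norm ?powR_ge0//; apply: ler_powRl => //.
  exact: ltW.
- by exists L => x /hL ->; rewrite powR0// gt_eqF.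
Qed.

Lemma dquot_powR_le t i k x : 1 < t ->
  `|dquot (fun x => f x `^ t) (delta_mx ord0 i) k x| <= t * U `^ (t - 1) * M.
Proof.
move=> t1; have t0 : 0 < t by apply: lt_trans t1.
have [c [c0 _ cm E]] := powR_MVT_sym t1 (f0 x) (f0 (x + hk R k *: delta_mx ord0 i)).
rewrite /dquot E mulrCA normrM ler_pM//; last exact: dquot_le.
rewrite ger0_norm; last by rewrite mulr_ge0 ?powR_ge0// ltW.
apply: ler_wpM2l; first exact: ltW.
apply: ler_powRl => //; first by rewrite subr_ge0 ltW.
by apply: le_trans cm _; rewrite ge_max !fU.
Qed.

Lemma powR_coord_lipschitz t : 1 < t -> coord_lipschitz (t * U `^ (t - 1) * M) (fun x => f x `^ t).
Proof.
move=> t1 i x h; have t0 : 0 < t by apply: lt_trans t1.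
have [c [c0 _ cm E]] := powR_MVT_sym t1 (f0 x) (f0 (x + h *: delta_mx ord0 i)).
rewrite E normrM -[leRHS]mulrA ler_pM//.
rewrite ger0_norm; last by rewrite mulr_ge0 ?powR_ge0// ltW.
apply: ler_wpM2l; first exact: ltW.
apply: ler_powRl => //; first by rewrite subr_ge0 ltW.
by apply: le_trans cm _; rewrite ge_max !fU.
Qed.

Lemma f_shift_cvg i x : f (x + hk R k *: delta_mx ord0 i) @[k --> \oo] --> f x.
Proof.
apply/cvgrPdist_le => e e0.
have : \forall k \near \oo, hk R k <= e / (M + 1).
  have /cvgr0Pnorm_le/(_ (e / (M + 1))) := @hk_cvg0 R.
  have M1 : 0 < M + 1 by rewrite ltr_wpDl// profile_M_ge0.
  rewrite divr_gt0// => /(_ isT); apply: filterS => k.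
  by rewrite ger0_norm// ltW// hk_gt0.
apply: filterS => k hke; rewrite distrC (le_trans (fM _ _ _))//.
have h0 := hk_gt0 R k; rewrite (gtr0_norm h0).
have M0 := profile_M_ge0.
rewrite (le_trans (ler_wpM2l M0 hke))// mulrA ler_pdivrMr ?ltr_wpDl//.
by rewrite mulrC ler_wpM2l ?ltW// ltrDl.
Qed.

(* [D_h (f^t) - t f^(t-1) D_h f] tends to 0 pointwise and boundedly, while [D_h f] converges
   weakly to [G]. *)
Lemma Rintegral_dquot_powR t i (F : V -> R) : 1 < t -> bmb F ->
  \int[mu]_x (F x * dquot (fun x => f x `^ t) (delta_mx ord0 i) k x) @[k --> \oo] -->
  \int[mu]_(x in Omega) (F x * (t * f x `^ (t - 1) * G x ord0 i)).
Proof.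
move=> t1 bF; have t0 : 0 < t by apply: lt_trans t1.
have t10 : 0 < t - 1 by rewrite subr_gt0.
have [mF [CF hCF] sF] := bF; have [mf _ _] := profile_bmb.
have CF0 : 0 <= CF by apply: le_trans (hCF 0).
have M0 := profile_M_ge0.
pose v : V := delta_mx ord0 i.
pose a x := t * f x `^ (t - 1).
have [mp _ _] := powR_bmb t10.
have ma : measurable_fun setT a by exact: measurable_funM.
pose b := t * U `^ (t - 1).
have b0 : 0 <= b by rewrite mulr_ge0 ?powR_ge0// ltW.
have a0 x : 0 <= a x by rewrite mulr_ge0 ?powR_ge0// ltW.
have ab x : a x <= b by apply: ler_wpM2l; [exact: ltW|apply: ler_powRl; [exact: ltW|exact: f0|exact: fU]].
have nab x : `|a x| <= b by rewrite ger0_norm.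
pose p k x := dquot (fun x => f x `^ t) v k x.
pose q k x := dquot f v k x.
have mp' k : measurable_fun setT (p k).
  by apply: dquot_measurable; have [] := powR_bmb t0.
have mq k : measurable_fun setT (q k) by exact: dquot_measurable.
have pb k x : `|p k x| <= b * M by exact: dquot_powR_le.
have qb k x : `|q k x| <= M by exact: dquot_le.
have i1 k : mu.-integrable setT (EFin \o (fun x => F x * p k x)).
  by apply/bmb_integrable/bmbM => //; exists (b * M).
have i2 k : mu.-integrable setT (EFin \o (fun x => F x * (a x * q k x))).
  apply/bmb_integrable/bmbM => //; first exact: measurable_funM.
  by exists (b * M) => x; rewrite normrM ler_pM.
have iF : mu.-integrable setT (EFin \o (fun x => b * M *+ 2 * `|F x|)).
  by apply: integrableZl_EFin => //; apply: integrable_norm; exact: bmb_integrable.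
have lim1 : \int[mu]_x (F x * p k x - F x * (a x * q k x)) @[k --> \oo] --> (0 : R).
  have [] := @Rintegral_dominated_cvg _ _ _ mu setT (fun k x => F x * p k x - F x * (a x * q k x))
    (fun=> 0) (fun x => b * M *+ 2 * `|F x|) measurableT _ _ iF.
  - move=> k; apply: measurable_funB; apply: measurable_funM => //.
    exact: measurable_funM.
  - move=> x _.
    have hc k : exists c, [/\ 0 <= c, `|c - f x| <= `|f (x + hk R k *: v) - f x| &
        p k x = t * c `^ (t - 1) * q k x].
      have [c [c0 cd _ E]] := powR_MVT_sym t1 (f0 x) (f0 (x + hk R k *: v)).
      by exists c; split => //; rewrite /p /q /dquot E mulrCA.
    have [c hcP] := choice hc.
    have cc : c k @[k --> \oo] --> f x.
      apply/cvgrPdist_lt => e e0; have /cvgrPdist_lt/(_ _ e0) := @f_shift_cvg i x.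
      apply: filterS => k; have [_ h _] := hcP k; rewrite distrC => h2.
      by rewrite distrC (le_lt_trans h).
    have cp : t * c k `^ (t - 1) - a x @[k --> \oo] --> (0 : R).
      rewrite -[0](subrr (a x)); apply: cvgB; last exact: cvg_cst.
      apply: cvgMr; apply: powR_cvg_ge0 => // k; by have [] := hcP k.
    have : `|F x| * M * `|t * c k `^ (t - 1) - a x| @[k --> \oo] --> (0 : R).
      rewrite -[0](mulr0 (`|F x| * M)); apply: cvgMr.
      by rewrite -[0](normr0 R); apply: cvg_norm.
    move=> cz; apply/cvgr0Pnorm_le => e e0.
    have /cvgr0Pnorm_le/(_ _ e0) := cz; apply: filterS => k; apply: le_trans.
    have [_ _ ->] := hcP k.
    rewrite -mulrBr -mulrBl normrM [X in _ * X]normrM [leRHS]ger0_norm; last first.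
      by rewrite !mulr_ge0.
    rewrite -[leRHS]mulrA; apply: ler_wpM2l => //; rewrite [leLHS]mulrC.
    by apply: ler_wpM2r; [exact: normr_ge0|exact: qb].
  - move=> k x _; rewrite -mulrBr normrM mulrC ler_wpM2r//.
    rewrite mulr2n (le_trans (ler_normB _ _))// lerD// normrM ler_pM//.
  by move=> _; rewrite Rintegral_cst// mul0r.
have aFb x : `|a x * F x| <= b * CF by rewrite normrM ler_pM.
have iaF : mu.-integrable Omega (EFin \o (fun x => a x * F x)).
  apply: (finite_bounded_integrable (C := b * CF)).
    by apply: measurable_funTS; exact: measurable_funM.
  by move=> x _; exact: aFb.
have lim2 := dquot_weak_cvg i iaF.
have i3 k : mu.-integrable Omega (EFin \o (fun x => q k x * (a x * F x))).
  apply: (finite_bounded_integrable (C := M * (b * CF))).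
    by apply: measurable_funTS; apply: measurable_funM => //; exact: measurable_funM.
  by move=> x _; rewrite normrM; apply: ler_pM => //; exact: qb.
have i4 : mu.-integrable Omega (EFin \o (fun x => G x ord0 i * (a x * F x))).
  apply: (finite_bounded_integrable (C := M * (b * CF))).
    by apply: measurable_funM => //; apply: measurable_funTS; exact: measurable_funM.
  by move=> x _; rewrite normrM; apply: ler_pM => //; exact: profile_GM.
have E k : \int[mu]_x (F x * p k x) = \int[mu]_x (F x * p k x - F x * (a x * q k x)) +
   (\int[mu]_(x in Omega) ((q k x - G x ord0 i) * (a x * F x)) +
    \int[mu]_(x in Omega) (F x * (a x * G x ord0 i))).
  have -> : \int[mu]_(x in Omega) (F x * (a x * G x ord0 i)) =
            \int[mu]_(x in Omega) (G x ord0 i * (a x * F x)).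
    by apply: eq_Rintegral => x _; ring.
  have -> : \int[mu]_(x in Omega) ((q k x - G x ord0 i) * (a x * F x)) =
    \int[mu]_(x in Omega) (q k x * (a x * F x)) - \int[mu]_(x in Omega) (G x ord0 i * (a x * F x)).
    rewrite -(RintegralB mO (i3 k) i4); apply: eq_Rintegral => x _; ring.
  rewrite subrK (RintegralB measurableT (i1 k) (i2 k)).
  have -> : \int[mu]_(x in Omega) (q k x * (a x * F x)) = \int[mu]_x (F x * (a x * q k x)).
    rewrite (Rintegral_subset_support (@subsetT _ Omega) (f := fun x => F x * (a x * q k x))).
      by apply: eq_Rintegral => x _; ring.
    by move=> x nO; rewrite /a fO// powR0 ?gt_eqF// mulr0 mul0r mulr0.
  by rewrite subrK.
under eq_fun do rewrite E.
have := cvgD lim1 (cvgD lim2 (@cvg_cst _ (\int[mu]_(x in Omega) (F x * (a x * G x ord0 i))) _ _ _)).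
by rewrite !add0r; exact.
Qed.

(** The integrals of a test function against the difference quotients of [f^t] have two limits, one
    by the pointwise chain rule, one by discrete integration by parts; equating them is the defining
    identity. *)
Lemma is_weak_gradient_powR t : 1 < t ->
  is_weak_gradient Omega (fun x => f x `^ t) (fun x => (t * f x `^ (t - 1)) *: G x).
Proof.
move=> t1; have t0 : 0 < t by apply: lt_trans t1.
have t10 : 0 < t - 1 by rewrite subr_gt0.
have [mt [Ct hCt] _] := powR_bmb t0; have [mt1 [C1 hC1] _] := powR_bmb t10.
split.
- by apply: (bounded_L1loc oO bO (C := Ct)) => //; exact: measurable_funTS.
- move=> i; apply: (bounded_L1loc oO bO (C := t * C1 * M)).
    rewrite (_ : (fun x => _) = (fun x => t * f x `^ (t - 1) * G x ord0 i)).
      by apply: measurable_funM => //; apply: measurable_funTS; exact: measurable_funM.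
    by apply/funext => x; rewrite mxE.
  move=> x _; rewrite mxE normrM ler_pM//; last exact: profile_GM.
  by rewrite normrM (gtr0_norm t0) ler_wpM2l// ltW.
- move=> i phi tphi; have hk := test_smooth_kernel bO tphi.
  have h1 := Rintegral_dquot_powR (i := i) t1 (smooth_kernel_bmb hk).
  have h2 := @Rintegral_dquot_test R n _ phi (delta_mx ord0 i) (powR_bmb t0) hk.
  have E := cvg_unique (@norm_hausdorff _ R) h1 h2.
  rewrite -(Rintegral_subset_support (@subsetT _ Omega) (f := fun x => f x `^ t * partial i phi x)).
    rewrite -[LHS]opprK -[X in - X]E; congr (- _).
    by apply: eq_Rintegral => x _; rewrite mxE; ring.
  by move=> x nO; rewrite fO// powR0 ?mul0r// gt_eqF.
Qed.

End profile.

(** * The dissipation and its lower bound *)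

Section pointwise.
Context (R : realType).
Implicit Types p q r t u g K L : R.

Lemma powRD_gt0 u s t : 0 < s -> 0 <= t -> u `^ (s + t) = u `^ s * u `^ t.
Proof. by move=> s0 t0; rewrite powRD// gt_eqF// ltr_wpDr. Qed.

(* [u^r g^q = u^(r-1) g^p (u g^(q-p))] and [u^(r-1) g^p = (u g^(q-p))^(r-1)]. *)
Lemma dissipation_le p q r u g : 0 < p -> p < q -> r = q / (q - p) -> 0 <= u -> 0 <= g ->
  r * u `^ (r - 1) * g `^ p <= 2^-1 * (u `^ r * g `^ q) + r * (2 * r) `^ (r - 1).
Proof.
move=> p0 pq rE u0 g0; have d0 : 0 < q - p by rewrite subr_gt0.
have r1E : r - 1 = p / (q - p) by rewrite rE; field; rewrite gt_eqF.
have r10 : 0 < r - 1 by rewrite r1E divr_gt0.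
have r0 : 0 < r by rewrite -(subrK 1 r) ltr_wpDr.
set w := u * g `^ (q - p).
have w0 : 0 <= w by rewrite mulr_ge0// powR_ge0.
have -> : u `^ r * g `^ q = u `^ (r - 1) * g `^ p * w.
  have := powRD_gt0 u r10 (@ler01 R); rewrite subrK powRr1// => ->.
  have := powRD_gt0 g d0 (ltW p0); rewrite subrK => ->.
  by rewrite /w; ring.
have E : u `^ (r - 1) * g `^ p = w `^ (r - 1).
  rewrite /w powRM ?powR_ge0// -powRrM r1E; congr (_ * _ `^ _).
  by field; rewrite gt_eqF.
rewrite -mulrA E; have h0 := powR_ge0 w (r - 1).
have c0 := powR_ge0 (2 * r) (r - 1).
(* For [w >= 2r] the left side [r w^(r-1)] is at most half of [w^r]; for [w < 2r] it is at most the
   additive constant. *)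
have [h|h] := leP (2 * r) w.
  rewrite ler_wpDr ?mulr_ge0 ?(ltW r0)//.
  rewrite mulrC [leRHS]mulrCA; apply: ler_wpM2l => //.
  by rewrite ler_pdivlMl// mulrC.
rewrite ler_wpDl ?mulr_ge0 ?invr_ge0 ?powR_ge0//.
apply: ler_wpM2l; first exact: ltW.
by apply: ler_powRl; [exact: ltW|exact: w0|exact: ltW].
Qed.

(** Young's inequality by cases, with [B = t L]: if [2 B g <= u] the left side is at most half of
    [u^t]; otherwise [u^(q-1)] is at most [(2 B g)^(q-1)], which yields the second term. *)
Lemma poincare_le q r t L u g : t = r + q -> 0 < r -> 1 < q -> 0 < L -> 0 <= u -> 0 <= g ->
  t * L * (u `^ (t - 1) * g) <=
  2^-1 * u `^ t + t * L * (2 * (t * L)) `^ (q - 1) * (u `^ r * g `^ q).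
Proof.
move=> tE r0 q1 L0 u0 g0; have q10 : 0 < q - 1 by rewrite subr_gt0.
have t0 : 0 < t by rewrite tE addr_gt0// (lt_trans ltr01).
have t1 : 0 < t - 1 by rewrite tE -addrA addr_gt0.
have tL : 0 < t * L by rewrite mulr_gt0.
set B := t * L.
have B0 : 0 < B by [].
have p1 := powR_ge0 u t; have p2 := powR_ge0 u r; have p3 := powR_ge0 g q.
have p4 := powR_ge0 (2 * B) (q - 1); have p5 := powR_ge0 u (t - 1).
have [h|h] := leP (2 * B * g) u.
  apply: ler_wpDr; first by apply: mulr_ge0; [apply: mulr_ge0; [exact: ltW|]|exact: mulr_ge0].
  have -> : u `^ t = u `^ (t - 1) * u by rewrite -{1}(subrK 1 t) powRD_gt0// powRr1.
  rewrite mulrCA [leRHS]mulrCA; apply: ler_wpM2l => //.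
  by rewrite ler_pdivlMl// mulrA.
apply: ler_wpDl; first by rewrite mulr_ge0 ?invr_ge0.
rewrite -[leRHS]mulrA; apply: ler_wpM2l; first exact: ltW.
have -> : u `^ (t - 1) = u `^ r * u `^ (q - 1) by rewrite tE -addrA; apply: powRD_gt0 => //; exact: ltW.
rewrite -[leLHS]mulrA [leRHS]mulrCA; apply: ler_wpM2l => //.
have -> : g `^ q = g `^ (q - 1) * g by rewrite -{1}(subrK 1 q) powRD_gt0// powRr1.
rewrite mulrA; apply: ler_wpM2r => //.
rewrite -powRM//; last by rewrite mulr_ge0// ltW.
by apply: ler_powRl; [exact: ltW|exact: u0|exact: ltW].
Qed.

(** Stands in for Hölder's inequality between the exponents [r + 1] and [r + q]: for [u < K] the
    left side is nonpositive, for [u >= K] one has [u^(q-1) >= K^(q-1)]. The level [K] remains free,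
    to be chosen from the energy. *)
Lemma powR_tail_le q r u K : 0 < r -> 1 < q -> 0 <= u -> 0 < K ->
  K `^ (q - 1) * (u `^ (r + 1) - K `^ (r + 1)) <= u `^ (r + q).
Proof.
move=> r0 q1 u0 K0; have q10 : 0 < q - 1 by rewrite subr_gt0.
have r10 : 0 < r + 1 by rewrite addr_gt0.
have [h|h] := leP K u.
  have -> : u `^ (r + q) = u `^ (q - 1) * u `^ (r + 1).
    by rewrite -powRD_gt0// ?(ltW r10)//; congr (_ `^ _); ring.
  apply: ler_pM; rewrite ?powR_ge0//.
  - by rewrite subr_ge0; apply: ler_powRl; [exact: ltW|exact: ltW|].
  - by apply: ler_powRl; [exact: ltW|exact: ltW|].
  - by rewrite gerBl powR_ge0.
apply: le_trans (powR_ge0 _ _); rewrite mulr_ge0_le0 ?powR_ge0// subr_le0.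
by apply: ler_powRl; [exact: ltW|exact: u0|exact: ltW].
Qed.

End pointwise.

(** * The integrand of the weak formulation *)

Section flux.
Context (R : realType) (n : nat).
Let V := 'rV[R]_n.
Local Notation mu := (@lebesgue_rV R n).
Variable Omega : set V.
Hypotheses (oO : open Omega) (bO : bounded_set Omega).
Variables (p q : R).
Hypotheses (p2 : 2 < p) (q0 : 0 < q).

Let mO : measurable Omega. Proof. exact: open_measurable_rV. Qed.
Let p20 : 0 < p - 2. Proof. by rewrite subr_gt0. Qed.

(** The integrand [weak_rhs] for a smooth [phi], with an explicit vector [v] in place of the chosen
    gradient of the solution and classical partial derivatives in place of the chosen gradient of
    [phi]. *)
Definition flux (phi : V -> R) (v : V) (x : V) : R :=
  - (enorm v `^ (p - 2) * edot v (\row_i partial i phi x)) + enorm v `^ q * phi x.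

Lemma Rintegral_weak_rhs_flux (f : V -> R) (g : V -> V) phi : test_function Omega phi ->
  is_weak_gradient Omega f g ->
  \int[mu]_(x in Omega) weak_rhs Omega p q f phi x = \int[mu]_(x in Omega) flux phi (g x) x.
Proof.
move=> tphi wg; have [cphi _] := tphi.
have [_ e1] := weak_gradientP oO bO wg.
have [_ e2] := weak_gradientP oO bO (is_weak_gradient_smooth bO cphi).
apply: ae_eq_Rintegral_lower; move: e1 e2; apply: filterS2 => x h1 h2 Ox.
by rewrite /weak_rhs h1// h2.
Qed.

Lemma flux_le phi C D B v x : (forall i, `|partial i phi x| <= C) -> `|phi x| <= D ->
  enorm v <= B -> `|flux phi v x| <= B `^ (p - 2) * (B * C *+ n) + B `^ q * D.
Proof.
move=> hC hD vB; have e0 : 0 <= enorm v by exact: sqrtr_ge0.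
have pw t : 0 < t -> `|enorm v `^ t| <= B `^ t.
  move=> t0; rewrite ger0_norm ?powR_ge0//.
  by apply: ler_powRl; [exact: ltW|exact: e0|exact: vB].
have ed : `|edot v (\row_i partial i phi x)| <= B * C *+ n.
  apply: le_trans (ler_norm_sum _ _ _) _.
  apply: (@le_trans _ _ (\sum_(i < n) (B * C))); last by rewrite sumr_const card_ord.
  apply: ler_sum => i _; rewrite mxE normrM; apply: ler_pM => //.
  exact: le_trans (enorm_ge_coord v i) vB.
apply: le_trans (ler_normD _ _) _; rewrite normrN !normrM; apply: lerD.
  by apply: ler_pM => //; exact: pw.
by apply: ler_pM => //; exact: pw.
Qed.

Lemma measurable_flux phi (g : V -> V) : test_function Omega phi ->
  (forall i, measurable_fun Omega (fun x => g x ord0 i)) ->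
  measurable_fun Omega (fun x => flux phi (g x) x).
Proof.
move=> tphi mg; have me : measurable_fun Omega (fun x => enorm (g x)) by exact: measurable_enorm.
have me_pow t : measurable_fun Omega (fun x => enorm (g x) `^ t).
  exact: (measurableT_comp (measurable_powR t) me).
have mphi psi : test_function Omega psi -> measurable_fun Omega psi.
  move=> tpsi; apply: measurable_funTS.
  by have [] := smooth_kernel_bmb (test_smooth_kernel bO tpsi).
apply: measurable_funD; last by apply: measurable_funM => //; exact: mphi.
apply: measurable_funN; apply: measurable_funM => //.
rewrite /edot; apply: measurable_sum => i.
rewrite (_ : (fun x => _) = (fun x => g x ord0 i * partial i phi x)).
  by apply: measurable_funM => //; apply: mphi; exact: test_derive.
by apply/funext => x; rewrite mxE.
Qed.

End flux.

Lemma half_sub_le (R : realType) (a b c : R) : b <= 2^-1 * a + c -> 2^-1 * a - c <= a - b.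
Proof. lra. Qed.

Section dissipation.
Context (R : realType) (n : nat).
Let V := 'rV[R]_n.
Let mu := @lebesgue_rV R n.
Variable Omega : set V.
Hypotheses (oO : open Omega) (bO : bounded_set Omega).

Let mO : measurable Omega. Proof. exact: open_measurable_rV. Qed.

Variables (f : V -> R) (G : V -> V) (M U : R).
Hypotheses (cf : continuous f) (f0 : forall x, 0 <= f x).
Hypothesis fO : forall x, ~ Omega x -> f x = 0.
Hypothesis fM : coord_lipschitz M f.
Hypothesis mG : forall i, measurable_fun Omega (fun x => G x ord0 i).
Hypothesis GM : forall x, enorm (G x) <= M.
Hypothesis wG : is_weak_gradient Omega f G.
Hypothesis fU : forall x, f x <= U.

Let bpow t : 0 < t -> bmb (fun x => f x `^ t).
Proof. by move=> t0; exact: (powR_bmb bO cf f0 fO fU). Qed.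

Lemma measurable_coord (i : 'I_n) : measurable_fun setT (fun x : V => x ord0 i).
Proof. exact: measurable_rV_coord. Qed.

Lemma bmb_coordM (g : V -> R) i : bmb g -> bmb (fun x => x ord0 i * g x).
Proof.
move=> [mg [C hC] [L hL]]; have C0 : 0 <= C by apply: le_trans (hC 0).
split; first by apply: measurable_funM => //; exact: measurable_coord.
- exists (`|L| * C) => x; have [h|h] := ltP L `|x|.
    by rewrite hL// mulr0 normr0 mulr_ge0.
  rewrite normrM ler_pM//; apply: le_trans (coord_le_norm _ _) _.
  exact: le_trans h (ler_norm _).
- by exists L => x /hL ->; rewrite mulr0.
Qed.

(** Discrete form of integrating [D_i (x_i f^t)]: [x_i] times the quotient of [P = f^t] is the
    quotient of [x_i P], whose integral vanishes, minus a translate of [P]. [Rintegral_dquot_powR]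
    identifies the limit. *)
Lemma poincare_identity t i : 1 < t ->
  \int[mu]_(x in Omega) (f x `^ t) =
  - \int[mu]_(x in Omega) (x ord0 i * (t * f x `^ (t - 1) * G x ord0 i)).
Proof.
move=> t1; have t0 : 0 < t by apply: lt_trans t1.
have [L L0 OL] := bounded_setP bO.
have L1 : 0 < L + 1 by rewrite ltr_wpDl.
(* The weight must have bounded support. The steps are at most 1, so the ball of radius [L + 1]
   contains the supports of all the quotients and the cutoff changes no integral. *)
pose B := [set x : V | `|x| <= L + 1].
have mB : measurable B.
  apply: measurable_closed_rV; apply: compact_closed; first exact: norm_hausdorff.
  exact: closed_ball0_compact.
pose F (x : V) : R := x ord0 i * \1_B x.
have bF : bmb F.
  apply: bmb_coordM; split; first exact: measurable_indic.
  - by exists 1 => x; rewrite indicE; case: (_ \in _); rewrite ?normr1 ?normr0.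
  - exists (L + 1) => x Lx; rewrite indicE memNset//= /B /=.
    by apply/negP; rewrite -ltNge.
pose v : V := delta_mx ord0 i.
have v1 : `|v| <= 1.
  apply/rV_norm_le => // j; rewrite mxE eqxx /=.
  by case: (_ == _); rewrite ?normr1 ?normr0.
pose P x := f x `^ t; have bP : bmb P by exact: bpow.
have PL x : L < `|x| -> P x = 0.
  by move=> Lx; rewrite /P fO ?powR0 ?gt_eqF// => /OL; rewrite leNgt Lx.
pose K (x : V) : R := x ord0 i * P x; have bK : bmb K by exact: bmb_coordM.
have E k x : F x * dquot P v k x =
    (hk R k)^-1 * (K (x + hk R k *: v) - K x) - P (x + hk R k *: v).
  have h0 := hk_gt0 R k; have h1 := hk_le1 R k.
  have -> : K (x + hk R k *: v) = (x ord0 i + hk R k) * P (x + hk R k *: v).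
    by rewrite /K !mxE !eqxx mulr1.
  have -> : (hk R k)^-1 * ((x ord0 i + hk R k) * P (x + hk R k *: v) - K x) -
      P (x + hk R k *: v) = x ord0 i * dquot P v k x.
    by rewrite /K /dquot; field; rewrite gt_eqF.
  rewrite /F indicE; have [Bx|nB] := pselect (B x); first by rewrite mem_set// mulr1.
  rewrite memNset// mulr0 mul0r; move/negP: nB; rewrite -ltNge => nB.
  rewrite /dquot !PL ?subrr ?mulr0//; first by apply: lt_trans nB; rewrite ltrDl.
  rewrite -[x in _ < `|x|]opprK; have := ler_normB (x + hk R k *: v) (hk R k *: v).
  rewrite addrK opprK normrZ gtr0_norm// => H.
  by have := ler_pM (ltW h0) (normr_ge0 v) h1 v1; move: H nB; lra.
have I k : \int[mu]_x (F x * dquot P v k x) = - \int[mu]_x P x.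
  have mK : measurable_fun setT K by case: bK.
  have mP : measurable_fun setT P by case: bP.
  under eq_Rintegral do rewrite E.
  have i1 := bmb_integrable (bmb_shift (hk R k *: v) bK).
  have i2 := bmb_integrable bK; have i3 := bmb_integrable (bmb_shift (hk R k *: v) bP).
  have i12 := integrableB_EFin measurableT i1 i2.
  rewrite (RintegralB measurableT (integrableZl_EFin (hk R k)^-1 measurableT i12) i3).
  rewrite (RintegralZl _ measurableT i12) (RintegralB measurableT i1 i2).
  by rewrite (Rintegral_rV_shift _ mK) (Rintegral_rV_shift _ mP) subrr mulr0 sub0r.
have := Rintegral_dquot_powR oO bO cf f0 fO fM mG GM wG fU (i := i) t1 bF.
rewrite -/P -/v; under eq_fun do rewrite I.
move=> h; have := cvg_unique (@norm_hausdorff _ R) h (@cvg_cst _ (- \int[mu]_x P x) _ _ _).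
move=> h2; rewrite (_ : \int[mu]_(x in Omega) _ = \int[mu]_x P x); last first.
  rewrite (Rintegral_subset_support (@subsetT _ Omega) (f := P))// => x nO.
  by rewrite /P fO// powR0// gt_eqF.
rewrite -[LHS]opprK -h2; congr (- _); apply: eq_Rintegral => x /set_mem Ox.
by rewrite /F indicE mem_set ?mulr1// /B /= (le_trans (OL _ Ox))// lerDl.
Qed.

(** The right-hand side of the weak formulation with [f^r] as test function, its gradient being
    written out by the chain rule. For a solution it is [1/(r+1)] times the formal time derivative
    of the energy. *)
Definition dissipation p q r : R := \int[mu]_(x in Omega)
  (- (enorm (G x) `^ (p - 2) * edot (G x) ((r * f x `^ (r - 1)) *: G x)) +
   enorm (G x) `^ q * f x `^ r).

Let me : measurable_fun Omega (fun x => enorm (G x)).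
Proof. exact: measurable_enorm. Qed.

Let me_pow t : measurable_fun Omega (fun x => enorm (G x) `^ t).
Proof. exact: (measurableT_comp (measurable_powR t) me). Qed.

Let mf_pow t : measurable_fun Omega (fun x => f x `^ t).
Proof.
by apply: (measurableT_comp (measurable_powR t)); apply: measurable_funTS; exact: continuous_measurable_rV.
Qed.

Let e_le t x : 0 < t -> `|enorm (G x) `^ t| <= M `^ t.
Proof.
move=> t0; rewrite ger0_norm ?powR_ge0//.
by apply: ler_powRl; [exact: ltW|exact: sqrtr_ge0|exact: GM].
Qed.

Let f_le t x : 0 < t -> `|f x `^ t| <= U `^ t.
Proof.
move=> t0; rewrite ger0_norm ?powR_ge0//.
by apply: ler_powRl; [exact: ltW|exact: f0|exact: fU].
Qed.

Let ife s t : 0 < s -> 0 < t -> mu.-integrable Omega (EFin \o (fun x => f x `^ s * enorm (G x) `^ t)).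
Proof.
move=> s0 t0; apply: (finite_bounded_integrable oO bO (C := U `^ s * M `^ t)).
  exact: measurable_funM.
by move=> x _; rewrite normrM; apply: ler_pM => //; [exact: f_le|exact: e_le].
Qed.

Let if_ s : 0 < s -> mu.-integrable Omega (EFin \o (fun x => f x `^ s)).
Proof.
move=> s0; apply: (finite_bounded_integrable oO bO (C := U `^ s)) => // x _.
exact: f_le.
Qed.

Lemma edotZ_enorm p (c : R) (v : V) : 2 < p ->
  enorm v `^ (p - 2) * edot v (c *: v) = c * enorm v `^ p.
Proof.
move=> p2; have -> : edot v (c *: v) = c * enorm v `^ 2.
  rewrite /enorm powR_mulrn ?sqrtr_ge0// sqr_sqrtr; last first.
    by apply: sumr_ge0 => i _; exact: sqr_ge0.
  by rewrite /edot mulr_sumr; apply: eq_bigr => i _; rewrite mxE; ring.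
rewrite mulrCA; congr (_ * _).
by have := @powRD_gt0 R (enorm v) (p - 2) 2; rewrite subrK => ->//; rewrite subr_gt0.
Qed.

(** [poincare_identity] and the pointwise inequality [poincare_le] bound the left integral by half
    of itself plus a multiple of the right one; the half is absorbed. *)
Lemma poincare_bound q r L B : B = (r + q) * L -> 1 < q -> 0 < r -> 0 < L -> (0 < n)%N ->
  (forall x, Omega x -> `|x| <= L) ->
  \int[mu]_(x in Omega) (f x `^ (r + q)) <=
  2 * (B * (2 * B) `^ (q - 1)) * \int[mu]_(x in Omega) (f x `^ r * enorm (G x) `^ q).
Proof.
move=> BE q1 r0 L0 n0 OL; pose i : 'I_n := Ordinal n0.
have q0 : 0 < q by apply: lt_trans q1.
have t1 : 1 < r + q by lra.
have t0 : 0 < r + q by rewrite addr_gt0.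
have q10 : 0 < q - 1 by rewrite subr_gt0.
have t10 : 0 < r + q - 1 by rewrite subr_gt0.
have it := if_ t0; have ire := ife r0 q0.
set J := \int[mu]_(x in Omega) (f x `^ r * _).
set I := \int[mu]_(x in Omega) (f x `^ (r + q)).
suff : I <= 2^-1 * I + B * (2 * B) `^ (q - 1) * J by lra.
rewrite {1}/I (poincare_identity i t1) -[leLHS]mulN1r.
have i1 : mu.-integrable Omega (EFin \o (fun x : V => x ord0 i * ((r + q) * f x `^ (r + q - 1) * G x ord0 i))).
  apply: (finite_bounded_integrable oO bO (C := L * ((r + q) * U `^ (r + q - 1) * M))).
    apply: measurable_funM; first by apply: measurable_funTS; exact: measurable_coord.
    by apply: measurable_funM => //; apply: measurable_funM.
  move=> x Ox; rewrite normrM; apply: ler_pM => //.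
    by apply: le_trans (coord_le_norm _ _) _; exact: OL.
  rewrite normrM; apply: ler_pM => //; last exact: profile_GM.
  rewrite normrM (gtr0_norm t0); apply: ler_wpM2l; [exact: ltW|exact: f_le].
rewrite -(RintegralZl _ mO i1) -(RintegralZl _ mO it) -(RintegralZl _ mO ire).
rewrite -(RintegralD mO (integrableZl_EFin _ mO it) (integrableZl_EFin _ mO ire)).
apply: le_Rintegral => //.
- exact: integrableZl_EFin.
- by apply: integrableD_EFin => //; exact: integrableZl_EFin.
move=> x Ox /=; have e0 : 0 <= enorm (G x) by exact: sqrtr_ge0.
have := poincare_le (erefl (r + q)) r0 q1 L0 (f0 x) e0; rewrite -BE; apply: le_trans.
rewrite mulN1r; apply: le_trans (ler_norm _) _.
rewrite normrN !normrM (gtr0_norm t0) (ger0_norm (powR_ge0 _ _)).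
have hx : `|x ord0 i| <= L by apply: le_trans (coord_le_norm _ _) _; exact: OL.
have hg := enorm_ge_coord (G x) i.
rewrite BE [leRHS](_ : _ = L * ((r + q) * f x `^ (r + q - 1) * enorm (G x))); last by ring.
by rewrite ler_pM// ?mulr_ge0 ?powR_ge0 ?(ltW t0)// ler_wpM2l// mulr_ge0 ?powR_ge0// ltW.
Qed.

(** With [J] the integral of [f^r |G|^q] and [I] that of [f^(r+q)], three bounds are chained: the
    dissipation is at least [J / 2] minus a constant times the volume, [I] is at most
    [2 B (2B)^(q-1) J], and [I] is bounded below by [powR_tail_le]. The factor 4 is the product of
    the two factors 2. *)
Lemma dissipation_bound p q r L B K : B = (r + q) * L -> 2 < p -> p < q -> r = q / (q - p) ->
  0 < L -> (0 < n)%N -> (forall x, Omega x -> `|x| <= L) -> 0 < K ->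
  (4 * (B * (2 * B) `^ (q - 1)))^-1 *
    (K `^ (q - 1) * (\int[mu]_(x in Omega) (f x `^ (r + 1)) - K `^ (r + 1) * fine (mu Omega))) -
    r * (2 * r) `^ (r - 1) * fine (mu Omega) <= dissipation p q r.
Proof.
move=> BE p2 pq rE L0 n0 OL K0.
have p0 : 0 < p by apply: lt_trans p2.
have q1 : 1 < q by lra.
have q0 : 0 < q by lra.
have d0 : 0 < q - p by lra.
have r0 : 0 < r by rewrite rE divr_gt0.
have r1 : 0 < r - 1.
  have -> : r - 1 = p / (q - p) by rewrite rE; field; rewrite gt_eqF.
  by rewrite divr_gt0.
have r10 : 0 < r + 1 by rewrite addr_gt0.
have t0 : 0 < r + q by rewrite addr_gt0.
have B0 : 0 < B by rewrite BE mulr_gt0.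
have C0 : 0 < B * (2 * B) `^ (q - 1) by rewrite mulr_gt0 ?powR_gt0 ?mulr_gt0.
have hp := poincare_bound BE q1 r0 L0 n0 OL.
have ire := ife r0 q0; have it := if_ t0; have ir1 := if_ r10; have ir1e := ife r1 p0.
set J := \int[mu]_(x in Omega) (f x `^ r * _) in hp.
set I := \int[mu]_(x in Omega) (f x `^ (r + q)) in hp.
set E := \int[mu]_(x in Omega) (f x `^ (r + 1)).
set m := fine (mu Omega).
have icst c : mu.-integrable Omega (EFin \o (fun=> c : R)).
  by apply: (finite_bounded_integrable oO bO (C := `|c|)).
have hI : K `^ (q - 1) * (E - K `^ (r + 1) * m) <= I.
  rewrite /E -(Rintegral_cst mu mO) -(RintegralB mO ir1 (icst _)).
  rewrite -(RintegralZl _ mO (integrableB_EFin mO ir1 (icst _))).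
  apply: le_Rintegral => //.
    by apply: integrableZl_EFin => //; exact: integrableB_EFin.
  by move=> x Ox /=; exact: powR_tail_le.
have hD : 2^-1 * J - r * (2 * r) `^ (r - 1) * m <= dissipation p q r.
  rewrite /dissipation -(Rintegral_cst mu mO) -(RintegralZl _ mO ire).
  rewrite -(RintegralB mO (integrableZl_EFin _ mO ire) (icst _)).
  have hE x : - (enorm (G x) `^ (p - 2) * edot (G x) ((r * f x `^ (r - 1)) *: G x)) +
     enorm (G x) `^ q * f x `^ r =
     f x `^ r * enorm (G x) `^ q - r * (f x `^ (r - 1) * enorm (G x) `^ p).
    by rewrite edotZ_enorm//; ring.
  under [in leRHS]eq_Rintegral do rewrite hE.
  apply: le_Rintegral => //.
  - by apply: integrableB_EFin => //; exact: integrableZl_EFin.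
  - by apply: integrableB_EFin => //; exact: integrableZl_EFin.
  - move=> x Ox /=; have := dissipation_le p0 pq rE (f0 x) (sqrtr_ge0 (\sum_i G x ord0 i ^+ 2)).
    rewrite -/(enorm (G x)) -mulrA.
    exact: half_sub_le.
apply: le_trans hD; rewrite lerD2r.
have h2 : (4 * (B * (2 * B) `^ (q - 1)))^-1 * I <= 2^-1 * J.
  rewrite ler_pdivrMl; last by rewrite mulr_gt0.
  apply: le_trans hp _; rewrite le_eqVlt; apply/orP; left; apply/eqP.
  by field.
apply: le_trans h2; apply: ler_wpM2l => //.
by rewrite invr_ge0; apply: mulr_ge0 => //; exact: ltW.
Qed.

Let mphi phi : test_function Omega phi -> measurable_fun Omega phi.
Proof. by move=> tphi; apply: measurable_funTS; have [] := smooth_kernel_bmb (test_smooth_kernel bO tphi). Qed.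

Let mpphi i phi : test_function Omega phi -> measurable_fun Omega (partial i phi).
Proof. by move=> tphi; apply: mphi; exact: test_derive. Qed.

(** The bound depends on [f] only through [M], so it dominates the right-hand side uniformly in
    time. *)
Lemma Rintegral_weak_rhs_le p q phi C D : 2 < p -> 0 < q -> test_function Omega phi ->
  (forall i x, `|partial i phi x| <= C) -> (forall x, `|phi x| <= D) ->
  `|\int[mu]_(x in Omega) weak_rhs Omega p q f phi x| <=
  (M `^ (p - 2) * (M * C *+ n) + M `^ q * D) * fine (mu Omega).
Proof.
move=> p2 q0 tphi hC hD; rewrite (Rintegral_weak_rhs_flux oO bO p q tphi wG).
set K := _ + _ * D.
have hK x : `|flux p q phi (G x) x| <= K.
  by apply: (flux_le p2 q0) => //; exact: GM.
rewrite -(Rintegral_cst mu mO); apply: Rintegral_le_bound => //.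
  apply: (finite_bounded_integrable oO bO (C := K)); first exact: measurable_flux.
  by move=> x _; exact: hK.
by apply: (finite_bounded_integrable oO bO (C := `|K|)).
Qed.

(** * Passing to the test function [f^r] in the right-hand side *)

Section approximation.
Variables (r C B : R) (phi : nat -> V -> R).
Hypotheses (r1 : 1 < r) (tphi : forall m, test_function Omega (phi m)).
Hypothesis phif : forall e : R, 0 < e -> \forall m \near \oo,
  forall x, `|phi m x - f x `^ r| <= e.
Hypothesis phiB : forall m x, `|phi m x| <= B.
Hypothesis phiC : forall m i x, `|partial i (phi m) x| <= C.

Let r0 : 0 < r. Proof. exact: lt_trans r1. Qed.
Let r10 : 0 < r - 1. Proof. by rewrite subr_gt0. Qed.

Lemma approximation_cvg (h : V -> R) (D : R) : measurable_fun Omega h ->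
  (forall x, Omega x -> `|h x| <= D) ->
  \int[mu]_(x in Omega) (h x * phi m x) @[m --> \oo] --> \int[mu]_(x in Omega) (h x * f x `^ r).
Proof.
move=> mh hD; have ic : mu.-integrable Omega (EFin \o (fun=> `|D| * B)).
  by apply: (finite_bounded_integrable oO bO (C := Num.norm (Num.norm D * B))).
apply: (Rintegral_dominated_cvg mO (f_ := fun m x => h x * phi m x) _ _ ic _).2.
- by move=> m; apply: measurable_funM => //; exact: mphi.
- move=> x _; apply: cvgMr; apply/cvgrPdist_le => e e0.
  by have := phif e0; apply: filterS => m h1; rewrite distrC.
- move=> m x Ox; rewrite normrM; apply: ler_pM => //.
  by apply: le_trans (hD _ Ox) (ler_norm _).
Qed.

(** The gradients are uniformly bounded, so testing with smooth [psi] is enough. There both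
    gradients are moved onto [psi], and only the uniform convergence of [phi m] to [f^r] is
    needed. *)
Lemma approximation_gradient_cvg i (F : V -> R) : mu.-integrable Omega (EFin \o F) ->
  \int[mu]_(x in Omega) ((partial i (phi m) x - r * f x `^ (r - 1) * G x ord0 i) * F x)
   @[m --> \oo] --> (0 : R).
Proof.
have mh : measurable_fun Omega (fun x => r * f x `^ (r - 1) * G x ord0 i).
  by apply: measurable_funM => //; exact: measurable_funM.
have hh x : `|r * f x `^ (r - 1) * G x ord0 i| <= r * U `^ (r - 1) * M.
  rewrite normrM; apply: ler_pM => //; last exact: profile_GM.
  by rewrite normrM (gtr0_norm r0); apply: ler_wpM2l; [exact: ltW|exact: f_le].
apply: (weak_test_cvg oO bO (M := C + r * U `^ (r - 1) * M)).
- by move=> m; apply: measurable_funB => //; exact: mpphi.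
- by move=> m x _; apply: le_trans (ler_normB _ _) _; exact: lerD.
move=> psi tpsi; have mpsi := mphi tpsi.
have [_ [D hD] _] := smooth_kernel_bmb (test_smooth_kernel bO tpsi).
have [cpsi _] := tpsi.
have [_ [D' hD'] _] := smooth_kernel_bmb (test_smooth_kernel bO (test_derive (delta_mx ord0 i) tpsi)).
have i1 m : mu.-integrable Omega (EFin \o (fun x => partial i (phi m) x * psi x)).
  apply: (finite_bounded_integrable oO bO (C := C * D)).
    by apply: measurable_funM => //; exact: mpphi.
  by move=> x _; rewrite normrM; apply: ler_pM.
have i2 : mu.-integrable Omega (EFin \o (fun x => r * f x `^ (r - 1) * G x ord0 i * psi x)).
  apply: (finite_bounded_integrable oO bO (C := r * U `^ (r - 1) * M * D)).
    exact: measurable_funM.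
  by move=> x _; rewrite normrM; apply: ler_pM.
have E m : \int[mu]_(x in Omega) ((partial i (phi m) x - r * f x `^ (r - 1) * G x ord0 i) * psi x) =
    \int[mu]_(x in Omega) (partial i psi x * f x `^ r) -
    \int[mu]_(x in Omega) (partial i psi x * phi m x).
  have -> : \int[mu]_(x in Omega) ((partial i (phi m) x - r * f x `^ (r - 1) * G x ord0 i) * psi x) =
     \int[mu]_(x in Omega) (partial i (phi m) x * psi x - r * f x `^ (r - 1) * G x ord0 i * psi x).
    by apply: eq_Rintegral => x _; ring.
  rewrite (RintegralB mO (i1 m) i2) addrC; have [cphi _] := tphi m.
  have [_ _ hw] := is_weak_gradient_powR oO bO cf f0 fO fM mG GM wG fU r1.
  congr (_ + _).
    rewrite (_ : \int[mu]_(x in Omega) (partial i psi x * _) =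
      \int[mu]_(x in Omega) (f x `^ r * partial i psi x)).
      by rewrite hw//; congr (- _); apply: eq_Rintegral => x _; rewrite mxE.
    by apply: eq_Rintegral => x _; rewrite mulrC.
  rewrite -[LHS]opprK -(integration_by_parts bO (delta_mx ord0 i) cphi tpsi); congr (- _).
  by apply: eq_Rintegral => x _; rewrite mulrC.
under eq_fun do rewrite E.
rewrite -[0](subrr (\int[mu]_(x in Omega) (partial i psi x * f x `^ r))).
apply: cvgB; first exact: cvg_cst.
by apply: (approximation_cvg (D := D')); [exact: mpphi|move=> x _; exact: hD'].
Qed.

(** The gradient of [phi m] appears linearly, paired with the fixed bounded fields [F i], so its
    weak convergence suffices; the term without gradient converges by [approximation_cvg]. *)
Lemma Rintegral_weak_rhs_cvg p q : 2 < p -> 0 < q ->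
  \int[mu]_(x in Omega) weak_rhs Omega p q f (phi m) x @[m --> \oo] --> dissipation p q r.
Proof.
move=> p2 q0; have p20 : 0 < p - 2 by rewrite subr_gt0.
pose F i x := enorm (G x) `^ (p - 2) * G x ord0 i.
have mF i : measurable_fun Omega (F i) by exact: measurable_funM.
have hF i x : `|F i x| <= M `^ (p - 2) * M.
  by rewrite normrM; apply: ler_pM => //; [exact: e_le|exact: profile_GM].
have iF i : mu.-integrable Omega (EFin \o F i).
  exact: (finite_bounded_integrable oO bO (mF i) (fun x _ => hF i x)).
pose d i x := r * f x `^ (r - 1) * G x ord0 i.
have md i : measurable_fun Omega (d i).
  by apply: measurable_funM => //; exact: measurable_funM.
have hd i x : `|d i x| <= r * U `^ (r - 1) * M.
  rewrite normrM; apply: ler_pM => //; last exact: profile_GM.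
  by rewrite normrM (gtr0_norm r0); apply: ler_wpM2l; [exact: ltW|exact: f_le].
have i1 m i : mu.-integrable Omega (EFin \o (fun x => (partial i (phi m) x - d i x) * F i x)).
  apply: (finite_bounded_integrable oO bO (C := (C + r * U `^ (r - 1) * M) * (M `^ (p - 2) * M))).
    by apply: measurable_funM => //; apply: measurable_funB => //; exact: mpphi.
  by move=> x _; rewrite normrM; apply: ler_pM => //; apply: le_trans (ler_normB _ _) _; exact: lerD.
have i2 m : mu.-integrable Omega (EFin \o (fun x => enorm (G x) `^ q * phi m x)).
  apply: (finite_bounded_integrable oO bO (C := M `^ q * B)).
    by apply: measurable_funM => //; exact: mphi.
  by move=> x _; rewrite normrM; apply: ler_pM => //; exact: e_le.
have i3 : mu.-integrable Omega (EFin \o (fun x => enorm (G x) `^ q * f x `^ r)).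
  apply: (finite_bounded_integrable oO bO (C := M `^ q * U `^ r)); first exact: measurable_funM.
  by move=> x _; rewrite normrM; apply: ler_pM => //; [exact: e_le|exact: f_le].
have i4 i : mu.-integrable Omega (EFin \o (fun x => d i x * F i x)).
  apply: (finite_bounded_integrable oO bO (C := r * U `^ (r - 1) * M * (M `^ (p - 2) * M))).
    exact: measurable_funM.
  by move=> x _; rewrite normrM; apply: ler_pM.
have i5 : mu.-integrable Omega (EFin \o (fun x => \sum_(i < n) (d i x * F i x))).
  exact: integrable_sum_EFin.
have i6 m : mu.-integrable Omega (EFin \o (fun x => \sum_(i < n) ((partial i (phi m) x - d i x) * F i x))).
  exact: integrable_sum_EFin.
have Ed : dissipation p q r = \int[mu]_(x in Omega) (enorm (G x) `^ q * f x `^ r) -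
    \int[mu]_(x in Omega) (\sum_(i < n) (d i x * F i x)).
  rewrite -(RintegralB mO i3 i5); apply: eq_Rintegral => x _; rewrite addrC; congr (_ - _).
  rewrite /edot mulr_sumr; apply: eq_bigr => i _; rewrite mxE /d /F; ring.
have Em m : \int[mu]_(x in Omega) weak_rhs Omega p q f (phi m) x =
    \int[mu]_(x in Omega) (enorm (G x) `^ q * phi m x) -
    (\int[mu]_(x in Omega) (\sum_(i < n) ((partial i (phi m) x - d i x) * F i x)) +
     \int[mu]_(x in Omega) (\sum_(i < n) (d i x * F i x))).
  rewrite (Rintegral_weak_rhs_flux oO bO p q (tphi m) wG) -(RintegralD mO (i6 m) i5).
  rewrite -(RintegralB mO (i2 m) (integrableD_EFin mO (i6 m) i5)).
  apply: eq_Rintegral => x _; rewrite /flux addrC; congr (_ - _).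
  rewrite -big_split /= /edot mulr_sumr; apply: eq_bigr => i _; rewrite mxE /d /F; ring.
under eq_fun do rewrite Em.
rewrite Ed; apply: cvgB; first by apply: (approximation_cvg (D := M `^ q)) => // x _; exact: e_le.
rewrite -[X in _ --> X]add0r; apply: cvgD; last exact: cvg_cst.
under eq_fun => m do rewrite (Rintegral_sum _ mO (i1 m)).
have h : \sum_(i < n) \int[mu]_(x in Omega) ((partial i (phi m) x - d i x) * F i x)
    @[m --> \oo] --> \sum_(i < n) (0 : R).
  apply: cvg_big => [|i _]; first exact: add_continuous.
  exact: approximation_gradient_cvg.
by rewrite big1 in h.
Qed.

End approximation.

End dissipation.

(** * From distributional identities in time to increments *)

Section smooth_step.
Context (R : realType).
Implicit Types (s c a : R) (k : nat).

Lemma Sm_inv k (a : R -> R) : Sm k a -> (forall x, a x != 0) -> Sm k (fun x => (a x)^-1).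
Proof.
elim: k => [|k ih] Ha a0.
  by move=> x; apply: cvgV; [exact: a0|exact: Ha].
have Hk := ih (SmW Ha) a0; have [a' da ha] := Ha.
exists (fun x => -1 * (a' x * ((a x)^-1 * (a x)^-1))); last first.
  by apply: SmM; [exact: Sm_cst|apply: SmM => //; exact: SmM].
move=> x; have [d1 d2] := da x; apply: DeriveDef; first exact: derivableV.
by rewrite deriveV// d2 scaleRE mulN1r -expr2 exprVn mulNr mulrC.
Qed.

Lemma flat_gt0 m s : 0 < s -> 0 < flat m s.
Proof. by move=> s0; rewrite /flat s0 mulr_gt0 ?expR_gt0// exprn_gt0 ?invr_gt0. Qed.

Lemma flat_eq0 m s : s <= 0 -> flat m s = 0.
Proof. by move=> s0; rewrite /flat ltNge s0. Qed.

Let den s := flat 0 s + flat 0 (1 - s).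

Let den_gt0 s : 0 < den s.
Proof.
rewrite /den; have [s0|s0] := ltP 0 s; first by rewrite ltr_pwDl ?flat_gt0 ?flat_ge0.
by rewrite ltr_wpDl ?flat_ge0// flat_gt0//; move: s0; lra.
Qed.

(** The usual smooth transition from 0 on [s <= 0] to 1 on [s >= 1]. The denominator is positive
    since [s] and [1 - s] are never both nonpositive. *)
Definition smooth_step s := flat 0 s / den s.

Definition smooth_step' s :=
  (flat 2 s * flat 0 (1 - s) + flat 0 s * flat 2 (1 - s)) / (den s * den s).

Let Sm_refl k m : Sm k (fun s : R => flat m (1 - s)).
Proof.
rewrite (_ : (fun x => _) = (fun x => flat m (-1 * x + 1))).
  by apply: Sm_affine; exact: Sm_flat.
by apply/funext => x; rewrite mulN1r addrC.
Qed.

Lemma Sm_smooth_step k : Sm k smooth_step.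
Proof.
apply: SmM; first exact: Sm_flat.
apply: Sm_inv; first by apply: SmD; [exact: Sm_flat|exact: Sm_refl].
by move=> x; rewrite gt_eqF// den_gt0.
Qed.

Lemma is_derive_smooth_step s : is_derive s (1 : R) smooth_step (smooth_step' s).
Proof.
have d1 (x : R) : is_derive x 1 (flat 0 : R -> R) (flat 2 x).
  by have := is_derive_flat 0 x; rewrite oppr0 mul0r add0r.
have d2 : is_derive s 1 (fun s : R => flat 0 (1 - s)) (- flat 2 (1 - s)).
  have h : is_derive s 1 (fun x : R => 1 - x) (-1).
    have : is_derive s 1 (cst (1 : R) - id) (0 - 1) by exact: is_deriveB.
    by rewrite sub0r.
  by have := @is_derive1_comp _ (flat 0) _ s _ _ (d1 (1 - s)) h; rewrite mulrN1.
have d3 : is_derive s 1 den (flat 2 s - flat 2 (1 - s)) by exact: is_deriveD.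
have dn : den s != 0 by rewrite gt_eqF.
have d4 : is_derive s 1 (fun x => (den x)^-1) (- (den s) ^- 2 * (flat 2 s - flat 2 (1 - s))).
  by have [e1 e2] := d3; apply: DeriveDef; [exact: derivableV|rewrite deriveV// e2].
have := is_deriveM (d1 s) d4; rewrite !scaleRE; congr is_derive.
by rewrite /smooth_step' /den; field.
Qed.

Lemma smooth_step_le0 s : s <= 0 -> smooth_step s = 0.
Proof. by move=> s0; rewrite /smooth_step flat_eq0// mul0r. Qed.

Lemma smooth_step_ge1 s : 1 <= s -> smooth_step s = 1.
Proof.
move=> s1; have := den_gt0 s; rewrite /smooth_step /den (@flat_eq0 _ (1 - s)).
  by rewrite addr0 => h; rewrite divff// gt_eqF.
by rewrite subr_le0.
Qed.

Lemma smooth_step_ge0 s : 0 <= smooth_step s.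
Proof. by rewrite divr_ge0 ?flat_ge0// ltW. Qed.

Lemma smooth_step_le1 s : smooth_step s <= 1.
Proof. by rewrite ler_pdivrMr// mul1r lerDl flat_ge0. Qed.

Lemma smooth_step'_ge0 s : 0 <= smooth_step' s.
Proof. by rewrite divr_ge0 ?mulr_ge0 ?addr_ge0 ?mulr_ge0 ?flat_ge0// ltW. Qed.

Lemma smooth_step'_le0 s : s <= 0 -> smooth_step' s = 0.
Proof. by move=> s0; rewrite /smooth_step' !(@flat_eq0 _ s)// !mul0r addr0 mul0r. Qed.

Lemma smooth_step'_ge1 s : 1 <= s -> smooth_step' s = 0.
Proof.
move=> s1; rewrite /smooth_step' !(@flat_eq0 _ (1 - s)) ?subr_le0//.
by rewrite !mulr0 addr0 mul0r.
Qed.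

Lemma continuous_smooth_step' : continuous smooth_step'.
Proof.
have [d hd cd] := Sm_smooth_step 1.
rewrite (_ : smooth_step' = d)//; apply/funext => s.
by have [_ <-] := is_derive_smooth_step s; have [_ <-] := hd s.
Qed.

Lemma is_derive_smooth_step_affine c a s :
  is_derive s 1 (fun t => smooth_step (c * (t - a))) (c * smooth_step' (c * (s - a))).
Proof.
have h : is_derive s 1 (fun x : R => c * (x - a)) c.
  have : is_derive s 1 ((cst c : R -> R) \* (id - cst a)) (c *: (1 - 0) + (s - a) *: 0).
    exact: is_deriveM.
  by rewrite scaler0 addr0 subr0 scaleRE mulr1.
by have := @is_derive1_comp _ smooth_step (fun x : R => c * (x - a)) s _ _
  (is_derive_smooth_step (c * (s - a))) h; rewrite mulrC.
Qed.

Lemma Ck_smooth_step_affine k c a : Ck k (fun t : R => smooth_step (c * (t - a))).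
Proof.
apply: (@Ck_comp_affine R R k smooth_step (fun t : R => c * (t - a)) (fun v => c * v)).
- move=> x; apply: cvgM; first exact: cvg_cst.
  by apply: cvgB; [exact: cvg_id|exact: cvg_cst].
- move=> x v h; rewrite (_ : h *: v = h * v)//; ring.
- exact: Sm_smooth_step.
Qed.

End smooth_step.

Section time_increment.
Context (R : realType).
Local Notation mu := (@lebesgue_measure R).

Lemma integral_smooth_step' (a d c : R) : 0 < d -> 0 < c -> 1 <= c * d ->
  \int[mu]_(t in `[a, a + d]) (c * smooth_step' (c * (t - a))) = 1.
Proof.
move=> d0 c0 cd; have ad : a < a + d by rewrite ltrDl.
pose F (t : R) := smooth_step (c * (t - a)); pose g (t : R) := c * smooth_step' (c * (t - a)).
have cF : continuous F by exact: (Ck_continuous (Ck_smooth_step_affine 0 c a)).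
have cg : continuous g.
  move=> t; apply: cvgM; first exact: cvg_cst.
  apply: (@continuous_comp _ _ _ (fun t : R => c * (t - a)) (@smooth_step' R)).
    by apply: cvgM; [exact: cvg_cst|apply: cvgB; [exact: cvg_id|exact: cvg_cst]].
  exact: continuous_smooth_step'.
have Fa : F a = 0 by rewrite /F subrr mulr0 smooth_step_le0.
have Fb : F (a + d) = 1 by rewrite /F addrAC subrr add0r smooth_step_ge1.
rewrite /Rintegral (@continuous_FTC2 _ g F)//.
- by rewrite Fa Fb sube0.
- exact: continuous_subspaceT.
- split.
  + by move=> x _; have [] := is_derive_smooth_step_affine c a x.
  + exact/cvg_at_right_filter/cF.
  + exact/cvg_at_left_filter/cF.
- by move=> x _; rewrite derive1E; have [_ ->] := is_derive_smooth_step_affine c a x.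
Qed.

(** The weights form an approximate identity at [a]: nonnegative, of mass 1, supported in
    [[a, a + d/(k+1)]]. They lie to the right of [a], so all supports are in [[a, a + d]], inside
    []0, T[]. *)
Lemma smooth_step'_average (T a d : R) (I : R -> R) : 0 < a -> 0 < d -> a + d < T ->
  {within `[0, T], continuous I} ->
  \int[mu]_(t in `]0, T[) (k.+1%:R / d * smooth_step' (k.+1%:R / d * (t - a)) * I t)
    @[k --> \oo] --> I a.
Proof.
move=> a0 d0 adT cI; have T0 : 0 < T by lra.
have aI : `[0, T]%classic a by rewrite /= in_itv /=; lra.
have subI : `[a, a + d] `<=` `[0, T].
  by move=> t; rewrite /= !in_itv /= => /andP[h1 h2]; lra.
pose c (k : nat) : R := k.+1%:R / d.
have c0 k : 0 < c k by rewrite divr_gt0.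
have cd k : 1 <= c k * d by rewrite divfK ?gt_eqF// ler1n.
pose g k t := c k * smooth_step' (c k * (t - a)).
have g0 k t : 0 <= g k t by rewrite mulr_ge0 ?smooth_step'_ge0// ltW.
have gout k t : t < a \/ a + (c k)^-1 < t -> g k t = 0.
  move=> [h|h]; rewrite /g.
    by rewrite smooth_step'_le0 ?mulr0// nmulr_lle0 ?ltW// ?subr_lt0// subr_ge0 ltW.
  by rewrite smooth_step'_ge1 ?mulr0// -(@divff _ (c k)) ?gt_eqF// ler_pM2l//; move: h; lra.
have ck k : (c k)^-1 <= d by rewrite -(ler_pM2l (c0 k)) divff// gt_eqF.
have cg k : continuous (g k).
  move=> t; apply: cvgM; first exact: cvg_cst.
  apply: (@continuous_comp _ _ _ (fun t : R => c k * (t - a)) (@smooth_step' R)).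
    by apply: cvgM; [exact: cvg_cst|apply: cvgB; [exact: cvg_id|exact: cvg_cst]].
  exact: continuous_smooth_step'.
have mB : measurable (`[a, a + d]%classic : set (measurableTypeR R)) by exact: measurable_itv.
have ig k : mu.-integrable `[a, a + d] (EFin \o g k).
  apply: continuous_compact_integrable; first exact: segment_compact.
  exact: continuous_subspaceT.
have cId : {within `[a, a + d], continuous I} by exact: continuous_subspaceW cI.
have igI k : mu.-integrable `[a, a + d] (EFin \o (fun t => g k t * I t)).
  apply: continuous_compact_integrable; first exact: segment_compact.
  move=> t; apply: cvgM; last exact: cId.
  exact: (continuous_subspaceT (cg k)).
apply/cvgrPdist_le => e e0.
have [r r0 hr] := compact_uniform_continuous (@segment_compact R 0 T) cI e0.
have : \forall k \near \oo, (c k)^-1 < r.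
  have /cvgr0Pnorm_lt/(_ (r / d)) := @hk_cvg0 R.
  rewrite divr_gt0// => /(_ isT); apply: filterS => k.
  rewrite gtr0_norm ?hk_gt0// => h; rewrite /c invfM invrK mulrC.
  by rewrite -ltr_pdivlMl// mulrC.
apply: filterS => k hk1.
rewrite (@Rintegral_support R _ _ mu `]0, T[ `[a, a + d] (fun t => g k t * I t)); first last.
- move=> t _ nt; rewrite gout ?mul0r//.
  have [h|h] := ltP t a; [by left|right].
  move: nt; rewrite /= in_itv /= h /= => /negP; rewrite -ltNge; apply: le_lt_trans.
  by rewrite lerD2l.
- by move=> t; rewrite /= !in_itv /= => /andP[h1 h2]; lra.
have h1 := integral_smooth_step' a d0 (c0 k) (cd k).
have -> : I a = \int[mu]_(t in `[a, a + d]) (g k t * I a).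
  have -> : \int[mu]_(t in `[a, a + d]) (g k t * I a) =
            \int[mu]_(t in `[a, a + d]) (I a * g k t).
    by apply: eq_Rintegral => t _; rewrite mulrC.
  by rewrite (RintegralZl _ mB (ig k)) h1 mulr1.
have igIa : mu.-integrable `[a, a + d] (EFin \o (fun t => g k t * I a)).
  rewrite (_ : (fun t => g k t * I a) = (fun t => I a * g k t)); first exact: integrableZl_EFin.
  by apply/funext => t; rewrite mulrC.
rewrite -(RintegralB mB igIa (igI k)).
apply: (@le_trans _ _ (\int[mu]_(t in `[a, a + d]) (e * g k t))); last first.
  by rewrite (RintegralZl _ mB (ig k)) h1 mulr1.
apply: (Rintegral_le_bound mB (integrableB_EFin mB igIa (igI k)) (integrableZl_EFin e mB (ig k))).
move=> t /subI tI; rewrite -mulrBr normrM (ger0_norm (g0 _ _)) mulrC.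
have [h|h] := ltP t a; first by rewrite gout ?mulr0//; left.
have [h'|h'] := ltP (a + (c k)^-1) t; first by rewrite gout ?mulr0//; right.
apply: ler_wpM2r => //; apply/ltW/hr => //.
by rewrite /ball /= distrC ger0_norm ?subr_ge0//; apply: le_lt_trans hk1; move: h'; lra.
Qed.

(* Test the identity against [smooth_step (c_k (t - t1)) - smooth_step (c_k (t - t2))], which
   tends to the indicator of [t1, t2]. *)
Lemma time_increment (T : R) (I A : R -> R) (D : set R) (C : R) (t1 t2 : R) :
  measurable (D : set (measurableTypeR R)) -> D `<=` `]0, T[%classic ->
  {ae mu, forall t, `]0, T[%classic t -> D t} ->
  measurable_fun (D : set (measurableTypeR R)) A -> (forall t, D t -> `|A t| <= C) ->
  {within `[0, T], continuous I} ->
  (forall theta : R -> R, test_function `]0, T[%classic theta ->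
     - (\int[mu]_(t in `]0, T[%classic) (derive1 theta t * I t)) =
     \int[mu]_(t in `]0, T[%classic) (theta t * A t)) ->
  0 < t1 -> t1 <= t2 -> t2 < T ->
  I t2 - I t1 = \int[mu]_(t in D `&` `]t1, t2]) A t.
Proof.
move=> mD DT aeD mA AC cI hI t10 t12 t2T.
have [t20 T0] : 0 < t2 /\ 0 < T by lra.
(* Half of the gap to [T], so that the second transition ends before [T] and [th k] has compact
   support in []0, T[]. *)
pose d := (T - t2) / 2; have d0 : 0 < d by rewrite divr_gt0// subr_gt0.
have t2d : t2 + d < T by rewrite /d; lra.
pose c (k : nat) : R := k.+1%:R / d.
have c0 k : 0 < c k by rewrite divr_gt0.
have cd k : 1 <= c k * d by rewrite divfK ?gt_eqF// ler1n.
pose th k (t : R) := smooth_step (c k * (t - t1)) - smooth_step (c k * (t - t2)).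
have tth k : test_function `]0, T[%classic (th k).
  split; first by move=> j; apply: CkB; exact: Ck_smooth_step_affine.
  exists `[t1, t2 + d]%classic.
    split; first exact: segment_compact.
    by move=> t; rewrite /= !in_itv /= => /andP[h1 h2]; lra.
  move=> t; rewrite /= in_itv /= => /negP; rewrite negb_and -!ltNge => /orP[h|h].
    by rewrite /th !smooth_step_le0 ?subrr// pmulr_rle0 ?subr_le0//; move: h t12; lra.
  have h2 : 1 <= c k * (t - t2).
    by apply: le_trans (cd k) _; rewrite ler_pM2l//; move: h; lra.
  rewrite /th !smooth_step_ge1 ?subrr//; apply: le_trans h2 _.
  by rewrite ler_pM2l//; move: t12; lra.
have dth k t : derive1 (th k) t = c k * smooth_step' (c k * (t - t1)) -
    c k * smooth_step' (c k * (t - t2)).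
  have := is_deriveB (is_derive_smooth_step_affine (c k) t1 t)
    (is_derive_smooth_step_affine (c k) t2 t).
  by rewrite derive1E => -[_ <-].
have mT : measurable (`]0, T[%classic : set (measurableTypeR R)) by exact: measurable_itv.
have ig a k : mu.-integrable `]0, T[ (EFin \o (fun t => c k * smooth_step' (c k * (t - a)) * I t)).
  apply: (@integrableS _ _ _ mu `[0, T]%classic) => //.
    by move=> t; rewrite /= !in_itv /= => /andP[/ltW -> /ltW ->].
  apply: continuous_compact_integrable; first exact: segment_compact.
  move=> t; apply: cvgM; last exact: cI.
  apply: (@continuous_subspaceT _ _ _ (fun t : R => c k * smooth_step' (c k * (t - a)))) => {}t.
  apply: cvgM; first exact: cvg_cst.
  apply: (@continuous_comp _ _ _ (fun t : R => c k * (t - a)) (@smooth_step' R)).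
    by apply: cvgM; [exact: cvg_cst|apply: cvgB; [exact: cvg_id|exact: cvg_cst]].
  exact: continuous_smooth_step'.
have El k : - (\int[mu]_(t in `]0, T[) (derive1 (th k) t * I t)) =
    (\int[mu]_(t in `]0, T[) (c k * smooth_step' (c k * (t - t2)) * I t)) -
    \int[mu]_(t in `]0, T[) (c k * smooth_step' (c k * (t - t1)) * I t).
  rewrite -[RHS]opprB -(RintegralB mT (ig t1 k) (ig t2 k)); congr (- _).
  by apply: eq_Rintegral => t _; rewrite dth mulrBl.
have limL : - (\int[mu]_(t in `]0, T[) (derive1 (th k) t * I t)) @[k --> \oo] --> I t2 - I t1.
  under eq_fun do rewrite El.
  apply: cvgB; first exact: smooth_step'_average.
  by apply: smooth_step'_average => //; move: t12 t2d; lra.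
have finT : (mu [set` `]0%R, T[] < +oo)%E.
  by rewrite lebesgue_measure_itv /= lte_fin T0 -EFinB ltry.
have finD : (mu D < +oo)%E by apply: le_lt_trans finT; apply: le_measure; rewrite ?inE.
(* [A] is known to be measurable and bounded only on [D]. The integral over []0, T[] ignores the
   remaining null set whatever [A] is there. *)
have Er k : \int[mu]_(t in `]0, T[) (th k t * A t) = \int[mu]_(t in D) (th k t * A t).
  rewrite (@ae_eq_Rintegral_lower _ _ _ mu _ _ ((fun t => th k t * A t) \_ D)); last first.
    move: aeD; apply: filterS; first exact: (ae_filter_ringOfSetsType mu).
    by move=> t h tT; rewrite /patch mem_set//; exact: h.
  by rewrite -Rintegral_mkcondr setIidr.
have mS : measurable (`]t1, t2]%classic : set (measurableTypeR R)) by exact: measurable_itv.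
have cth k : continuous (th k) by have [/(_ 0%N)/Ck_continuous] := tth k.
have iC : mu.-integrable D (EFin \o (fun=> `|C|)).
  by apply: (bounded_integrable (C := `|C|) mD finD) => // t _; rewrite normr_id.
have bth k t : `|th k t| <= 1.
  rewrite ler_norml /th; have := smooth_step_ge0 (c k * (t - t1)).
  have := smooth_step_ge0 (c k * (t - t2)).
  have := smooth_step_le1 (c k * (t - t1)); have := smooth_step_le1 (c k * (t - t2)).
  by move: (smooth_step _) (smooth_step _) => x y; lra.
have hstep a t : smooth_step (c k * (t - a)) @[k --> \oo] --> ((a < t)%R%:R : R).
  have [h|h] := ltP a t; last first.
    rewrite (_ : (fun k => _) = (fun=> 0)); first exact: cvg_cst.
    by apply/funext => k; rewrite smooth_step_le0// pmulr_rle0 ?subr_le0.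
  have ta : 0 < t - a by rewrite subr_gt0.
  apply: (@cvg_trans _ ((fun=> 1) @ \oo)); last exact: cvg_cst.
  apply: near_eq_cvg.
  have : \forall k \near \oo, hk R k <= (t - a) / d.
    have /cvgr0Pnorm_le/(_ ((t - a) / d)) := @hk_cvg0 R.
    rewrite divr_gt0// => /(_ isT); apply: filterS => k.
    by rewrite gtr0_norm ?hk_gt0.
  apply: filterS => k h1; rewrite smooth_step_ge1//.
  rewrite /c -mulrA [_^-1 * _]mulrC -ler_pdivrMl ?ltr0n// mulr1.
  exact: h1.
have limR : \int[mu]_(t in D) (th k t * A t) @[k --> \oo] -->
    \int[mu]_(t in D) (((t1 < t)%R%:R - (t2 < t)%R%:R) * A t).
  apply: (@Rintegral_dominated_cvg _ _ R mu D (fun k t => th k t * A t)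
    (fun t => ((t1 < t)%R%:R - (t2 < t)%R%:R) * A t) (fun=> `|C|) mD _ _ iC _).2.
  - move=> k; apply: measurable_funM => //; apply: measurable_funTS.
    exact: continuous_measurable_fun.
  - by move=> t Dt; apply: cvgM; [apply: cvgB; exact: hstep|exact: cvg_cst].
  - move=> k t Dt; rewrite normrM -[leRHS]mul1r; apply: ler_pM => //.
    by apply: le_trans (AC _ Dt) (ler_norm _).
have E2 : \int[mu]_(t in D) (((t1 < t)%R%:R - (t2 < t)%R%:R) * A t) = \int[mu]_(t in D `&` `]t1, t2]) A t.
  rewrite Rintegral_mkcondr; apply: eq_Rintegral => t _; rewrite /patch mem_setE in_itv /=.
  have [h1|h1] := ltP t1 t; have [h2|h2] := ltP t2 t => /=; rewrite ?subrr ?subr0 ?mul0r ?mul1r//.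
  by move: h1 h2 t12; lra.
have lim2 : \int[mu]_(t in D) (th k t * A t) @[k --> \oo] --> I t2 - I t1.
  by under eq_fun do rewrite -Er -(hI _ (tth _)).
by rewrite -E2; exact: (cvg_unique (@norm_hausdorff _ R) lim2 limR).
Qed.

End time_increment.

(** * Zero extension and regularity in time *)

Section restriction.
Context (R : realType) (n : nat).
Let V := 'rV[R]_n.
Local Notation mu := (@lebesgue_rV R n).
Variable Omega : set V.
Implicit Types (f : V -> R) (g : V -> V).

(** An equality of predicates, so that [get] makes the same choice for [f] and for its extension by
    zero. *)
Lemma is_weak_gradient_patch f : is_weak_gradient Omega (f \_ Omega) = is_weak_gradient Omega f.
Proof.
have E x : Omega x -> (f \_ Omega) x = f x by move=> Ox; rewrite /patch mem_set.
have L : L1loc Omega (f \_ Omega) = L1loc Omega f.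
  apply/propext; split => h K cK KO; have := h K cK KO.
    apply: eq_integrable; first exact: (measurable_closed_rV (compact_closed (@norm_hausdorff _ _) cK)).
    by move=> x /set_mem Kx /=; rewrite E//; exact: KO.
  apply: eq_integrable; first exact: (measurable_closed_rV (compact_closed (@norm_hausdorff _ _) cK)).
  by move=> x /set_mem Kx /=; rewrite E//; exact: KO.
apply/funext => g; apply/propext; rewrite /is_weak_gradient L.
by split => -[h1 h2 h3]; split => // i phi tphi; rewrite -h3//; apply: eq_Rintegral => x /set_mem Ox;
  rewrite E.
Qed.

Lemma weak_gradient_patch f : weak_gradient Omega (f \_ Omega) = weak_gradient Omega f.
Proof. by rewrite /weak_gradient is_weak_gradient_patch. Qed.

Lemma Lp_norm_oo_le f (M : R) : (Lp_norm Omega +oo%E f <= M%:E)%E ->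
  {ae mu, forall x, Omega x -> `|f x| <= M}.
Proof.
rewrite /Lp_norm unlock; case: ifPn => [_ /ess_supP|m0 _].
  by apply: filterS => x /= + Ox; rewrite /patch mem_set// lee_fin.
(* The remaining case of the definition of the norm is that of a null space, where any property
   holds almost everywhere. *)
exists setT; split => //; apply/eqP; rewrite eq_le measure_ge0 andbT.
by rewrite leNgt.
Qed.

Lemma Lp_norm_ge0 (s : \bar R) f : (0 <= s)%E -> (0 <= Lp_norm Omega s f)%E.
Proof. by move=> s0; exact: Lnorm_ge0. Qed.

Lemma W1_norm_oo_le f (M : R) : (W1_norm Omega +oo%E f <= M%:E)%E ->
  {ae mu, forall x, Omega x -> enorm (weak_gradient Omega f x) <= M}.
Proof.
move=> h; have : (Lp_norm Omega +oo%E (fun x => enorm (weak_gradient Omega f x)) <= M%:E)%E.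
  by apply: le_trans h; rewrite leeDr// Lp_norm_ge0.
move=> /Lp_norm_oo_le; apply: filterS => x h1 Ox.
by rewrite (le_trans (ler_norm _))// h1.
Qed.

End restriction.

Section zero_extension.
Context (R : realType) (n : nat).
Let V := 'rV[R]_n.
Variable Omega : set V.
Hypotheses (oO : open Omega) (bO : bounded_set Omega).
Variable u : R -> V -> R.
Hypothesis cu : {within [set z : R * V | 0 <= z.1 /\ closure Omega z.2],
  continuous (fun z : R * V => u z.1 z.2)}.
Hypothesis u0 : forall t x, 0 <= t -> closure Omega x -> 0 <= u t x.
Hypothesis uO : forall t x, 0 <= t -> boundary Omega x -> u t x = 0.

Definition zext t : V -> R := u t \_ Omega.

Lemma zextE t x : Omega x -> zext t x = u t x.
Proof. by move=> Ox; rewrite /zext /patch mem_set. Qed.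

Lemma zext_out t x : ~ Omega x -> zext t x = 0.
Proof. by move=> Ox; rewrite /zext /patch memNset. Qed.

Lemma zext_ge0 t x : 0 <= t -> 0 <= zext t x.
Proof.
move=> t0; have [Ox|nO] := pselect (Omega x); last by rewrite zext_out.
by rewrite zextE//; apply: u0 => //; exact: subset_closure.
Qed.

Lemma compact_cylinder (T : R) : compact (`[0, T] `*` closure Omega).
Proof.
apply: compact_setX; first exact: segment_compact.
have [L L0 OL] := bounded_setP bO.
apply: (subclosed_compact _ (@closed_ball0_compact R n L)); first exact: closed_closure.
have clB := compact_closed (@norm_hausdorff _ _) (@closed_ball0_compact R n L).
by rewrite ((closure_id _).1 clB); apply: closure_subset => x /OL.
Qed.

Lemma continuous_cylinder (T : R) : {within `[0, T] `*` closure Omega,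
  continuous (fun z : R * V => u z.1 z.2)}.
Proof.
apply: continuous_subspaceW cu => -[t x] [/= ht hx]; split => //.
by move: ht; rewrite in_itv /= => /andP[].
Qed.

Lemma zext_uniform (T e : R) : 0 < e -> exists2 d : R, 0 < d &
  forall s t x, 0 <= s <= T -> 0 <= t <= T -> `|s - t| < d -> `|zext s x - zext t x| <= e.
Proof.
move=> e0; have [d d0 hd] := compact_uniform_continuous (@compact_cylinder T)
  (@continuous_cylinder T) e0.
exists d => // s t x sT tT st.
have [Ox|nO] := pselect (Omega x); last by rewrite !zext_out// subrr normr0 ltW.
have cO : closure Omega x by exact: subset_closure.
rewrite !zextE//; apply/ltW/(hd (s, x) (t, x)); [by split; rewrite //= in_itv|by split; rewrite //= in_itv|].
by split; rewrite /= ?/ball //=; exact: ballxx.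
Qed.

Lemma zext_bound (T : R) : exists2 U : R, 0 <= U & forall t x, 0 <= t <= T -> zext t x <= U.
Proof.
have := continuous_compact (@continuous_cylinder T) (@compact_cylinder T).
move=> /compact_bounded[M [_ hM]]; exists (`|M| + 1); first by rewrite addr_ge0.
move=> t x tT; have [Ox|nO] := pselect (Omega x); last by rewrite zext_out// addr_ge0.
rewrite zextE//; apply: le_trans (ler_norm _) _; apply: (hM (`|M| + 1)).
  by rewrite (le_lt_trans (ler_norm _))// ltrDl.
exists (t, x) => //; split; first by rewrite /= in_itv.
exact: subset_closure.
Qed.

(** Across the boundary, continuity comes from [u t = 0] there together with continuity of [u]
    relative to the closure of Omega. *)
Lemma zext_continuous t : 0 <= t -> continuous (zext t).
Proof.
move=> t0 x.
have [cOx|nc] := pselect (closure Omega x); last first.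
  have nO : ~ Omega x by move=> /subset_closure.
  apply/(@cvgrPdist_le R R _ _ (nbhs_filter (x : V)) (zext t)) => e e0.
  have : \forall y \near x, (~` closure Omega) y.
    by apply: open_nbhs_nbhs; split => //; apply: closed_openC; exact: closed_closure.
  apply: filterS => y ny; have nOy : ~ Omega y by move=> /subset_closure.
  by rewrite !zext_out// subrr normr0 ltW.
have hx e : 0 < e -> \forall y \near x, closure Omega y -> `|u t x - u t y| < e.
  move=> e0; move/subspace_continuousP: cu => /(_ (t, x)) /(_ (conj t0 cOx)).
  move=> /cvgrPdist_lt/(_ _ e0); rewrite near_withinE => /nbhs_ballP[r /= r0 hr].
  apply/nbhs_ballP; exists r => //= y xy cy.
  apply: (hr (t, y)); last by split.
  by split => //=; exact: ballxx.
have [Ox|nOx] := pselect (Omega x).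
  apply/(@cvgrPdist_le R R _ _ (nbhs_filter (x : V)) (zext t)) => e e0; have := hx e e0.
  have : \forall y \near x, Omega y by exact: open_nbhs_nbhs.
  apply: filterS2 => y Oy h; rewrite !zextE//; apply/ltW/h; exact: subset_closure.
have bx : boundary Omega x.
  by split => // /interior_subset.
apply/(@cvgrPdist_le R R _ _ (nbhs_filter (x : V)) (zext t)) => e e0; have := hx e e0; apply: filterS => y h.
rewrite (zext_out _ nOx) -(uO t0 bx).
have [Oy|nOy] := pselect (Omega y).
  by rewrite zextE//; apply/ltW/h; exact: subset_closure.
by rewrite (zext_out _ nOy) (uO t0 bx) subrr normr0 ltW.
Qed.

End zero_extension.

(** * Stability of the right-hand side under convergence in [W^(1,oo)] *)

Section weak_rhs_limit.
Context (R : realType) (n : nat).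
Let V := 'rV[R]_n.
Local Notation mu := (@lebesgue_rV R n).
Variable Omega : set V.
Hypotheses (oO : open Omega) (bO : bounded_set Omega).
Variables (p q : R).
Hypotheses (p2 : 2 < p) (q0 : 0 < q).

Let mO : measurable Omega. Proof. exact: open_measurable_rV. Qed.
Let p20 : 0 < p - 2. Proof. by rewrite subr_gt0. Qed.

Lemma enorm_le_coord (v : V) (B : R) : (forall i, `|v ord0 i| <= B) -> enorm v <= B *+ n.
Proof.
move=> vB; apply: (@le_trans _ _ (\sum_i `|v ord0 i|)); last first.
  apply: (@le_trans _ _ (\sum_(i < n) B)); last by rewrite sumr_const card_ord.
  by apply: ler_sum => i _; exact: vB.
have S0 : 0 <= \sum_i `|v ord0 i| by exact: sumr_ge0.
rewrite -[leRHS](ger0_norm S0) -sqrtr_sqr ler_wsqrtr// expr2 mulr_suml.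
apply: ler_sum => i _; rewrite -real_normK ?num_real// expr2; apply: ler_wpM2l => //.
by rewrite (bigD1 i)//= lerDl sumr_ge0.
Qed.

Lemma flux_cvg phi (w : nat -> V) (v x : V) : enorm (v - w k) @[k --> \oo] --> (0 : R) ->
  flux p q phi (w k) x @[k --> \oo] --> flux p q phi v x.
Proof.
move=> hw; have cw i : w k ord0 i @[k --> \oo] --> v ord0 i.
  apply/cvgrPdist_le => e e0; have /cvgr0Pnorm_le/(_ _ e0) := hw; apply: filterS => k.
  rewrite ger0_norm; last exact: sqrtr_ge0.
  apply: le_trans; apply: le_trans (enorm_ge_coord _ i).
  by rewrite !mxE.
have ce : enorm (w k) @[k --> \oo] --> enorm v.
  have cs : \sum_i w k ord0 i ^+ 2 @[k --> \oo] --> \sum_i v ord0 i ^+ 2.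
    apply: cvg_big => [|i _]; first exact: add_continuous.
    by apply: cvgM; exact: cw.
  exact: (cvg_comp _ _ cs (@sqrt_continuous R _)).
have cp t : 0 < t -> enorm (w k) `^ t @[k --> \oo] --> enorm v `^ t.
  by move=> t0; apply: powR_cvg_ge0 => // *; exact: sqrtr_ge0.
apply: cvgD; last by apply: cvgM; [exact: cp|exact: cvg_cst].
apply: cvgN; apply: cvgM; first exact: cp.
apply: cvg_big => [|i _]; first exact: add_continuous.
by apply: cvgM; [exact: cw|exact: cvg_cst].
Qed.

(** Makes the right-hand side, as a function of time, a pointwise limit of simple functions.
    Convergence in [W^(1,oo)] gives almost everywhere convergence of the gradients and, from some
    rank on, a common bound; dominated convergence does the rest. *)
Lemma Rintegral_weak_rhs_W1_cvg (f : V -> R) (g : nat -> V -> R) (M : R) phi :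
  test_function Omega phi ->
  is_weak_gradient Omega f (weak_gradient Omega f) ->
  (W1_norm Omega +oo%E f <= M%:E)%E ->
  (forall k, is_weak_gradient Omega (g k) (weak_gradient Omega (g k))) ->
  (W1_norm Omega +oo%E (fun x => f x - g k x)%R @[k --> \oo] --> 0%E) ->
  \int[mu]_(x in Omega) weak_rhs Omega p q (g k) phi x @[k --> \oo] -->
  \int[mu]_(x in Omega) weak_rhs Omega p q f phi x.
Proof.
move=> tphi wf fM wg cfg.
set F := weak_gradient Omega f in wf *; pose G k := weak_gradient Omega (g k).
have aeF : {ae mu, forall x, Omega x -> enorm (F x) <= M} by exact: W1_norm_oo_le.
have ev e : 0 < e -> exists K, forall k, (K <= k)%N ->
    {ae mu, forall x, Omega x -> enorm (F x - G k x) <= e}.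
  move=> e0; have /fine_cvgP[hfin /cvgr0Pnorm_le/(_ _ e0) hle] := cfg.
  have [K _ hK] : \forall k \near \oo, (W1_norm Omega +oo%E (fun x => f x - g k x)%R <= e%:E)%E.
    move: hfin hle; apply: filterS2 => k kfin /= ke.
    by rewrite -(fineK kfin) lee_fin; apply: le_trans ke; exact: ler_norm.
  exists K => k Kk; have := W1_norm_oo_le (hK k Kk).
  have [_] := weak_gradientP oO bO (is_weak_gradientB oO bO wf (wg k)).
  by apply: filterS2 => x h1 h2 Ox; rewrite -h1//; exact: h2.
have M1 : 0 <= `|M| by [].
(* From rank [K0] on the gradients are within 1 of that of [f], hence uniformly bounded; earlier
   terms need not be bounded, which is why the sequence is shifted below. *)
have [K0 hK0] := ev 1 ltr01.
have aeB : {ae mu, forall x (k : nat), Omega x -> enorm (G (K0 + k)%N x) <= (`|M| + 1) *+ n}.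
  apply/ae_foralln => k; have := hK0 (K0 + k)%N (leq_addr _ _).
  move: aeF; apply: filterS2 => x h1 h2 Ox.
  apply: enorm_le_coord => i.
  rewrite (_ : G _ x ord0 i = F x ord0 i - (F x - G (K0 + k)%N x) ord0 i); last first.
    by rewrite !mxE opprB addrC subrK.
  apply: le_trans (ler_normB _ _) _; apply: lerD; apply: le_trans (enorm_ge_coord _ _) _.
    exact: le_trans (h1 Ox) (ler_norm _).
  exact: h2.
have aeC : {ae mu, forall x, Omega x -> enorm (F x - G k x) @[k --> \oo] --> (0 : R)}.
  have : {ae mu, forall x (j : nat), Omega x -> exists K, forall k, (K <= k)%N ->
      enorm (F x - G k x) <= hk R j}.
    apply/ae_foralln => j; have [K hK] := ev _ (hk_gt0 R j).
    have : {ae mu, forall x (k : nat), Omega x -> enorm (F x - G (K + k)%N x) <= hk R j}.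
      by apply/ae_foralln => k; exact: hK (leq_addr _ _).
    apply: filterS => x h Ox; exists K => k Kk.
    by have := h (k - K)%N Ox; rewrite subnKC.
  apply: filterS => x h Ox; apply/cvgr0Pnorm_le => e e0.
  have /cvgr0Pnorm_le/(_ _ e0)[j _ hj] := @hk_cvg0 R.
  have [K hK] := h j Ox; exists K => // k /= Kk.
  rewrite ger0_norm; last exact: sqrtr_ge0.
  apply: le_trans (hK _ Kk) _; apply: le_trans (ler_norm _) _; exact: (hj j (leqnn j)).
have [_ lF _] := wf.
have mF i : measurable_fun Omega (fun x => F x ord0 i) by exact: L1loc_measurable (lF i).
have mG k i : measurable_fun Omega (fun x => G k x ord0 i).
  by have [_ lG _] := wg k; exact: L1loc_measurable (lG i).
have hk := test_smooth_kernel bO tphi.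
have [D _ hD] := kernel_bounded hk.
have hC i : exists C : R, forall x, `|partial i phi x| <= C.
  by have [C _ hC] := kernel_bounded (kernel_derive (delta_mx ord0 i) hk); exists C.
have {hC}[Ci hCi] := choice hC.
pose C : R := \sum_i `|Ci i|.
have hC x i : `|partial i phi x| <= C.
  apply: le_trans (hCi i x) _; apply: le_trans (ler_norm _) _.
  by rewrite /C (bigD1 i)//= lerDl sumr_ge0.
set B := (`|M| + 1) *+ n in aeB.
pose c := B `^ (p - 2) * (B * C *+ n) + B `^ q * D.
suff key (J : (V -> R) -> R) : (forall h gh, is_weak_gradient Omega h gh ->
    J h = \int[mu]_(x in Omega) flux p q phi (gh x) x) -> (fun k => J (g k)) @ \oo --> J f.
  pose J h := \int[mu]_(x in Omega) weak_rhs Omega p q h phi x.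
  by have H := key J (fun h gh hw => Rintegral_weak_rhs_flux oO bO p q tphi hw); exact: H.
move=> EJ; have EF := EJ _ _ wf.
rewrite EF; suff H2 : (fun k => \int[mu]_(x in Omega) flux p q phi (G k x) x) @ \oo -->
    \int[mu]_(x in Omega) flux p q phi (F x) x.
  apply: cvg_trans H2; apply: near_eq_cvg; apply: nearW => k.
  exact: esym (EJ _ _ (wg k)).
have ic : mu.-integrable Omega (EFin \o (fun=> c)).
  by apply: (bounded_integrable (C := `|c|) mO (finite_lebesgue_bounded oO bO)).
have H := (@Rintegral_dominated_cvg_ae _ _ R mu Omega (fun k x => flux p q phi (G (k + K0)%N x) x)
    (fun x => flux p q phi (F x) x) (fun=> c) mO _ _ _ ic _).2.
have {}H : \int[mu]_(x in Omega) flux p q phi (G (k + K0)%N x) x @[k --> \oo] -->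
    \int[mu]_(x in Omega) flux p q phi (F x) x.
  apply: H.
  - by move=> k; exact: measurable_flux.
  - exact: measurable_flux.
  - move: aeC; apply: filterS => x h Ox; apply: flux_cvg.
    exact: (cvg_comp _ _ (cvg_addnr K0) (h Ox)).
  - move: aeB; apply: filterS => x h k Ox; apply: flux_le => //.
    by rewrite addnC; exact: h.
exact: (eq_ind _ id H _ (cvg_shiftn K0 (fun k => \int[mu]_(x in Omega) flux p q phi (G k x) x) _)).
Qed.

End weak_rhs_limit.

Lemma ae_interval_dense (R : realType) (T : R) (D : set R) (t d : R) :
  {ae (@lebesgue_measure R), forall s : R, `]0, T[%classic s -> D s} ->
  0 < T -> 0 <= t <= T -> 0 < d -> exists2 s, D s & `|s - t| < d.
Proof.
move=> [Z [mZ Z0 DZ]] T0 /andP[t0 tT] d0; apply: contrapT => h.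
pose a := Num.max 0 (t - d); pose b := Num.min T (t + d).
have ab : a < b by rewrite /a /b gt_max !lt_min T0; apply/and3P; split; lra.
have IZ : [set` `]a, b[] `<=` Z.
  move=> s; rewrite /= in_itv /= gt_max lt_min => /andP[/andP[s0 s1] /andP[s2 s3]].
  apply: DZ => /= hs; apply: h; exists s; first by apply: hs; rewrite /= in_itv /= s0.
  by rewrite ltr_norml; lra.
have : (lebesgue_measure [set` `]a, b[] <= (0 : \bar R))%E.
  by rewrite -Z0; apply: le_measure; rewrite ?inE//; exact: measurable_itv.
by rewrite lebesgue_measure_itv /= lte_fin ab -EFinB lee_fin subr_le0 leNgt ab.
Qed.

(** A preimage under the composite is a finite union of level sets of [s], so neither a
    sigma-algebra on the intermediate space nor any regularity of [F] is required. *)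
Lemma measurable_simple (R : realType) d (S : measurableType d) (U : Type) (D : set S)
    (s : S -> U) (F : U -> R) : measurable D -> finite_set (range s) ->
  (forall f, measurable (s @^-1` [set f])) -> measurable_fun D (F \o s).
Proof.
move=> mD fs ms _ Y mY.
rewrite (_ : _ @^-1` Y = \bigcup_(f in range s `&` F @^-1` Y) (s @^-1` [set f])).
  apply: measurableI => //; apply: fin_bigcup_measurable => //.
  exact: finite_setIl.
apply/seteqP; split => [x /= Yx|x [f [_ Yf] /= xf]]; last by rewrite /= xf.
by exists (s x) => //; split => //; exists x.
Qed.

Section evolution.
Context (R : realType) (n : nat).
Let V := 'rV[R]_n.
Local Notation mu := (@lebesgue_rV R n).
Local Notation lambda := (@lebesgue_measure R).
Variable Omega : set V.
Hypotheses (oO : open Omega) (bO : bounded_set Omega).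
Variables (p q T : R).
Hypotheses (p2 : 2 < p) (q0 : 0 < q) (T0 : 0 < T).
Variable u : R -> V -> R.
Hypothesis cu : {within [set z : R * V | 0 <= z.1 /\ closure Omega z.2],
  continuous (fun z : R * V => u z.1 z.2)}.
Hypothesis u0 : forall t x, 0 <= t -> closure Omega x -> 0 <= u t x.
Hypothesis uO : forall t x, 0 <= t -> boundary Omega x -> u t x = 0.
Hypothesis W : in_Linfty_W1infty Omega T u.

Let mO : measurable Omega. Proof. exact: open_measurable_rV. Qed.

(** [D] is []0, T[] minus the exceptional null sets of the measurability and boundedness conditions.
    Gradients are controlled on [D] only, whereas the Lipschitz bound extends to every time of
    [[0, T]]. *)
Lemma good_times : exists (M : R) (D : set R), [/\ 0 <= M,
    measurable (D : set (measurableTypeR R)), D `<=` `]0, T[%classic,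
    {ae lambda, forall t : R, `]0, T[%classic t -> D t} &
    [/\ forall t, 0 <= t <= T -> coord_lipschitz M (zext Omega u t),
      forall t, D t -> exists G : V -> V, [/\ forall i, measurable_fun Omega (fun x => G x ord0 i),
        forall x, enorm (G x) <= M & is_weak_gradient Omega (zext Omega u t) G] &
      forall phi, test_function Omega phi -> measurable_fun (D : set (measurableTypeR R))
        (fun t => \int[mu]_(x in Omega) weak_rhs Omega p q (u t) phi x)]].
Proof.
have [[s [fs ms ws aes]] [M aeM]] := W.
have [N1 [mN1 N10 hN1]] := aes; have [N2 [mN2 N20 hN2]] := aeM.
pose D : set R := `]0, T[ `\` (N1 `|` N2).
have mD : measurable (D : set (measurableTypeR R)).
  by apply: measurableD; [exact: measurable_itv|exact: measurableU].
have h1 t : D t -> W1_norm Omega +oo%E (fun x => u t x - s k t x)%R @[k --> \oo] --> 0%E.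
  move=> [tT nN]; apply: contrapT => h; apply: nN; left; apply: hN1 => /= hs.
  by apply: h; exact: hs.
have h2 t : D t -> in_W1 Omega +oo%E (u t) /\ (W1_norm Omega +oo%E (u t) <= M%:E)%E.
  move=> [tT nN]; apply: contrapT => h; apply: nN; right; apply: hN2 => /= hs.
  by apply: h; exact: hs.
have DT : D `<=` `]0, T[%classic by move=> t [].
have aeD : {ae lambda, forall t : R, `]0, T[%classic t -> D t}.
  exists (N1 `|` N2); split; first exact: measurableU.
    by apply: null_set_setU.
  move=> t /= h; apply: contrapT => nN; apply: h => tT; split => //.
have DT' t : D t -> 0 <= t by move=> /DT; rewrite /= in_itv /= => /andP[/ltW].
have wg t : D t -> is_weak_gradient Omega (zext Omega u t) (weak_gradient Omega (u t)).
  by move=> /h2[[_ wu _] _]; rewrite /zext is_weak_gradient_patch.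
have gM t : D t -> {ae mu, forall x, Omega x -> enorm (weak_gradient Omega (u t) x) <= `|M|}.
  move=> /h2[_ /W1_norm_oo_le]; apply: filterS => x h Ox.
  exact: le_trans (h Ox) (ler_norm _).
have lipD t : D t -> coord_lipschitz `|M| (zext Omega u t).
  move=> Dt i; apply: (weak_coord_lipschitz oO bO _ _ (wg t Dt)) => //.
  - exact: zext_continuous (DT' t Dt).
  - by apply: (profile_bounded_support bO) => x; exact: zext_out.
  - move: (gM t Dt); apply: filterS => x h Ox.
    exact: le_trans (enorm_ge_coord _ _) (h Ox).
  - by move=> x; apply: zext_ge0 => //; exact: DT'.
  - by move=> x; exact: zext_out.
exists `|M|, D; split => //; split.
(* [D] is dense in [[0, T]] and [zext] is uniformly continuous in time, so the Lipschitz bound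
   passes to the limit. *)
- move=> t tT i x h; apply/ler_addgt0Pr => e e0.
  have [d d0 hd] := zext_uniform bO cu T (divr_gt0 e0 (ltr0n R 2)).
  have [t' Dt' tt'] := ae_interval_dense aeD T0 tT d0.
  have t'T : 0 <= t' <= T by have := DT _ Dt'; rewrite /= in_itv /= => /andP[/ltW -> /ltW ->].
  have e1 := hd t' t (x + h *: delta_mx ord0 i) t'T tT tt'; have e2 := hd t' t x t'T tT tt'.
  have e3 := lipD t' Dt' i x h.
  move: (zext _ _ t' _) (zext _ _ t' _) (zext _ _ t _) (zext _ _ t _) e1 e2 e3 => a b a' b'.
  move: (`|M| * `|h|) => m; rewrite !ler_norml => /andP[? ?] /andP[? ?] /andP[? ?].
  by apply/andP; split; lra.
- move=> t Dt; have [G [mG GM _ wG]] := nice_gradient oO bO (wg t Dt) (normr_ge0 M) (gM t Dt).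
  by exists G.
- move=> phi tphi.
  apply: (@measurable_fun_cvg _ _ _ D (fun k t => \int[mu]_(x in Omega) weak_rhs Omega p q (s k t) phi x)).
    move=> k; exact: (@measurable_simple R _ _ _ D (s k)
      (fun f => \int[mu]_(x in Omega) weak_rhs Omega p q f phi x) mD (fs k) (ms k)).
  move=> t Dt; have [[_ wu _] uM] := h2 t Dt.
  have ws' k : is_weak_gradient Omega (s k t) (weak_gradient Omega (s k t)) by have [] := ws k t.
  exact: (@Rintegral_weak_rhs_W1_cvg R n Omega oO bO p q p2 q0 (u t) (fun k => s k t) M phi
    tphi wu uM ws' (h1 t Dt)).
Qed.

End evolution.

(** * Growth of the energy *)

(** Tangent line inequality at [a] for the convex function [x^(r+1) / (r+1)], obtained from the mean
    value theorem. *)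
Lemma powR_convex (R : realType) (r a b : R) : 0 < r -> 0 <= a -> 0 <= b ->
  a `^ r * (b - a) <= (r + 1)^-1 * (b `^ (r + 1) - a `^ (r + 1)).
Proof.
move=> r0 a0 b0; have r10 : 0 < r + 1 by rewrite addr_gt0.
have r11 : 1 < r + 1 by rewrite ltrDr.
rewrite ler_pdivlMl//; have [ab|/ltW ba] := leP a b.
  have [c /andP[ac cb] ->] := powR_MVT r11 a0 ab; rewrite addrK.
  rewrite mulrA; apply: ler_wpM2r; first by rewrite subr_ge0.
  by apply: ler_wpM2l; [exact: ltW|apply: ler_powRl => //; exact: ltW].
have [c /andP[bc ca] E] := powR_MVT r11 b0 ba; rewrite addrK in E.
rewrite -[leRHS]opprB E -[b - a]opprB mulrN mulrN lerN2 mulrA.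
apply: ler_wpM2r; first by rewrite subr_ge0.
apply: ler_wpM2l; first exact: ltW.
by apply: ler_powRl => //; [exact: ltW|exact: le_trans bc].
Qed.

Lemma powR_lipschitz (R : realType) (r U a b : R) : 1 < r -> 0 <= a <= U -> 0 <= b <= U ->
  `|b `^ r - a `^ r| <= r * U `^ (r - 1) * `|b - a|.
Proof.
move=> r1 /andP[a0 aU] /andP[b0 bU]; have r0 : 0 < r by apply: lt_trans r1.
have [c [c0 _ cm ->]] := powR_MVT_sym r1 a0 b0.
rewrite normrM; apply: ler_wpM2r => //.
rewrite ger0_norm; last by rewrite mulr_ge0 ?powR_ge0// ltW.
apply: ler_wpM2l; first exact: ltW.
apply: ler_powRl => //; first by rewrite subr_ge0 ltW.
by apply: le_trans cm _; rewrite ge_max aU.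
Qed.

Lemma find_step (R : realDomainType) (tau : nat -> R) (N : nat) (s : R) : tau 0%N < s ->
  s <= tau N -> exists2 j, (j < N)%N & tau j < s <= tau j.+1.
Proof.
elim: N => [|N ih] s0 sN; first by move: (lt_le_trans s0 sN); rewrite ltxx.
have [h|h] := leP s (tau N); last by exists N; rewrite ?h.
by have [j jN hj] := ih s0 h; exists j => //; rewrite ltnS ltnW.
Qed.

Section energy.
Context (R : realType) (n : nat).
Let V := 'rV[R]_n.
Local Notation mu := (@lebesgue_rV R n).
Local Notation lambda := (@lebesgue_measure R).
Variable Omega : set V.
Hypotheses (oO : open Omega) (bO : bounded_set Omega).

Let mO : measurable Omega. Proof. exact: open_measurable_rV. Qed.

Let icst (c : R) : mu.-integrable Omega (EFin \o (fun=> c)).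
Proof. by apply: (finite_bounded_integrable oO bO (C := `|c|)). Qed.

Lemma continuous_Rintegral_uniform (T C : R) (F : R -> V -> R) :
  (forall t, 0 <= t <= T -> measurable_fun Omega (F t)) ->
  (forall t x, 0 <= t <= T -> `|F t x| <= C) ->
  (forall e, 0 < e -> exists2 d : R, 0 < d & forall s t x, 0 <= s <= T -> 0 <= t <= T ->
    `|s - t| < d -> `|F s x - F t x| <= e) ->
  {within `[0, T], continuous (fun t => \int[mu]_(x in Omega) F t x)}.
Proof.
move=> mF FC hF; apply/subspace_continuousP => t tT; apply/cvgrPdist_le => e e0.
have m0 : 0 <= fine (mu Omega) by rewrite fine_ge0.
have m1 : 0 < fine (mu Omega) + 1 by rewrite ltr_wpDl.
have [d d0 hd] := hF _ (divr_gt0 e0 m1).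
rewrite near_withinE; apply/nbhs_ballP; exists d => //= s ts sT.
have tT' : 0 <= t <= T by move: tT; rewrite /= in_itv.
have sT' : 0 <= s <= T by move: sT; rewrite /= in_itv.
have iF r : 0 <= r <= T -> mu.-integrable Omega (EFin \o F r).
  by move=> rT; exact: (finite_bounded_integrable oO bO (mF r rT) (fun x _ => FC r x rT)).
rewrite -(RintegralB mO (iF t tT') (iF s sT')).
apply: (@le_trans _ _ (\int[mu]_(x in Omega) (e / (fine (mu Omega) + 1)))).
  apply: (Rintegral_le_bound mO (integrableB_EFin mO (iF t tT') (iF s sT')) (icst _)).
  by move=> x _; apply: hd.
rewrite (Rintegral_cst mu mO) -mulrA; apply: ler_piMr; first exact: ltW.
by rewrite ler_pdivrMl// mulr1 lerDl.
Qed.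

Variables (p q r T : R).
Hypotheses (p2 : 2 < p) (q0 : 0 < q) (r1 : 1 < r) (T0 : 0 < T).
Variable u : R -> V -> R.
Hypothesis cu : {within [set z : R * V | 0 <= z.1 /\ closure Omega z.2],
  continuous (fun z : R * V => u z.1 z.2)}.
Hypothesis u0 : forall t x, 0 <= t -> closure Omega x -> 0 <= u t x.
Hypothesis uO : forall t x, 0 <= t -> boundary Omega x -> u t x = 0.

Let r0 : 0 < r. Proof. exact: lt_trans r1. Qed.
Let r10 : 0 < r + 1. Proof. by rewrite addr_gt0. Qed.

Definition energy t : R := \int[mu]_(x in Omega) (zext Omega u t x `^ (r + 1)).

Let w t := zext Omega u t.

Let mw t : 0 <= t -> measurable_fun Omega (w t).
Proof.
by move=> t0; apply: measurable_funTS; apply: continuous_measurable_rV; exact: zext_continuous.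
Qed.

Let mwpow t s : 0 <= t -> measurable_fun Omega (fun x => w t x `^ s).
Proof. by move=> t0; apply: (measurableT_comp (measurable_powR s)); exact: mw. Qed.

Lemma energy_continuous : {within `[0, T], continuous energy}.
Proof.
have [U U0 hU] := zext_bound bO cu T.
have w0 t x : 0 <= t <= T -> 0 <= w t x by move=> /andP[t0 _]; exact: zext_ge0.
apply: (continuous_Rintegral_uniform (C := U `^ (r + 1)) (F := fun t x => w t x `^ (r + 1))).
- by move=> t /andP[t0 _]; exact: mwpow.
- move=> t x tT; rewrite ger0_norm ?powR_ge0//.
  by apply: ler_powRl; [exact: ltW|exact: w0|exact: hU].
move=> e e0; pose c := (r + 1) * U `^ r + 1.
have c0 : 0 < c by rewrite ltr_wpDl// mulr_ge0 ?powR_ge0// ltW.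
have [d d0 hd] := zext_uniform bO cu T (divr_gt0 e0 c0).
exists d => // s t x sT tT st.
have := @powR_lipschitz R (r + 1) U (w t x) (w s x); rewrite addrK => h.
apply: le_trans (h _ _ _) _; rewrite ?ltrDr ?w0 ?hU//.
apply: (@le_trans _ _ (c * (e / c))); last by rewrite mulrC divfK// gt_eqF.
apply: ler_pM; rewrite ?mulr_ge0 ?powR_ge0 ?(ltW r10)//; first by rewrite lerDl.
exact: hd.
Qed.

Lemma pairing_continuous phi : test_function Omega phi ->
  {within `[0, T], continuous (fun t => \int[mu]_(x in Omega) (w t x * phi x))}.
Proof.
move=> tphi; have [mphi [D hD] _] := smooth_kernel_bmb (test_smooth_kernel bO tphi).
have [U U0 hU] := zext_bound bO cu T.
have w0 t x : 0 <= t <= T -> 0 <= w t x by move=> /andP[t0 _]; exact: zext_ge0.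
apply: (continuous_Rintegral_uniform (C := U * D) (F := fun t x => w t x * phi x)).
- by move=> t /andP[t0 _]; apply: measurable_funM; [exact: mw|exact: measurable_funTS].
- move=> t x tT; rewrite normrM; apply: ler_pM => //.
  by rewrite ger0_norm; [exact: hU|exact: w0].
move=> e e0; have D0 : 0 <= D by apply: le_trans (hD 0).
have D1 : 0 < D + 1 by rewrite ltr_wpDl.
have [d d0 hd] := zext_uniform bO cu T (divr_gt0 e0 D1).
exists d => // s t x sT tT st; rewrite -mulrBl normrM.
apply: (@le_trans _ _ (e / (D + 1) * (D + 1))); last by rewrite divfK// gt_eqF.
apply: ler_pM => //; first exact: hd.
by apply: le_trans (hD x) _; rewrite lerDl.
Qed.

(** [powR_convex] integrated over Omega. Replacing [w s ^ r] by [phi] costs at most [eta * U] at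
    each point, because both values of [w] lie in [[0, U]]. *)
Lemma energy_step (U eta : R) (phi : V -> R) (s t : R) : test_function Omega phi ->
  0 <= s <= T -> 0 <= t <= T -> (forall s x, 0 <= s <= T -> w s x <= U) ->
  (forall x, `|phi x - w s x `^ r| <= eta) ->
  (\int[mu]_(x in Omega) (w t x * phi x)) - (\int[mu]_(x in Omega) (w s x * phi x)) -
    eta * U * fine (mu Omega) <= (r + 1)^-1 * (energy t - energy s).
Proof.
move=> tphi sT tT hU hphi.
have [mphi [D hD] _] := smooth_kernel_bmb (test_smooth_kernel bO tphi).
have w0 t' x : 0 <= t' <= T -> 0 <= w t' x by move=> /andP[t0 _]; exact: zext_ge0.
have wU t' x : 0 <= t' <= T -> `|w t' x| <= U.
  by move=> h; rewrite ger0_norm; [exact: hU|exact: w0].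
have ip t' : 0 <= t' <= T -> mu.-integrable Omega (EFin \o (fun x => w t' x * phi x)).
  move=> h; apply: (finite_bounded_integrable oO bO (C := U * D)).
    by apply: measurable_funM; [apply: mw; case/andP: h|exact: measurable_funTS].
  by move=> x _; rewrite normrM; apply: ler_pM => //; exact: wU.
have ie t' : 0 <= t' <= T -> mu.-integrable Omega (EFin \o (fun x => w t' x `^ (r + 1))).
  move=> h; apply: (finite_bounded_integrable oO bO (C := U `^ (r + 1))).
    by apply: mwpow; case/andP: h.
  move=> x _; rewrite ger0_norm ?powR_ge0//.
  by apply: ler_powRl; [exact: ltW|exact: w0|exact: hU].
rewrite /energy -(RintegralB mO (ie t tT) (ie s sT)).
rewrite -(RintegralZl _ mO (integrableB_EFin mO (ie t tT) (ie s sT))).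
rewrite -(RintegralB mO (ip t tT) (ip s sT)) -(Rintegral_cst mu mO).
have i1 := integrableB_EFin mO (ip t tT) (ip s sT).
rewrite -(RintegralB mO i1 (icst _)).
apply: le_Rintegral => //.
- exact: integrableB_EFin.
- by apply: integrableZl_EFin => //; apply: integrableB_EFin => //; exact: ie.
move=> x _ /=; apply: le_trans (powR_convex r0 (w0 s x sT) (w0 t x tT)).
have h1 : `|(phi x - w s x `^ r) * (w t x - w s x)| <= eta * U.
  rewrite normrM; apply: ler_pM => //.
  rewrite ler_norml; have := w0 s x sT; have := w0 t x tT; have := hU s x sT; have := hU t x tT.
  by move: (w t x) (w s x) => a b; lra.
move: (w t x) (w s x) (w s x `^ r) (phi x) h1 => a b c f.
by rewrite ler_norml => /andP[_ h]; lra.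
Qed.

End energy.

Lemma hk_partition_end (R : realType) (a b : R) m : a + m.+1%:R * ((b - a) * hk R m) = b.
Proof.
rewrite /hk; have : m.+1%:R != 0 :> R by rewrite pnatr_eq0.
by move: (m.+1%:R) => k k0; field.
Qed.

(** A tolerance equal to the square of [hk R m] at each of the [m + 1] steps leaves a total error of
    order [hk R m]. *)
Lemma hk_sqr (R : realType) m : m.+1%:R * (hk R m * hk R m) = hk R m.
Proof.
rewrite /hk; have : m.+1%:R != 0 :> R by rewrite pnatr_eq0.
by move: (m.+1%:R) => k k0; field.
Qed.

(** * Summation over a partition of the time interval *)

Section energy_growth.
Context (R : realType) (n : nat).
Let V := 'rV[R]_n.
Local Notation mu := (@lebesgue_rV R n).
Local Notation lambda := (@lebesgue_measure R).
Variable Omega : set V.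
Hypotheses (oO : open Omega) (bO : bounded_set Omega).
Variables (p q r T : R).
Hypotheses (p2 : 2 < p) (q0 : 0 < q) (r1 : 1 < r) (T0 : 0 < T).
Variable u : R -> V -> R.
Hypothesis cu : {within [set z : R * V | 0 <= z.1 /\ closure Omega z.2],
  continuous (fun z : R * V => u z.1 z.2)}.
Hypothesis u0 : forall t x, 0 <= t -> closure Omega x -> 0 <= u t x.
Hypothesis uO : forall t x, 0 <= t -> boundary Omega x -> u t x = 0.
Hypothesis W : in_Linfty_W1infty Omega T u.
Hypothesis Hid : forall psi, test_function Omega psi ->
  forall theta : R -> R, test_function `]0, T[%classic theta ->
    - (\int[lambda]_(t in `]0, T[%classic)
         (derive1 theta t * (\int[mu]_(x in Omega) (u t x * psi x)))) =
    \int[lambda]_(t in `]0, T[%classic)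
        (theta t * (\int[mu]_(x in Omega) weak_rhs Omega p q (u t) psi x)).

Let mO : measurable Omega. Proof. exact: open_measurable_rV. Qed.
Let r0 : 0 < r. Proof. exact: lt_trans r1. Qed.
Let w t := zext Omega u t.

Let Ew s phi : weak_rhs Omega p q (u s) phi = weak_rhs Omega p q (w s) phi.
Proof. by apply/funext => x; rewrite /weak_rhs /w /zext weak_gradient_patch. Qed.

Lemma zext_powR_continuous t : 0 <= t <= T -> continuous (fun x => w t x `^ r).
Proof.
move=> tT x; have [U U0 hU] := zext_bound bO cu T; have [t0 _] := andP tT.
have w0 y : 0 <= w t y by exact: zext_ge0.
apply/(@cvgrPdist_le R R _ _ (nbhs_filter (x : V)) (fun x => w t x `^ r)) => e e0.
have c0 : 0 < r * U `^ (r - 1) + 1 by rewrite ltr_wpDl// mulr_ge0 ?powR_ge0// ltW.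
have /(@cvgrPdist_le R R _ _ (nbhs_filter (x : V)) (w t)) := zext_continuous oO cu uO t0 (x := x).
move=> /(_ _ (divr_gt0 e0 c0)); apply: filterS => y hy.
apply: le_trans (@powR_lipschitz R r U _ _ r1 _ _) _; rewrite ?w0 ?hU//.
apply: (@le_trans _ _ ((r * U `^ (r - 1) + 1) * (e / (r * U `^ (r - 1) + 1)))).
  by apply: ler_pM => //; [rewrite mulr_ge0 ?powR_ge0// ltW|rewrite lerDl].
by rewrite mulrC divfK// gt_eqF.
Qed.

(** [time_increment] for the pairing of the solution with a fixed test function. The uniform bound
    is returned as well, to dominate the step integrands when the partition is refined. *)
Lemma pairing_increment (M C D : R) (S : set R) (phi : V -> R) (t1 t2 : R) :
  measurable (S : set (measurableTypeR R)) -> S `<=` `]0, T[%classic ->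
  {ae lambda, forall t : R, `]0, T[%classic t -> S t} ->
  (forall t, S t -> exists G : V -> V, [/\ forall i, measurable_fun Omega (fun x => G x ord0 i),
        forall x, enorm (G x) <= M & is_weak_gradient Omega (w t) G]) ->
  (forall phi, test_function Omega phi -> measurable_fun (S : set (measurableTypeR R))
        (fun t => \int[mu]_(x in Omega) weak_rhs Omega p q (u t) phi x)) ->
  test_function Omega phi -> (forall i x, `|partial i phi x| <= C) -> (forall x, `|phi x| <= D) ->
  0 < t1 -> t1 <= t2 -> t2 < T ->
  (forall t, S t -> `|\int[mu]_(x in Omega) weak_rhs Omega p q (u t) phi x| <=
      (M `^ (p - 2) * (M * C *+ n) + M `^ q * D) * fine (mu Omega)) /\
  (\int[mu]_(x in Omega) (w t2 x * phi x)) - (\int[mu]_(x in Omega) (w t1 x * phi x)) =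
  \int[lambda]_(t in S `&` `]t1, t2]) (\int[mu]_(x in Omega) weak_rhs Omega p q (u t) phi x).
Proof.
move=> mS ST aeS hG mA tphi hC hD t10 t12 t2T.
have bd t : S t -> `|\int[mu]_(x in Omega) weak_rhs Omega p q (u t) phi x| <=
      (M `^ (p - 2) * (M * C *+ n) + M `^ q * D) * fine (mu Omega).
  move=> /hG[G [mG GM wG]]; rewrite Ew.
  exact: (Rintegral_weak_rhs_le oO bO mG GM wG p2 q0 tphi hC hD).
split=> //.
apply: (@time_increment R T (fun t => \int[mu]_(x in Omega) (w t x * phi x)) _ S _ t1 t2
  mS ST aeS (mA _ tphi) bd) => //.
  exact: pairing_continuous.
move=> theta ttheta; rewrite -(Hid tphi ttheta); congr (- _).
apply: eq_Rintegral => t _; congr (_ * _); apply: eq_Rintegral => x /set_mem Ox.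
by rewrite /w zextE.
Qed.

(** Summing [energy_step] over a partition telescopes on the energy side; the other side is an
    integral in time of right-hand sides with test functions frozen at the left nodes. As the mesh
    tends to 0 these integrands tend to the dissipation at each good time, under a common bound. *)
Lemma energy_growth (t1 t2 beta : R) : 0 < t1 -> t1 < t2 -> t2 < T ->
  (forall s M (G : V -> V), t1 <= s <= t2 -> coord_lipschitz M (w s) ->
     (forall i, measurable_fun Omega (fun x => G x ord0 i)) ->
     (forall x, enorm (G x) <= M) -> is_weak_gradient Omega (w s) G ->
     beta <= dissipation Omega (w s) G p q r) ->
  beta * (t2 - t1) <= (r + 1)^-1 * (energy Omega r u t2 - energy Omega r u t1).
Proof.
move=> t10 t12 t2T hbeta; have t120 : 0 < t2 - t1 by rewrite subr_gt0.
have [M [S [M0 mS ST aeS [lip hG mA]]]] := good_times oO bO p2 q0 T0 cu u0 uO W.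
have [U U0 hU] := zext_bound bO cu T.
have w0 t x : 0 <= t <= T -> 0 <= w t x by move=> /andP[t0 _]; exact: zext_ge0.
(* A coordinate Lipschitz constant of [w t ^ r] valid for every time of [[0, T]], hence a gradient
   bound common to all the approximations. *)
pose C := r * U `^ (r - 1) * M.
(* One approximation for each pair (time, tolerance). The conditions on the pair are placed under
   the existential, so that [choice] gives a total function. *)
have approx (z : R * R) : exists phi : V -> R, 0 <= z.1 <= T -> 0 < z.2 ->
    [/\ test_function Omega phi, forall x, `|phi x - w z.1 x `^ r| <= z.2 &
      forall i x, `|partial i phi x| <= C].
  have [zT|] := pselect (0 <= z.1 <= T /\ 0 < z.2); last by exists (fun=> 0) => h1 h2; case: b.
  have [zT1 z2] := zT.
  have [||||phi hphi] := @lipschitz_approx R n Omega (fun x => w z.1 x `^ r) C oO bO _ _ _ _ _ z2.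
  - exact: zext_powR_continuous.
  - by move=> x; exact: powR_ge0.
  - by move=> x nO; rewrite /w zext_out// powR0// gt_eqF.
  - exact: (powR_coord_lipschitz (fun x => w0 z.1 x zT1) (lip _ zT1) (fun x => hU z.1 x zT1) r1).
  by exists phi.
have [Phi hPhi] := choice approx.
pose h m : R := (t2 - t1) * hk R m.
pose tau m (j : nat) : R := t1 + j%:R * h m.
have h0 m : 0 < h m by rewrite mulr_gt0// hk_gt0.
have tau0 m : tau m 0%N = t1 by rewrite /tau mul0r addr0.
have tauN m : tau m m.+1 = t2.
  exact: hk_partition_end.
have tauS m j : tau m j.+1 = tau m j + h m by rewrite /tau -natr1 mulrDl mul1r addrA.
have tau_le m i j : (i <= j)%N -> tau m i <= tau m j.
  by move=> ij; rewrite lerD2l ler_wpM2r ?ler_nat// ltW.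
have tau1 m j : t1 <= tau m j by rewrite -(tau0 m) tau_le.
have tau2 m j : (j <= m.+1)%N -> tau m j <= t2 by move=> jm; rewrite -(tauN m) tau_le.
have tauT m j : (j <= m.+1)%N -> 0 <= tau m j <= T.
  move=> jm; rewrite (le_trans (ltW t10) (tau1 m j))/=.
  exact: le_trans (tau2 m j jm) (ltW t2T).
(* Quadratic in the mesh, so that the errors of the [m + 1] steps add up to a quantity tending to
   0. *)
pose eta m := hk R m * hk R m.
have eta0 m : 0 < eta m by rewrite mulr_gt0 ?hk_gt0.
have eta1 m : eta m <= hk R m by rewrite ler_piMr ?hk_le1// ltW ?hk_gt0.
pose ph m j := Phi (tau m j, eta m).
have phP m j : (j <= m.+1)%N -> [/\ test_function Omega (ph m j),
    forall x, `|ph m j x - w (tau m j) x `^ r| <= eta m &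
    forall i x, `|partial i (ph m j) x| <= C].
  by move=> jm; apply: (hPhi (tau m j, eta m)); [exact: tauT|exact: eta0].
pose B := U `^ r + 1.
have phB m j x : (j <= m.+1)%N -> `|ph m j x| <= B.
  move=> jm; have [_ hp _] := phP m j jm.
  rewrite -(subrK (w (tau m j) x `^ r) (ph m j x)) addrC; apply: le_trans (ler_normD _ _) _.
  apply: lerD; last first.
    by apply: le_trans (hp x) _; apply: le_trans (eta1 m) _; exact: hk_le1.
  rewrite ger0_norm ?powR_ge0//.
  by apply: ler_powRl; [exact: ltW|apply: w0; exact: tauT|apply: hU; exact: tauT].
pose A m j s := \int[mu]_(x in Omega) weak_rhs Omega p q (u s) (ph m j) x.
pose K := (M `^ (p - 2) * (M * C *+ n) + M `^ q * B) * fine (mu Omega).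
have incr m j : (j < m.+1)%N -> (forall t, S t -> `|A m j t| <= K) /\
  (\int[mu]_(x in Omega) (w (tau m j.+1) x * ph m j x)) -
  (\int[mu]_(x in Omega) (w (tau m j) x * ph m j x)) =
  \int[lambda]_(t in S `&` `]tau m j, tau m j.+1]) A m j t.
  move=> jm; have [tp _ hC] := phP m j (ltnW jm).
  apply: (pairing_increment mS ST aeS hG mA tp hC (fun x => phB m j x (ltnW jm))).
  - exact: lt_le_trans (tau1 _ _).
  - exact: tau_le.
  - exact: le_lt_trans (tau2 _ _ jm) t2T.
have mI a b : measurable (`]a, b]%classic : set (measurableTypeR R)) by exact: measurable_itv.
pose DD := S `&` `]t1, t2]%classic.
have mDD : measurable (DD : set (measurableTypeR R)) by exact: measurableI.
have finI : (lambda [set` `]t1, t2]] < +oo)%E.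
  by rewrite lebesgue_measure_itv /= lte_fin t12 -EFinB ltry.
have finDD : (lambda DD < +oo)%E.
  apply: le_lt_trans finI; apply: le_measure; rewrite ?inE; [exact: mDD|exact: mI|by move=> s []].
have mAj m j : (j < m.+1)%N -> measurable_fun (DD : set (measurableTypeR R)) (A m j).
  move=> jm; have [tp _ _] := phP m j (ltnW jm).
  by apply: (measurable_funS mS _ (mA _ tp)); exact: subIsetl.
(* Each increment is cut off to its own step, so the sum over [j] is a single integrand on []t1,
   t2]] and dominated convergence can be applied to it. *)
pose f m j s := \1_(`]tau m j, tau m j.+1]%classic) s * A m j s.
have mf m j : (j < m.+1)%N -> measurable_fun (DD : set (measurableTypeR R)) (f m j).
  move=> jm; apply: measurable_funM; last exact: mAj.
  by apply: measurable_funTS; apply: measurable_indic; exact: mI.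
have K0 m j : (j < m.+1)%N -> forall s, DD s -> `|f m j s| <= K.
  move=> jm s [Ss _]; have hA := (incr m j jm).1 s Ss.
  rewrite /f indicE; case: (_ \in _); rewrite ?mul1r// mul0r normr0.
  exact: le_trans hA.
have if_ m (j : 'I_m.+1) : lambda.-integrable DD (EFin \o f m j).
  exact: (bounded_integrable mDD finDD (mf m j (ltn_ord j)) (K0 m j (ltn_ord j))).
have IS m : \int[lambda]_(s in DD) (\sum_(j < m.+1) f m j s) =
    \sum_(j < m.+1) \int[lambda]_(s in S `&` `]tau m j, tau m j.+1]) A m j s.
  rewrite (Rintegral_sum _ mDD (if_ m)); apply: eq_bigr => j _.
  rewrite (@Rintegral_support R _ _ lambda DD (S `&` `]tau m j, tau m j.+1]%classic) (f m j)).
  - by apply: eq_Rintegral => s /set_mem[_ Js]; rewrite /f indicE mem_set// mul1r.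
  - move=> s [Ss]; rewrite /= in_itv /= => /andP[h1 h2]; split => //.
    rewrite /= in_itv /= (le_lt_trans (tau1 _ _) h1)/=.
    exact: le_trans h2 (tau2 _ _ _).
  - move=> s [Ss _] nJ; rewrite /f indicE memNset ?mul0r// => Js.
    by apply: nJ; split.
have low m : \int[lambda]_(s in DD) (\sum_(j < m.+1) f m j s) - hk R m * (U * fine (mu Omega)) <=
    (r + 1)^-1 * (energy Omega r u t2 - energy Omega r u t1).
  have st (j : 'I_m.+1) := energy_step oO bO r1 cu u0 uO (let: And3 h1 _ _ := phP m j (ltnW (ltn_ord j)) in h1)
    (tauT m j (ltnW (ltn_ord j))) (tauT m j.+1 (ltn_ord j)) (fun s x => hU s x)
    (let: And3 _ h2 _ := phP m j (ltnW (ltn_ord j)) in h2).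
  have := @ler_sum R _ (index_enum 'I_m.+1) xpredT _ _ (fun j _ => st j).
  rewrite -mulr_sumr -(big_mkord xpredT (fun j => energy Omega r u (tau m j.+1) -
    energy Omega r u (tau m j))) telescope_sumr// tauN tau0; apply: le_trans.
  rewrite sumrB lerB//; last first.
    rewrite sumr_const card_ord -[_ *+ _]mulr_natl.
    have -> : m.+1%:R * (eta m * U * fine (mu Omega)) =
        m.+1%:R * eta m * (U * fine (mu Omega)) by ring.
    by rewrite /eta hk_sqr.
  by rewrite IS; apply: ler_sum => j _; rewrite -(incr m j (ltn_ord j)).2.
have hGs s : exists G : V -> V, S s -> [/\ forall i, measurable_fun Omega (fun x => G x ord0 i),
     forall x, enorm (G x) <= M & is_weak_gradient Omega (w s) G].
  have [/hG[G HG]|nS] := pselect (S s); [by exists G|by exists (fun=> 0)].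
have {hGs}[Gs hGs] := choice hGs.
(* Each time [s] lies in exactly one step []tau j, tau (j+1)]], and only that term of the sum
   survives. *)
have sel m s : DD s -> exists j, [/\ (j < m.+1)%N, tau m j < s <= tau m j.+1 &
    \sum_(j < m.+1) f m j s = A m j s].
  move=> [Ss]; rewrite /= in_itv /= => /andP[s1 s2].
  have [||j jm /andP[hj1 hj2]] := @find_step R (tau m) m.+1 s; rewrite ?tau0 ?tauN//.
  exists j; split; rewrite ?hj1//.
  rewrite (bigD1 (Ordinal jm))//= big1 => [|i inj].
    by rewrite addr0 /f indicE mem_set ?mul1r//= in_itv /= hj1.
  rewrite /f indicE memNset ?mul0r//= in_itv /= => /andP[hi1 hi2].
  have := inj; rewrite -val_eqE /= neq_ltn => /orP[ij|ji].
    by have := tau_le m _ _ ij; rewrite leNgt (lt_le_trans hj1 hi2).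
  by have := tau_le m _ _ ji; rewrite leNgt (lt_le_trans hi1 hj2).
have lim s : DD s -> (\sum_(j < m.+1) f m j s) @[m --> \oo] -->
    dissipation Omega (w s) (Gs s) p q r.
  move=> Ds; have [Ss s12] := Ds; have [mG GM wG] := hGs s Ss.
  have sT : 0 <= s <= T by have := ST _ Ss; rewrite /= in_itv /= => /andP[/ltW -> /ltW ->].
  have s0 : 0 <= s by case/andP: sT.
  have [jm hjm] := choice (fun m => sel m s Ds).
  have jle m : (jm m <= m.+1)%N by have [/ltnW] := hjm m.
  have H : \int[mu]_(x in Omega) weak_rhs Omega p q (w s) (ph m (jm m)) x @[m --> \oo] -->
      dissipation Omega (w s) (Gs s) p q r.
    apply: (Rintegral_weak_rhs_cvg oO bO (zext_continuous oO cu uO s0)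
      (fun x => w0 s x sT) (fun x => @zext_out _ _ _ u s x) (lip s sT) mG GM wG
      (fun x => hU s x sT) r1 (fun m => let: And3 h _ _ := phP m _ (jle m) in h) _
      (fun m x => phB m _ x (jle m)) (fun m => let: And3 _ _ h := phP m _ (jle m) in h) p2 q0).
    move=> e e0; have e2 : 0 < e / 2 by rewrite divr_gt0.
    have c0 : 0 < r * U `^ (r - 1) + 1 by rewrite ltr_wpDl// mulr_ge0 ?powR_ge0// ltW.
    have [d d0 hd] := zext_uniform bO cu T (divr_gt0 e2 c0).
    have d' : 0 < d / (t2 - t1) by rewrite divr_gt0.
    have /cvgr0Pnorm_lt/(_ _ d') H1 := @hk_cvg0 R.
    have /cvgr0Pnorm_le/(_ _ e2) H2 := @hk_cvg0 R.
    move: H1 H2; apply: filterS2 => m; rewrite gtr0_norm ?hk_gt0// => H1 H2 x.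
    have [_ hp _] := phP m _ (jle m); have [_ /andP[a1 a2] _] := hjm m.
    rewrite -(subrKA (w (tau m (jm m)) x `^ r)) (splitr e); apply: le_trans (ler_normD _ _) _.
    apply: lerD; first by apply: le_trans (hp x) _; apply: le_trans (eta1 m) H2.
    have tT := tauT m _ (jle m).
    apply: le_trans (@powR_lipschitz R r U _ _ r1 _ _) _; rewrite ?w0 ?hU//.
    apply: (@le_trans _ _ ((r * U `^ (r - 1) + 1) * (e / 2 / (r * U `^ (r - 1) + 1)))); last first.
      by rewrite mulrC divfK// gt_eqF.
    apply: ler_pM => //; first by rewrite mulr_ge0 ?powR_ge0// ltW.
      by rewrite lerDl.
    apply: hd => //; rewrite distrC gtr0_norm ?subr_gt0//.
    rewrite ltr_pdivlMr// mulrC in H1; move: a2; rewrite tauS /h; move: H1.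
    by move: ((t2 - t1) * hk R m) (tau _ _) => y z; lra.
  apply: cvg_trans H; apply: near_eq_cvg; apply: nearW => m.
  by have [_ _ ->] := hjm m; rewrite /A Ew.
have bdK m s : DD s -> `|\sum_(j < m.+1) f m j s| <= K.
  move=> Ds; have [j [jm _ ->]] := sel m s Ds; have [Ss _] := Ds.
  exact: (incr m j jm).1.
have [idis cdis] := @Rintegral_dominated_cvg _ _ R lambda DD (fun m s => \sum_(j < m.+1) f m j s)
  (fun s => dissipation Omega (w s) (Gs s) p q r) (fun=> K) mDD
  (fun m => measurable_sum _ (fun j : 'I_m.+1 => mf m j (ltn_ord j))) lim
  (bounded_integrable mDD finDD (@measurable_cst _ _ _ _ _ K) (fun _ _ => lexx `|K|)) bdK.
apply: (@le_trans _ _ (\int[lambda]_(s in DD) dissipation Omega (w s) (Gs s) p q r)).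
  have ib : lambda.-integrable DD (EFin \o (fun=> beta)).
    exact: (bounded_integrable mDD finDD (@measurable_cst _ _ _ _ _ beta) (fun _ _ => lexx `|beta|)).
  have -> : beta * (t2 - t1) = \int[lambda]_(s in DD) beta.
    rewrite Rintegral_cst//; congr (_ * _).
    (* [S] fills []t1, t2]] up to a null set, so [DD] has the full length [t2 - t1]. *)
    have E : lambda DD = lambda [set` `]t1, t2]].
      have [Z [mZ Z0 SZ]] := aeS; have mDZ := measurableU _ _ mDD mZ.
      apply/eqP; rewrite eq_le; apply/andP; split.
        by apply: le_measure; rewrite ?inE; [exact: mDD|exact: mI|by move=> s []].
      rewrite -(measureU0 mDD mZ Z0); apply: le_measure; rewrite ?inE; [exact: mI|exact: mDZ|].
      move=> s s12; have [Ss|nS] := pselect (S s); [by left|right; apply: SZ => /= h1].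
      apply/nS/h1; move: s12; rewrite /= !in_itv /= => /andP[s1 s2].
      by rewrite (lt_trans t10 s1) (le_lt_trans s2 t2T).
    rewrite lebesgue_measure_itv /= lte_fin t12 -EFinB in E.
    by apply: (@etrans _ _ (fine (t2 - t1)%:E)) => //; congr fine; exact: esym E.
  apply: (le_Rintegral mDD ib idis) => s [Ss]; rewrite /= in_itv /= => /andP[s1 s2].
  have [mG GM wG] := hGs s Ss; apply: (hbeta s M) => //; first by rewrite (ltW s1).
  by apply: lip; have := ST _ Ss; rewrite /= in_itv /= => /andP[/ltW -> /ltW ->].
have lim2 : \int[lambda]_(s in DD) (\sum_(j < m.+1) f m j s) - hk R m * (U * fine (mu Omega))
    @[m --> \oo] --> \int[lambda]_(s in DD) dissipation Omega (w s) (Gs s) p q r - 0.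
  apply: cvgB; first exact: cdis.
  by rewrite -(mul0r (U * fine (mu Omega))); apply: cvgMl; exact: hk_cvg0.
rewrite subr0 in lim2; apply: (cvgr_to_le lim2); apply: nearW => m; exact: low.
Qed.

End energy_growth.

(** * Blow-up for superlinear differential inequalities *)

Section blowup.
Context (R : realType).
Variables (alpha c C : R) (y : R -> R).
Hypotheses (alpha0 : 0 < alpha) (c0 : 0 < c) (C0 : 0 <= C).
Hypothesis cy : forall T, 0 < T -> {within `[0, T], continuous y}.
Hypothesis growth : forall t1 t2 v, 0 < t1 -> t1 < t2 -> 0 < v ->
  (forall s, t1 <= s <= t2 -> v <= y s) ->
  (c * v `^ alpha * v - C) * (t2 - t1) <= y t2 - y t1.

(** Above this level the loss [C] is at most half of the gain: [v >= 1] gives [v^alpha >= 1], and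
    [v >= 2 C / c] gives [c v >= 2 C]. *)
Let b := 1 + 2 * C / c.

Let b1 : 1 <= b.
Proof. by rewrite lerDl divr_ge0 ?mulr_ge0// ltW. Qed.

Let one_powR : 1 `^ alpha = 1 :> R.
Proof. by rewrite powR1. Qed.

Let c2 : 0 <= c / 2.
Proof. by rewrite divr_ge0// ltW. Qed.

Let growth' t1 t2 v : 0 < t1 -> t1 <= t2 -> b <= v ->
  (forall s, t1 <= s <= t2 -> v <= y s) ->
  c / 2 * v `^ alpha * v * (t2 - t1) <= y t2 - y t1.
Proof.
move=> t10; rewrite le_eqVlt => /predU1P[<-|t12] bv hv; first by rewrite !subrr mulr0.
have v1 : 1 <= v by apply: le_trans bv.
have v0 : 0 < v by apply: lt_le_trans v1.
apply: le_trans (growth t10 t12 v0 hv); apply: ler_wpM2r; first by rewrite subr_ge0 ltW.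
have p1 : 1 <= v `^ alpha.
  by rewrite -[leLHS]one_powR; apply: ler_powRl => //; exact: ltW.
have h1 : 2 * C <= c * v.
  rewrite -ler_pdivrMl// mulrC; apply: le_trans bv; by rewrite lerDr.
have h2 : c * v <= c * v `^ alpha * v.
  by rewrite mulrAC; apply: ler_peMr => //; rewrite mulr_ge0 ?ltW.
move: (v `^ alpha) h1 h2 => z; lra.
Qed.

Let near_y t e : 0 <= t -> 0 < e -> exists2 d : R, 0 < d &
  forall s, 0 <= s -> `|t - s| < d -> `|y t - y s| < e.
Proof.
move=> t0 e0; have t10 : 0 < t + 1 by rewrite ltr_wpDl.
have tT : `[0, t + 1]%classic t by rewrite /= in_itv /= t0 lerDl ler01.
have /subspace_continuousP/(_ _ tT)/cvgrPdist_lt/(_ _ e0) := cy t10.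
rewrite near_withinE => /nbhs_ballP[d /= d0 hd]; exists (Num.min d 1).
  by rewrite lt_min d0 ltr01.
move=> s s0; rewrite lt_min => /andP[h1 h2]; apply: hd => //=.
by rewrite in_itv /= s0; move: h2; rewrite ltr_norml; lra.
Qed.

(** Suppose [y] fell to [b], and let [tau] be the infimum of the times where [y <= b]. Up to just
    before [tau] the growth bound keeps [y] at least [2b], yet near [tau] there is a value at most
    [b], against continuity at [tau]. *)
Let above a t : 0 < a -> a <= t -> 2 * b <= y a -> b < y t.
Proof.
move=> a0 at_ ya; rewrite ltNge; apply/negP => yt.
have b0 : 0 < b by apply: lt_le_trans b1.
pose A : set R := [set s | a <= s <= t /\ y s <= b].
have At : A t by split => //; rewrite at_ lexx.
have hA : has_inf A by split; [exists t|exists a => s [/andP[]]].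
set tau := inf A.
have atau : a <= tau by apply: lb_le_inf; [exists t|move=> s [/andP[]]].
have [d d0 hd] := near_y (le_trans (ltW a0) atau) (divr_gt0 b0 (ltr0n R 2)).
have [s [/andP[as_ st] ys] sd] := inf_adherent d0 hA.
have taus : tau <= s by apply: ge_inf; [case: hA|split => //; rewrite as_].
have h1 : `|y tau - y s| < b / 2.
  by apply: hd; [exact: le_trans (ltW a0) as_|rewrite distrC ger0_norm ?subr_ge0//; move: sd; rewrite -/tau; lra].
pose s' := Num.max a (tau - d / 2).
have as' : a <= s' by rewrite /s' le_max lexx.
have s'tau : s' <= tau by rewrite /s' ge_max atau /=; lra.
have h2 : `|y tau - y s'| < b / 2.
  apply: hd; first exact: le_trans (ltW a0) as'.
  rewrite ger0_norm ?subr_ge0//; have : tau - d / 2 <= s' by rewrite /s' le_max lexx orbT.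
  lra.
have [E|ns] := eqVneq s' tau.
  have ta : tau = a.
    by move: E; rewrite /s'; case: leP => [h E|_ ->//]; move: h E; lra.
  move: h1; rewrite ta ltr_norml => /andP[_ h]; move: h ya ys b0; lra.
have s'lt : s' < tau by rewrite lt_neqAle ns.
have hb r : a <= r <= s' -> b <= y r.
  move=> /andP[ar rs]; rewrite leNgt; apply/negP => yr.
  suff : tau <= r by rewrite leNgt (le_lt_trans rs s'lt).
  apply: ge_inf; [by case: hA|split; last exact: ltW].
  by rewrite ar (le_trans rs)// (le_trans s'tau)// (le_trans taus).
have := growth' a0 as' (lexx b) hb.
have g0 : 0 <= c / 2 * b `^ alpha * b * (s' - a).
  rewrite mulr_ge0 ?subr_ge0// mulr_ge0 ?(ltW b0)// mulr_ge0 ?powR_ge0//.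
move: h1 h2; rewrite !ltr_norml => /andP[k1 k2] /andP[k3 k4] k5.
have : 2 * b <= y s' by move: g0 k5 ya; lra.
move: ys; lra.
Qed.

(** Let [y] attain its minimum over [[a, t]] at [m]. The minimum is at least [b], so the growth
    bound on [[a, m]] with [v = y m] gives [y m >= y a]. *)
Let monotone a t : 0 < a -> a <= t -> 2 * b <= y a -> y a <= y t.
Proof.
move=> a0 at_ ya.
have t0 : 0 < t by apply: lt_le_trans at_.
have ca : {within `[a, t], continuous y}.
  apply: continuous_subspaceW (cy t0) => s; rewrite /= !in_itv /= => /andP[h ->].
  by rewrite (le_trans (ltW a0) h).
have [m] := EVT_min at_ ca; rewrite in_itv /= => /andP[am mt] hm.
have hm' s : a <= s <= m -> y m <= y s.
  by move=> /andP[h1 h2]; apply: hm; rewrite in_itv /= h1 (le_trans h2).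
have bm : b <= y m by apply/ltW; exact: (above a0 am ya).
have := growth' a0 am bm hm'.
have m0 : 0 <= y m by apply: le_trans bm; apply: le_trans b1.
have g0 : 0 <= c / 2 * y m `^ alpha * y m * (m - a).
  rewrite mulr_ge0 ?subr_ge0// mulr_ge0// mulr_ge0 ?powR_ge0//.
have : y m <= y t by apply: hm; rewrite in_itv /= at_ lexx.
by move: g0; lra.
Qed.

(** Doubling times. From [y >= v = 2^k L], a time [2 / (c v^alpha)] suffices for a gain of [v];
    these durations form a geometric series of ratio [rho = 2^(-alpha)] and sum [K]. All times [t k]
    therefore stay in [[0, a + K]], where a continuous [y] is bounded, although
    [y (t k) >= 2^k L]. *)
Lemma superlinear_blowup : ~ 2 * b < y 0.
Proof.
move=> y0; have b0 : 0 < b by apply: lt_le_trans b1.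
have y0' : 0 < y 0 - 2 * b by rewrite subr_gt0.
have [d d0 hd] := near_y (lexx 0) y0'.
(* The growth bound is available at positive times only; continuity at 0 supplies a positive
   starting time where [y] is still at least [2b]. *)
pose a := d / 2; have a0 : 0 < a by rewrite divr_gt0.
have ya : 2 * b <= y a.
  have : `|y 0 - y a| < y 0 - 2 * b.
    by apply: hd; [exact: ltW|rewrite sub0r normrN gtr0_norm// /a; lra].
  by rewrite ltr_norml => /andP[_]; lra.
pose L := 2 * b; have L0 : 0 < L by rewrite mulr_gt0.
pose rho := (2 `^ alpha)^-1 : R.
have p1 : 1 < 2 `^ alpha :> R by rewrite -[ltLHS]one_powR; apply: gt0_ltr_powR; rewrite ?nnegrE ?ltr1n.
have p0 : 0 < 2 `^ alpha :> R by apply: lt_trans p1.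
have rho0 : 0 < rho by rewrite invr_gt0.
have rho1 : 0 < 1 - rho by rewrite subr_gt0 invf_lt1.
pose K := 2 / (c * L `^ alpha * (1 - rho)).
have La : 0 < L `^ alpha by rewrite powR_gt0.
have K0 : 0 < K by rewrite divr_gt0// !mulr_gt0.
pose t k := a + K * (1 - rho ^+ k).
have ta k : a <= t k.
  by rewrite lerDl mulr_ge0 ?subr_ge0 ?exprn_ile1 ?ltW//; move: rho1; rewrite subr_gt0.
have yt k : 2 ^+ k * L <= y (t k).
  elim: k => [|k ih]; first by rewrite expr0 mul1r /t expr0 subrr mulr0 addr0.
  have tk0 : 0 < t k by apply: lt_le_trans (ta k).
  have Lk : L <= 2 ^+ k * L by apply: ler_peMl; [exact: ltW|rewrite exprn_ege1// ler1n].
  have bt : 2 * b <= y (t k) by apply: le_trans ih.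
  have tt : t k.+1 - t k = K * (1 - rho) * rho ^+ k by rewrite /t exprS; ring.
  have tk : t k <= t k.+1.
    by rewrite -subr_ge0 tt mulr_ge0 ?exprn_ge0 ?(ltW rho0)// mulr_ge0 ?ltW.
  have bL : b <= 2 ^+ k * L by apply: le_trans Lk; rewrite /L; lra.
  have := growth' tk0 tk bL (fun s h => le_trans ih (monotone tk0 (andP h).1 bt)).
  have -> : c / 2 * (2 ^+ k * L) `^ alpha * (2 ^+ k * L) * (t k.+1 - t k) = 2 ^+ k * L.
    have -> : (2 ^+ k * L) `^ alpha = (2 `^ alpha) ^+ k * L `^ alpha.
      rewrite powRM ?exprn_ge0 ?ltW//; congr (_ * _).
      by rewrite -powR_mulrn// -powRrM mulrC powRrM powR_mulrn// ltW.
    have pk : (2 `^ alpha) ^+ k != 0 :> R by rewrite expf_neq0// gt_eqF.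
    have rk : rho ^+ k = ((2 `^ alpha) ^+ k)^-1 by rewrite /rho exprVn.
    rewrite tt /K rk; have := gt_eqF La; have := gt_eqF c0; have := gt_eqF rho1.
    move: (1 - rho) ((2 `^ alpha) ^+ k) pk (L `^ alpha) (2 ^+ k * L) => e P P0 Q z e0 cn Qn.
    by field; rewrite e0 cn Qn P0.
  rewrite exprS -mulrA; move: ih; move: (2 ^+ k * L) => z; lra.
have aK : 0 < a + K by rewrite addr_gt0.
have [m _ hm] := EVT_max (ltW aK) (cy aK).
have tK k : t k \in `[0, a + K]%R.
  rewrite in_itv /= (le_trans (ltW a0) (ta k)) lerD2l ger_pMr// gerBl.
  by rewrite exprn_ge0// ltW.
have [k hk] : exists k : nat, y m < 2 ^+ k * L.
  have ym : 0 <= `|y m| / L by rewrite divr_ge0// ltW.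
  exists (Num.bound (`|y m| / L)); rewrite -ltr_pdivrMr//.
  apply: le_lt_trans (_ : _ <= `|y m| / L) _.
    by apply: ler_wpM2r; [rewrite invr_ge0 ltW|exact: ler_norm].
  apply: lt_le_trans (archi_boundP ym) _.
  by rewrite -natrX ler_nat ltnW// ltn_expl.
by have := le_lt_trans (le_trans (yt k) (hm _ (tK k))) hk; rewrite ltxx.
Qed.

End blowup.

(** * Nonexistence of global solutions *)

(** Relates the norm in the hypothesis on the initial datum to the energy at time 0; the integral is
    finite, so nothing is lost in passing to the real-valued one. *)
Lemma Lp_norm_powR (R : realType) (n : nat) (Omega : set 'rV[R]_n) (s : R) (f : 'rV[R]_n -> R) :
  0 < s -> bmb (f \_ Omega) -> (forall x, 0 <= (f \_ Omega) x) ->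
  Lp_norm Omega s%:E f =
  ((\int[lebesgue_rV]_(x in Omega) ((f \_ Omega) x `^ s)) `^ s^-1)%:E.
Proof.
move=> s0 [mf [U hU] [L hL]] f0; rewrite /Lp_norm unlock.
have b : bmb (fun x => (f \_ Omega) x `^ s).
  split; first exact: (measurableT_comp (measurable_powR s) mf).
  - exists (U `^ s) => x; rewrite ger0_norm ?powR_ge0//; apply: ler_powRl; [exact: ltW|exact: f0|].
    exact: le_trans (ler_norm _) (hU x).
  - by exists L => x /hL ->; rewrite powR0// gt_eqF.
rewrite -poweR_EFin; congr (_ `^ _)%E.
rewrite -(@Rintegral_support R _ _ lebesgue_rV setT Omega (fun x => (f \_ Omega) x `^ s)) //; last first.
  by move=> x _ nO; rewrite /patch memNset// powR0// gt_eqF.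
rewrite /Rintegral fineK; last exact: (integrable_fin_num measurableT (bmb_integrable b)).
by apply: eq_integral => x _ /=; rewrite ger0_norm.
Qed.

Section nonexistence.
Context (R : realType) (n : nat).
Let V := 'rV[R]_n.
Local Notation mu := (@lebesgue_rV R n).
Variables (Omega : set V) (p q r L : R).
Hypotheses (n0 : (0 < n)%N) (oO : open Omega) (bO : bounded_set Omega).
Hypotheses (p2 : 2 < p) (pq : p < q) (rE : r = q / (q - p)).
Hypotheses (L0 : 0 < L) (OL : forall x, Omega x -> `|x| <= L).

Let q0 : 0 < q. Proof. by move: p2 pq; lra. Qed.
Let r0 : 0 < r. Proof. by rewrite rE divr_gt0// subr_gt0. Qed.
Let r1 : 1 < r.
Proof.
rewrite -subr_gt0 (_ : r - 1 = p / (q - p)); first by rewrite divr_gt0 ?subr_gt0//; move: p2; lra.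
by rewrite rE; field; rewrite gt_eqF// subr_gt0.
Qed.
Let r10 : 0 < r + 1. Proof. by rewrite addr_gt0. Qed.

Let m := fine (mu Omega).
Let m0 : 0 <= m. Proof. by rewrite fine_ge0. Qed.
(** Chosen so that [k * m <= 1/2]; adding 1 to the volume [m] makes the denominator positive at
    once. *)
Let k : R := (2 * (m + 1))^-1.
Let k0 : 0 < k. Proof. by rewrite /k invr_gt0 mulr_gt0// ltr_wpDl. Qed.
Let B := (r + q) * L.
Let c1 := (4 * (B * (2 * B) `^ (q - 1)))^-1.
Let c10 : 0 < c1.
Proof.
have B0 : 0 < B by rewrite mulr_gt0// addr_gt0.
by rewrite /c1 invr_gt0 mulr_gt0// mulr_gt0// powR_gt0// mulr_gt0.
Qed.

(** The [alpha] of the differential inequality: for [K^(r+1) = k v], the factor [K^(q-1)] of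
    [dissipation_bound] becomes [(k v)^alpha]. *)
Definition blowup_exponent := (q - 1) / (r + 1).
(** The constants [c] and, next, [C] of [y' >= c y^(1+alpha) - C]. The factor [r + 1] comes from
    differentiating [u^(r+1)], and the division by 2 from the half of [v] left after subtracting
    [k v m]. *)
Definition blowup_rate := (r + 1) * (c1 * k `^ blowup_exponent / 2).
Definition blowup_loss := (r + 1) * (r * (2 * r) `^ (r - 1) * m).

Lemma blowup_exponent_gt0 : 0 < blowup_exponent.
Proof. by rewrite divr_gt0//; move: p2 pq; lra. Qed.

Lemma blowup_rate_gt0 : 0 < blowup_rate.
Proof. by rewrite mulr_gt0// divr_gt0// mulr_gt0// powR_gt0. Qed.

Lemma blowup_loss_ge0 : 0 <= blowup_loss.
Proof.
by apply: mulr_ge0; [exact: ltW|apply: mulr_ge0 => //; apply: mulr_ge0; [exact: ltW|exact: powR_ge0]].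
Qed.

(* Take [K^(r+1) = k v] in [dissipation_bound], so that [K^(r+1) |Omega| <= v / 2]. *)
Lemma dissipation_superlinear (f : V -> R) (G : V -> V) (M U v : R) :
  continuous f -> (forall x, 0 <= f x) -> (forall x, ~ Omega x -> f x = 0) ->
  coord_lipschitz M f -> (forall i, measurable_fun Omega (fun x => G x ord0 i)) ->
  (forall x, enorm (G x) <= M) -> is_weak_gradient Omega f G -> (forall x, f x <= U) ->
  0 < v -> v <= \int[mu]_(x in Omega) (f x `^ (r + 1)) ->
  (r + 1)^-1 * (blowup_rate * v `^ blowup_exponent * v - blowup_loss) <= dissipation Omega f G p q r.
Proof.
move=> cf f0 fO fM mG GM wG fU v0 vE; pose K := (v * k) `^ (r + 1)^-1.
have vk : 0 < v * k by rewrite mulr_gt0.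
have K0 : 0 < K by rewrite powR_gt0.
have E1 : K `^ (r + 1) = v * k by rewrite -powRrM mulVf ?gt_eqF// powRr1// ltW.
have E2 : K `^ (q - 1) = v `^ blowup_exponent * k `^ blowup_exponent.
  rewrite -powRM ?(ltW v0) ?(ltW k0)// /K -powRrM; congr (_ `^ _); exact: mulrC.
have := dissipation_bound oO bO cf f0 fO fM mG GM wG fU (erefl B) p2 pq rE L0 n0 OL K0.
apply: le_trans; rewrite -/c1 -/m E1 E2.
have km : v * k * m <= v / 2.
  rewrite -mulrA; apply: ler_wpM2l; first exact: ltW.
  rewrite /k invfM -mulrA; apply: ler_piMr => //.
  by rewrite ler_pdivrMl ?mulr1 ?lerDl// ltr_wpDl.
have -> : (r + 1)^-1 * (blowup_rate * v `^ blowup_exponent * v - blowup_loss) =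
    c1 * (v `^ blowup_exponent * k `^ blowup_exponent * (v / 2)) - r * (2 * r) `^ (r - 1) * m.
  by rewrite /blowup_rate /blowup_loss; field; rewrite gt_eqF.
rewrite lerD2r; apply: ler_wpM2l; first exact: ltW.
apply: ler_wpM2l; first by rewrite mulr_ge0 ?powR_ge0.
by move: km vE; set E := Rintegral _ _ _; lra.
Qed.

(** The threshold is the one of [superlinear_blowup] for these constants. Each growth estimate on
    [[t1, t2]] uses the weak formulation on the longer interval []0, t2 + 1[], which leaves room
    after [t2]. *)
Lemma no_large_solution (z : V -> R) (u : R -> V -> R) :
  C0bar Omega z -> global_weak_solution Omega p q z u ->
  ~ 2 * (1 + 2 * blowup_loss / blowup_rate) < energy Omega r u 0.
Proof.
move=> [_ zO] [cu u0 ub ui hT].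
(* A solution is required to vanish on the boundary for [t > 0] only; at [t = 0] this comes from the
   initial datum. *)
have uO t x : 0 <= t -> boundary Omega x -> u t x = 0.
  rewrite le_eqVlt => /predU1P[<-|t0] bx; last exact: ub.
  by have [cx _] := bx; rewrite ui// zO.
apply: (superlinear_blowup blowup_exponent_gt0 blowup_rate_gt0 blowup_loss_ge0).
  by move=> T T0; exact: energy_continuous.
move=> t1 t2 v t10 t12 v0 hv.
have T0 : 0 < t2 + 1 by rewrite addr_gt0// (lt_trans t10).
have t2T : t2 < t2 + 1 by rewrite ltrDl.
have [W Hid] := hT _ T0.
have [U U0 hU] := zext_bound bO cu (t2 + 1).
have := energy_growth oO bO p2 q0 r1 T0 cu u0 uO W
  (fun psi tpsi => Hid psi (test_in_H10 oO bO tpsi)) t10 t12 t2T.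
move=> /(_ ((r + 1)^-1 * (blowup_rate * v `^ blowup_exponent * v - blowup_loss))) h.
rewrite -(ler_pM2l (_ : 0 < (r + 1)^-1)) ?invr_gt0// mulrA; apply: h.
move=> s M G s12 lip mG GM wG; have [s1 s2] := andP s12.
have s0 : 0 <= s by apply: le_trans s1; exact: ltW.
apply: (dissipation_superlinear (U := U) (zext_continuous oO cu uO s0)
  (fun x => zext_ge0 u0 x s0) (fun x => @zext_out _ _ _ u s x) lip mG GM wG _ v0 (hv s s12)).
by move=> x; apply: hU; rewrite s0 (le_trans s2)// ltW.
Qed.

End nonexistence.

Theorem proposition5p3 (R : realType) (N : nat) (Omega : set 'rV[R]_N)
    (p q : R) (hN : (0 < N)%N) (hOmega : is_domain Omega)
    (hbounded : bounded_set Omega) (hboundary : C2_boundary Omega)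
    (hp : 2 < p) (hq : p < q) :
  let r := q / (q - p) in
  exists2 kappa : R, 0 < kappa &
    forall u0 : 'rV[R]_N -> R,
      C0bar Omega u0 ->
      (forall x, closure Omega x -> 0 <= u0 x) ->
      (exists2 x, closure Omega x & u0 x != 0) ->
      (kappa%:E < Lp_norm Omega (r + 1)%:E u0)%E ->
      ~ exists u : R -> 'rV[R]_N -> R, global_weak_solution Omega p q u0 u.
Proof.
move=> r; have [_ oO _] := hOmega; have [L0 L00 OL0] := bounded_setP hbounded.
pose L := L0 + 1; have L_gt0 : 0 < L by rewrite ltr_wpDl.
have OL x : Omega x -> `|x| <= L by move=> /OL0 h; apply: le_trans h _; rewrite lerDl.
have r0 : 0 < r by rewrite divr_gt0 ?subr_gt0//; lra.
have r10 : 0 < r + 1 by rewrite addr_gt0.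
have c0 := @blowup_rate_gt0 R N Omega p q r L hp hq erefl L_gt0.
have C0 := @blowup_loss_ge0 R N Omega p q r hp hq erefl.
pose b := 2 * (1 + 2 * blowup_loss Omega r / blowup_rate Omega q r L).
have b0 : 0 < b.
  apply: mulr_gt0 => //; apply: ltr_wpDr => //; apply: divr_ge0; last exact: ltW.
  exact: mulr_ge0.
(* [b] is the energy threshold, and the norm is the [(r+1)]-th root of the energy at time 0. *)
exists (b `^ (r + 1)^-1); first by rewrite powR_gt0.
move=> u0 hu0 u00 _ hk [u hu]; have [cu u_ge0 ub ui _] := hu.
apply: (no_large_solution hN oO hbounded hp hq (erefl r) L_gt0 OL hu0 hu).
rewrite -/b.
have uO t x : 0 <= t -> boundary Omega x -> u t x = 0.
  rewrite le_eqVlt => /predU1P[<-|t0] bx; last exact: ub.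
  by have [cx _] := bx; have [_ zO] := hu0; rewrite ui// zO.
have E0 : u0 \_ Omega = zext Omega u 0.
  apply/funext => x; rewrite /zext /patch; case: ifPn => // /set_mem Ox.
  by rewrite ui//; exact: subset_closure.
have b1 : bmb (u0 \_ Omega).
  rewrite E0; apply: (profile_bmb hbounded); first exact: zext_continuous.
  by move=> x; exact: zext_out.
have p0 x : 0 <= (u0 \_ Omega) x by rewrite E0; exact: zext_ge0.
move: hk; rewrite Lp_norm_powR// lte_fin E0 => hk.
rewrite ltNge; apply/negP => h; move: hk; rewrite ltNge => /negP; apply.
apply: ler_powRl; [by rewrite invr_ge0 ltW| |exact: h].
by apply: Rintegral_ge0 => x _; exact: powR_ge0.
Qed.
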